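(* Let $(\mathcal E,\mathfrak a,\mathfrak b)$ be a quasi-twilled Lie conformal algebra with structure $\Omega=\widehat\psi+\widehat\nu_1+\widehat\nu_2$. Set $$L:=\bigoplus_{n\ge0}\mathscr C^{n+1}(\mathcal E,\mathcal E),\qquad F:=\bigoplus_{n\ge0}\mathscr C^{n+1}(\mathfrak a,\mathfrak b),$$ let $\mathbf P:L\to L$ be the projection onto $F$, and set $\Delta:=\Omega$. Then $(L,F,\mathbf P,\Delta)$ is a curved $V$-data, and the resulting curved $L_\infty$-algebra on $F$ is $\bigl(\bigoplus_{n\ge0}\mathscr C^{n+1}(\mathfrak a,\mathfrak b),l_0,l_1,l_2\bigr)$ with $$l_0=\widehat\psi,\qquad l_1(f)=[\widehat\nu_1,\widehat f\,]_{NR},\qquad l_2(f,g)=[[\widehat\nu_2,\widehat f\,]_{NR},\widehat g\,]_{NR}$$ for all $f\in\mathscr C^m(\mathfrak a,\mathfrak b)$, $g\in\mathscr C^n(\mathfrak a,\mathfrak b)$, and $l_k=0$ for $k\ge3$. Moreover, a $\mathbb C[\partial]$-module homomorphism $D:\mathfrak a\to\mathfrak b$ is a right deformation map of $(\mathcal E,\mathfrak a,\mathfrak b)$ if and only if $D$ is a Maurer-Cartan element of this curved $L_\infty$-algebra: $$l_0+l_1(D)+\tfrac12l_2(D,D)=0.$$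
   Context: All vector spaces and linear maps are over $\mathbb C$, and all $\mathbb C[\partial]$-modules are finitely generated. A Lie conformal algebra is a $\mathbb C[\partial]$-module $\mathcal E$ with a $\mathbb C$-linear map $\mathcal E\otimes\mathcal E\to\mathcal E[\lambda]$, $x\otimes y\mapsto\{x_\lambda y\}$, such that $\{\partial x_\lambda y\}=-\lambda\{x_\lambda y\}$, $\{x_\lambda\partial y\}=(\partial+\lambda)\{x_\lambda y\}$, $\{x_\lambda y\}=-\{y_{-\lambda-\partial}x\}$ and $\{x_\lambda\{y_\mu z\}\}=\{\{x_\lambda y\}_{\lambda+\mu}z\}+\{y_\mu\{x_\lambda z\}\}$. The subscript $-\lambda-\partial$ means that the formal variable is replaced by $-\lambda-\partial$, with $\partial$ acting from the left on the coefficients. A quasi-twilled Lie conformal algebra $(\mathcal E,\mathfrak a,\mathfrak b)$ is a Lie conformal algebra $\mathcal E$ with a decomposition $\mathcal E=\mathfrak a\oplus\mathfrak b$ of $\mathbb C[\partial]$-modules such that $\mathfrak b$ is a Lie conformal subalgebra. With $\mathrm{pr}_{\mathfrak a},\mathrm{pr}_{\mathfrak b}$ the projections, for $a,b\in\mathfrak a$, $u,v\in\mathfrak b$ set $\{a_\lambda b\}_{\mathfrak a}=\mathrm{pr}_{\mathfrak a}\{a_\lambda b\}$, $\psi_{1,\lambda}(a,b)=\mathrm{pr}_{\mathfrak b}\{a_\lambda b\}$, $\varrho_{\mathfrak b}(u)_\lambda a=\mathrm{pr}_{\mathfrak a}\{u_\lambda a\}$, $\varrho_{\mathfrak a}(a)_\lambda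 v=\mathrm{pr}_{\mathfrak b}\{a_\lambda v\}$, $\{u_\lambda v\}_{\mathfrak b}=\{u_\lambda v\}$. A right deformation map is a $\mathbb C[\partial]$-module homomorphism $D:\mathfrak a\to\mathfrak b$ whose graph $\{(a,D(a))\mid a\in\mathfrak a\}$ is a Lie conformal subalgebra of $\mathcal E$. Cochains: for $\mathbb C[\partial]$-modules $M,N$ and $k\ge1$, $\mathscr C^k(M,N)$ is the space of $\mathbb C$-linear maps $\varphi:M^{\otimes k}\to\mathbb C[\lambda_1,\dots,\lambda_{k-1}]\otimes N$ such that, with $\lambda_k^\ddagger:=-\sum_{j=1}^{k-1}\lambda_j-\partial$ ($\partial$ acting on $N$ from the left), (i) $\varphi(\dots,\partial a_i,\dots)=-\lambda_i\varphi(\dots,a_i,\dots)$ for $1\le i\le k-1$ and $\varphi(\dots,\partial a_k)=-\lambda_k^\ddagger\varphi(\dots,a_k)$; (ii) for every permutation $\sigma$, $\varphi_{\lambda_1,\dots,\lambda_{k-1}}(a_1,\dots,a_k)=(-1)^\sigma\varphi_{\lambda_{\sigma(1)},\dots,\lambda_{\sigma(k-1)}}(a_{\sigma(1)},\dots,a_{\sigma(k)})|_{\lambda_k\mapsto\lambda_k^\ddagger}$. In particular $\mathscr C^1(M,N)=\mathrm{Hom}_{\mathbb C[\partial]}(M,N)$. Nijenhuis-Richardson bracket: for $f\in\mathscr C^m(\mathcal E,\mathcal E)$, $g\in\mathscr C^n(\mathcal E,\mathcal E)$, $[f,g]_{NR}:=f\star g-(-1)^{(m-1)(n-1)}g\star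 f\in\mathscr C^{m+n-1}(\mathcal E,\mathcal E)$, where $$(f\star g)_{\lambda_1,\dots,\lambda_{m+n-2}}(x_1,\dots,x_{m+n-1})=\sum_{\sigma}(-1)^\sigma f_{\lambda_{\sigma(1)}+\cdots+\lambda_{\sigma(n)},\lambda_{\sigma(n+1)},\dots,\lambda_{\sigma(m+n-2)}}\bigl(g_{\lambda_{\sigma(1)},\dots,\lambda_{\sigma(n-1)}}(x_{\sigma(1)},\dots,x_{\sigma(n)}),x_{\sigma(n+1)},\dots,x_{\sigma(m+n-1)}\bigr)\big|_{\lambda_{m+n-1}\mapsto\lambda_{m+n-1}^\ddagger},$$ summed over $(n,m-1)$-unshuffles $\sigma$ (i.e. $\sigma(1)<\dots<\sigma(n)$ and $\sigma(n+1)<\dots<\sigma(m+n-1)$). With $\mathscr C^{n+1}(\mathcal E,\mathcal E)$ in degree $n$, this is a graded Lie algebra. Components of the structure: $\Omega\in\mathscr C^2(\mathcal E,\mathcal E)$ is the $\lambda$-bracket of $\mathcal E$, and $\Omega=\widehat\psi+\widehat\nu_1+\widehat\nu_2$ with $\widehat\psi_\lambda((a,u),(b,v))=(0,\psi_{1,\lambda}(a,b))$, $\widehat\nu_{1,\lambda}((a,u),(b,v))=(\{a_\lambda b\}_{\mathfrak a},\varrho_{\mathfrak a}(a)_\lambda v-\varrho_{\mathfrak a}(b)_{-\lambda-\partial}u)$, $\widehat\nu_{2,\lambda}((a,u),(b,v))=(\varrho_{\mathfrak b}(u)_\lambda b-\varrho_{\mathfrak b}(v)_{-\lambda-\partial}a,\{u_\lambda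 v\}_{\mathfrak b})$. For $f\in\mathscr C^k(\mathfrak a,\mathfrak b)$, the lift $\widehat f\in\mathscr C^k(\mathcal E,\mathcal E)$ is $\widehat f((a_1,u_1),\dots,(a_k,u_k))=(0,f(a_1,\dots,a_k))$; $F$ is identified with its image in $L$ under $f\mapsto\widehat f$ (with $\mathscr C^{n+1}(\mathfrak a,\mathfrak b)$ in degree $n$). The projection $\mathbf P$ sends $h\in\mathscr C^k(\mathcal E,\mathcal E)$ to the lift of $\mathrm{pr}_{\mathfrak b}\circ h|_{\mathfrak a^{\otimes k}}$. A curved $V$-data is a quadruple $(L,F,\mathbf P,\Delta)$ where $L$ is a graded Lie algebra, $F$ an abelian graded Lie subalgebra, $\mathbf P:L\to L$ a projection with image $F$ whose kernel is a graded Lie subalgebra, and $\Delta\in L^1$ with $[\Delta,\Delta]=0$. By Voronov's construction, the resulting curved $L_\infty$-algebra on $F$ has $l_0=\mathbf P(\Delta)$ and $l_k(f_1,\dots,f_k)=\mathbf P([\cdots[[\Delta,f_1],f_2],\cdots,f_k])$. Here a curved $L_\infty$-algebra on a graded space $F$ (in Voronov's convention) is a family of graded symmetric multilinear maps $l_k:F^{\otimes k}\to F$, $k\ge0$, of degree $1$ (with $l_0\in F^1$) such that for all $n\ge0$ and homogeneous $v_1,\dots,v_n$, $\sum_{i=0}^n\sum_{\sigma}\varepsilon(\sigma)\,l_{n-i+1}(l_i(v_{\sigma(1)},\dots,v_{\sigma(i)}),v_{\sigma(i+1)},\dots,v_{\sigma(n)})=0$, the inner sum being over $(i,n-i)$-unshuffles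 and $\varepsilon(\sigma)$ the Koszul sign. A Maurer-Cartan element is a degree $0$ element $\alpha$ with $\sum_{k\ge0}\frac1{k!}l_k(\alpha,\dots,\alpha)=0$. *)

(* Defs.v *)
From HB Require Import structures.
From mathcomp Require Import all_boot all_order all_algebra all_fingroup.
From mathcomp Require Import finmap complex.
From mathcomp Require Import boolp functions reals.
From mathcomp.multinomials Require Import monalg.

Set Implicit Arguments.
Unset Strict Implicit.
Unset Printing Implicit Defensive.

Import GRing.Theory.
Local Open Scope ring_scope.

(* A K[∂]-module is an [lmodType {poly K}]: ∂ acts as ['X *: _] and a scalar
   c of K acts as [c%:P *: _]. *)

Definition fin_gen (A : pzRingType) (M : lmodType A) : Prop :=
  exists (n : nat) (g : 'I_n -> M),
    forall x : M, exists c : 'I_n -> A, x = \sum_(i < n) c i *: g i.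

(* -------------------------------------------------------------------------- *)
(* Polynomials in the formal variables λ_0, λ_1, λ_2, ... with coefficients in
   N, as finitely supported functions from monomials to N. For a K[∂]-module N
   they form a module over K[∂][λ_0, λ_1, ...], see [lact] below. *)

Definition lpoly (N : zmodType) : Type := {malg N[{cmonom nat}]}.

HB.instance Definition _ (N : zmodType) := GRing.Zmodule.on (lpoly N).

Definition lcoef (N : zmodType) (p : lpoly N) (m : {cmonom nat}) : N :=
  mcoeff m p.

Definition lsupp (N : zmodType) (p : lpoly N) : {fset {cmonom nat}} := msupp p.

Definition lmono (N : zmodType) (x : N) (m : {cmonom nat}) : lpoly N :=
  << x *g m >>.

Definition lconst (N : zmodType) (x : N) : lpoly N :=
  lmono x (@mone {cmonom nat}).

(* The operations on N[λ] are locked: conversion must not unfold them. *)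
HB.lock Definition lmap (N N' : zmodType) (h : N -> N') (p : lpoly N) :
    lpoly N' :=
  \sum_(m <- lsupp p) lmono (h (lcoef p m)) m.

Lemma lpolyP (N : zmodType) (p q : lpoly N) :
  (forall m, lcoef p m = lcoef q m) -> p = q.
Proof. by move=> pq; apply/(@malgP _ N p q). Qed.

Lemma lcoefD (N : zmodType) (p q : lpoly N) m :
  lcoef (p + q) m = lcoef p m + lcoef q m.
Proof. exact: (@mcoeffD _ N m p q). Qed.

Lemma lcoef_map (N N' : zmodType) (h : N -> N') (h0 : h 0 = 0) (p : lpoly N) m :
  lcoef (lmap h p) m = h (lcoef p m).
Proof.
rewrite /lcoef lmap.unlock /lmono /lsupp raddf_sum /=.
under eq_bigr => i _ do rewrite mcoeffU.
have [mp|mp] := boolP (m \in msupp p).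
  rewrite (bigD1_seq m mp (fset_uniq _)) eqxx mulr1n.
  rewrite big1 => [|i ne]; first exact: addr0.
  by rewrite (negPf ne).
rewrite (mcoeff_outdom mp) h0 big_seq big1 // => i ip.
by case: eqP => // im; move: mp; rewrite -im ip.
Qed.

Section LPolyScale.
Variables (K : fieldType) (N : lmodType {poly K}).

Definition lscale (c : K) (p : lpoly N) : lpoly N :=
  lmap (fun x : N => c%:P *: x) p.

Lemma lcoef_scale c (p : lpoly N) m : lcoef (lscale c p) m = c%:P *: lcoef p m.
Proof. exact: (lcoef_map (scaler0 N c%:P)). Qed.

Fact lscaleA a b (p : lpoly N) : lscale a (lscale b p) = lscale (a * b) p.
Proof. by apply: lpolyP => m; rewrite !lcoef_scale scalerA polyCM. Qed.

Fact lscale1 : left_id 1 lscale.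
Proof. by move=> p; apply: lpolyP => m; rewrite lcoef_scale scale1r. Qed.

Fact lscaleDr : right_distributive lscale +%R.
Proof.
by move=> c p q; apply: lpolyP => m; rewrite lcoefD !lcoef_scale lcoefD scalerDr.
Qed.

Fact lscaleDl (p : lpoly N) : {morph lscale^~ p : a b / a + b}.
Proof.
by move=> a b; apply: lpolyP => m; rewrite lcoefD !lcoef_scale polyCD scalerDl.
Qed.

HB.instance Definition _ := GRing.Zmodule_isLmodule.Build K (lpoly N)
  lscaleA lscale1 lscaleDr lscaleDl.

End LPolyScale.

(* K[∂][λ_0, λ_1, ...] *)
Definition lring (K : fieldType) := {malg {poly K}[{cmonom nat}]}.

Definition lam {K : fieldType} (i : nat) : lring K := << ucm i >>.
Definition del {K : fieldType} : lring K := 'X%:MP.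

(* p only involves λ_0, ..., λ_(k-1). *)
Definition in_vars (N : zmodType) (k : nat) (p : lpoly N) : Prop :=
  forall m i, m \in lsupp p -> (k <= i)%N -> m i = 0%N.

(* The action of K[∂][λ] on N[λ], where ∂ acts on the coefficients. *)
HB.lock Definition lact (K : fieldType) (N : lmodType {poly K})
    (q : lring K) (p : lpoly N) : lpoly N :=
  \sum_(m <- msupp q) \sum_(m' <- lsupp p)
     lmono (q@_m *: lcoef p m') (mmul m m').

(* The substitution λ_i ↦ s i; every ∂ occurring in s i acts from the left on
   the coefficients of p. *)
HB.lock Definition lsubst (K : fieldType) (N : lmodType {poly K})
    (s : nat -> lring K) (p : lpoly N) : lpoly N :=
  \sum_(m <- lsupp p)
     lact (\prod_(i <- finsupp m) s i ^+ m i) (lconst (lcoef p m)).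

(* The K[λ]-linear extension of f to M[λ] *)
HB.lock Definition lext (K : fieldType) (M N : lmodType {poly K})
    (f : M -> lpoly N) (q : lpoly M) : lpoly N :=
  \sum_(m <- lsupp q) lact (<< m >> : lring K) (f (lcoef q m)).

(* -------------------------------------------------------------------------- *)

Section LieConformal.
Variable K : fieldType.

Definition br_at (E : lmodType {poly K}) (br : E -> E -> lpoly E)
    (s : lring K) (x y : E) : lpoly E :=
  lsubst (fun _ => s) (br x y).

(* {x_λ y} is stored as a polynomial in λ_0. *)
Record lie_conformal (E : lmodType {poly K}) (br : E -> E -> lpoly E) : Prop :=
  LieConformal {
  lc_vars : forall x y, in_vars 1 (br x y);
  lc_linl : forall (c : K) x x' y,
    br (c%:P *: x + x') y = c *: br x y + br x' y;
  lc_linr : forall (c : K) x y y',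
    br x (c%:P *: y + y') = c *: br x y + br x y';
  lc_sesql : forall x y, br ('X *: x) y = lact (- lam 0) (br x y);
  lc_sesqr : forall x y, br x ('X *: y) = lact (del + lam 0) (br x y);
  lc_skew : forall x y, br x y = - br_at br (- lam 0 - del) y x;
  lc_jacobi : forall x y z,
    lext (br_at br (lam 0) x) (br_at br (lam 1) y z) =
      lext (fun w => br_at br (lam 0 + lam 1) w z) (br_at br (lam 0) x y)
      + lext (br_at br (lam 1) y) (br_at br (lam 0) x z) }.

Record conformal_subalgebra (E : lmodType {poly K}) (br : E -> E -> lpoly E)
    (S : E -> Prop) : Prop := ConformalSubalgebra {
  cs_0 : S 0;
  cs_lin : forall (c : {poly K}) x y, S x -> S y -> S (c *: x + y);
  cs_br : forall x y m, S x -> S y -> S (lcoef (br x y) m) }.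

End LieConformal.

(* -------------------------------------------------------------------------- *)
(* A K-linear map φ : M^(⊗k) -> N[λ] is encoded as the function on sequences
   that maps [:: a_1; ...; a_k] to φ(a_1, ..., a_k) and every sequence of
   another length to 0; an element of ⊕_k C^k(M, N) is then a single function
   on sequences. The variables λ_1, λ_2, ... are numbered from 0. *)

Definition mcochain (K : fieldType) (M N : lmodType {poly K}) : lmodType K :=
  (seq M -> lpoly N).

Section Cochains.
Variable K : fieldType.
Implicit Types M N : lmodType {poly K}.

(* λ_k^‡ = - Σ_(j < k) λ_j - ∂ *)
Definition ldag (k : nat) : lring K := - \sum_(j < k.-1) lam j - del.

(* λ_k ↦ λ_k^‡ *)
Definition sub_dag (k i : nat) : lring K :=
  if i == k.-1 then ldag k else lam i.

Definition permute M k (s : 'S_k) (a : k.-tuple M) : seq M :=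
  [seq tnth a (s i) | i <- enum 'I_k].

(* φ_{s_1, s_2, ...}(a) *)
Definition eval_at M N (phi : mcochain M N) (s : seq (lring K)) (a : seq M) :
    lpoly N :=
  lsubst (nth 0 s) (phi a).

Record is_cochain M N (k : nat) (phi : mcochain M N) : Prop := IsCochain {
  co_arity : forall a : seq M, size a <> k -> phi a = 0;
  co_vars : forall a : seq M, in_vars k.-1 (phi a);
  co_lin : forall (a1 a2 : seq M) (c : K) (x y : M),
    (size a1 + size a2).+1 = k ->
    phi (a1 ++ (c%:P *: x + y) :: a2) =
      c *: phi (a1 ++ x :: a2) + phi (a1 ++ y :: a2);
  co_sesq : forall (a1 a2 : seq M) (x : M),
    (size a1 + size a2).+1 = k ->
    phi (a1 ++ 'X *: x :: a2) =
      lact (- sub_dag k (size a1)) (phi (a1 ++ x :: a2));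
  co_skew : forall (s : 'S_k) (a : k.-tuple M),
    phi a = (-1) ^+ s *:
      lsubst (sub_dag k)
        (eval_at phi (take k.-1 [seq lam (s i) | i : 'I_k]) (permute s a)) }.

Definition cochain1 M N (D : M -> N) : mcochain M N :=
  fun a => if a is [:: x] then lconst (D x) else 0.

Definition cochain2 M N (B : M -> M -> lpoly N) : mcochain M N :=
  fun a => if a is [:: x; y] then B x y else 0.

Definition unshuffle (p k : nat) (s : 'S_k) : bool :=
  [forall i : 'I_k, forall j : 'I_k,
     ((i < j) && ((j < p) || (p <= i)))%N ==> (s i < s j)%N].

(* f ⋆ g for f of arity m and g of arity n *)
Definition star E (m n : nat) (f g : mcochain E E) : mcochain E E :=
  fun x =>
    let k := (m + n).-1 in
    if size x != k then 0 else
    lsubst (sub_dag k) (\sum_(s : 'S_k | unshuffle n s)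
      (-1) ^+ s *:
        (let ls : seq (lring K) := [seq lam (s i) | i : 'I_k] in
         let xs := [seq nth 0 x (s i) | i : 'I_k] in
         lext (fun y : E =>
                 eval_at f (take m.-1 ((\sum_(l <- take n ls) l) :: drop n ls))
                   (y :: drop n xs))
           (eval_at g (take n.-1 ls) (take n xs)))).

Definition NR_hom E (m n : nat) (f g : mcochain E E) : mcochain E E :=
  star m n f g - (-1) ^+ (m.-1 * n.-1) *: star n m g f.

(* The bilinear extension of the Nijenhuis-Richardson bracket to ⊕_k C^k(E, E):
   in arity k the pairs (p + 1, q + 1) with p + q + 1 = k contribute. As [star]
   only sees the values of f and g on sequences of the right length, this is
   [NR_hom m n f g] when f and g are homogeneous of arities m, n >= 1. *)
Definition NR E (f g : mcochain E E) : mcochain E E :=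
  fun x => \sum_(p < size x) NR_hom p.+1 (size x - p) f g x.

End Cochains.

(* -------------------------------------------------------------------------- *)
(* ℕ-graded spaces are given by their homogeneous components G n inside an
   ambient space V; the graded space itself is [dsum G]. *)

Section Graded.
Variables (K : fieldType) (V : lmodType K).
Implicit Types (G L F : nat -> V -> Prop) (br : V -> V -> V).

Definition dsum G (x : V) : Prop :=
  exists (k : nat) (y : nat -> V), (forall i, G i (y i)) /\ x = \sum_(i < k) y i.

Record graded_space G : Prop := GradedSpace {
  gs_0 : forall n, G n 0;
  gs_lin : forall n (c : K) x y, G n x -> G n y -> G n (c *: x + y);
  gs_direct : forall (k : nat) (y : nat -> V), (forall i, G i (y i)) ->
    \sum_(i < k) y i = 0 -> forall i, (i < k)%N -> y i = 0 }.

Record graded_lie L br : Prop := GradedLie {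
  gl_space : graded_space L;
  gl_linl : forall (c : K) x x' y, dsum L x -> dsum L x' -> dsum L y ->
    br (c *: x + x') y = c *: br x y + br x' y;
  gl_linr : forall (c : K) x y y', dsum L x -> dsum L y -> dsum L y' ->
    br x (c *: y + y') = c *: br x y + br x y';
  gl_deg : forall m n x y, L m x -> L n y -> L (m + n)%N (br x y);
  gl_skew : forall m n x y, L m x -> L n y ->
    br x y = - ((-1) ^+ (m * n) *: br y x);
  gl_jacobi : forall m n p x y z, L m x -> L n y -> L p z ->
    br x (br y z) = br (br x y) z + (-1) ^+ (m * n) *: br y (br x z) }.

Record curved_V_data L br F (P : V -> V) (Delta : V) : Prop := CurvedVData {
  cv_lie : graded_lie L br;
  cv_F_space : graded_space F;
  cv_F_sub : forall n x, F n x -> L n x;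
  cv_F_abelian : forall m n x y, F m x -> F n y -> br x y = 0;
  cv_P_lin : forall (c : K) x y, dsum L x -> dsum L y ->
    P (c *: x + y) = c *: P x + P y;
  cv_P_idem : forall x, dsum L x -> P (P x) = P x;
  cv_P_image : forall n y, F n y <-> exists x, L n x /\ P x = y;
  cv_P_ker : forall m n x y, L m x -> L n y -> P x = 0 -> P y = 0 ->
    P (br x y) = 0;
  cv_Delta : L 1 Delta;
  cv_Delta2 : br Delta Delta = 0 }.

(* The sign ε with v_(σ 1) ... v_(σ k) = ε v_1 ... v_k for v_i of degree d i *)
Definition koszul (k : nat) (d : 'I_k -> nat) (s : 'S_k) : K :=
  \prod_(i < k) \prod_(j < k | (i < j)%N && (s j < s i)%N)
     (-1) ^+ (d (s i) * d (s j)).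

Definition permuted (k : nat) (s : 'S_k) (v : 'I_k -> V) : seq V :=
  [seq v (s i) | i : 'I_k].

(* All the maps l_k at once: l [:: v_1; ...; v_k] is l_k(v_1, ..., v_k). *)
Record curved_Linfty F (l : seq V -> V) : Prop := CurvedLinfty {
  ci_space : graded_space F;
  ci_lin : forall (s1 s2 : seq V) (c : K) x y,
    (forall i, (i < size s1)%N -> dsum F (nth 0 s1 i)) ->
    (forall i, (i < size s2)%N -> dsum F (nth 0 s2 i)) ->
    dsum F x -> dsum F y ->
    l (s1 ++ (c *: x + y) :: s2) = c *: l (s1 ++ x :: s2) + l (s1 ++ y :: s2);
  ci_deg : forall (k : nat) (d : 'I_k -> nat) (v : 'I_k -> V),
    (forall i, F (d i) (v i)) ->
    F (\sum_(i < k) d i).+1 (l [seq v i | i : 'I_k]);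
  ci_sym : forall (k : nat) (d : 'I_k -> nat) (v : 'I_k -> V) (s : 'S_k),
    (forall i, F (d i) (v i)) ->
    l (permuted s v) = koszul d s *: l [seq v i | i : 'I_k];
  ci_rel : forall (n : nat) (d : 'I_n -> nat) (v : 'I_n -> V),
    (forall i, F (d i) (v i)) ->
    \sum_(i < n.+1) \sum_(s : 'S_n | unshuffle i s)
       koszul d s *:
         l (l (take i (permuted s v)) :: drop i (permuted s v)) = 0 }.

Definition voronov (P : V -> V) br (Delta : V) (fs : seq V) : V :=
  P (foldl br Delta fs).

(* The sum over k >= 0 is required to have finitely many nonzero terms. *)
Definition maurer_cartan F (l : seq V -> V) (alpha : V) : Prop :=
  F 0%N alpha /\
  exists n : nat,
    (forall k, (n <= k)%N -> l (nseq k alpha) = 0) /\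
    \sum_(k < n) (k`!%:R)^-1 *: l (nseq k alpha) = 0.

End Graded.

(* -------------------------------------------------------------------------- *)

Section QuasiTwilled.
Variables (K : fieldType) (A B : lmodType {poly K}).

Let E : lmodType {poly K} := (A * B)%type.

Variable br : E -> E -> lpoly E.

Definition inA (a : A) : E := (a, 0).
Definition inB (u : B) : E := (0, u).
Definition prA (x : E) : A := x.1.
Definition prB (x : E) : B := x.2.

Record quasi_twilled : Prop := QuasiTwilled {
  qt_lie : lie_conformal br;
  qt_B : conformal_subalgebra br (fun x => exists u : B, x = inB u) }.

Definition right_deformation_map (D : {linear A -> B}) : Prop :=
  conformal_subalgebra br (fun x => exists a : A, x = (a, D a)).

Definition brA (a b : A) : lpoly A := lmap prA (br (inA a) (inA b)).
Definition psi1 (a b : A) : lpoly B := lmap prB (br (inA a) (inA b)).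
Definition rhoB (u : B) (a : A) : lpoly A := lmap prA (br (inB u) (inA a)).
Definition rhoA (a : A) (v : B) : lpoly B := lmap prB (br (inA a) (inB v)).
Definition brB (u v : B) : lpoly B := lmap prB (br (inB u) (inB v)).

(* The pair (p, q) of A[λ] × B[λ] seen in (A × B)[λ] *)
Definition lpair (p : lpoly A) (q : lpoly B) : lpoly E :=
  lmap inA p + lmap inB q.

(* λ_0 ↦ - λ_0 - ∂ *)
Definition flip (N : lmodType {poly K}) (p : lpoly N) : lpoly N :=
  lsubst (fun _ => - lam 0 - del) p.

Definition Omega : mcochain E E := cochain2 br.

Definition psi_hat : mcochain E E :=
  cochain2 (fun x y : E => lpair 0 (psi1 (prA x) (prA y))).

Definition nu1_hat : mcochain E E :=
  cochain2 (fun x y : E =>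
    lpair (brA (prA x) (prA y))
          (rhoA (prA x) (prB y) - flip (rhoA (prA y) (prB x)))).

Definition nu2_hat : mcochain E E :=
  cochain2 (fun x y : E =>
    lpair (rhoB (prB x) (prA y) - flip (rhoB (prB y) (prA x)))
          (brB (prB x) (prB y))).

Definition hat (f : mcochain A B) : mcochain E E :=
  fun x => lpair 0 (f (map prA x)).

(* ⊕_n C^(n+1)(E, E) *)
Definition Lgr (n : nat) (h : mcochain E E) : Prop := is_cochain n.+1 h.

(* ⊕_n C^(n+1)(A, B), identified with its image under f ↦ hat f *)
Definition Fgr (n : nat) (h : mcochain E E) : Prop :=
  exists f : mcochain A B, is_cochain n.+1 f /\ h = hat f.

Definition projF (h : mcochain E E) : mcochain E E :=
  hat (fun a => lmap prB (h (map inA a))).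

Definition linf : seq (mcochain E E) -> mcochain E E :=
  voronov projF (@NR K E) Omega.

End QuasiTwilled.

Arguments Lgr {K} A B n h.
Arguments Fgr {K} A B n h.
Arguments projF {K} A B h.

(* Main.v *)
Require Import Defs.
From HB Require Import structures.
From mathcomp Require Import all_boot all_order all_algebra all_fingroup.
From mathcomp Require Import finmap complex.
From mathcomp Require Import boolp functions reals.
From mathcomp.multinomials Require Import monalg.

(** Why the theorem holds.

    Cochains without λ. The computation rules of the variables λ_1, λ_2, ... and
    of λ_k^‡ disappear once a cochain F of arity k is realized as a map [rho F]
    on weighted vectors (s_i, x_i), a weight s_i standing for the value of λ_i:
    its value is the functional that sends a test function phi to
    F_{s_1, ..., s_(k-1)}(x_1, ..., x_k), pushed through
    phi(s_1 + ... + s_k, -). If phi is sesquilinear, phi(s, ∂x) = - s phi(s, x),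
    then ∂ acts as minus the total weight and λ_k^‡ becomes s_k. The conditions
    on F turn into plain alternation and sesquilinearity in one slot
    ([rho_multimap], [cochain_of_multimap]), the product [star] turns into the
    signed insertion product [pstar] ([rho_star]), and F is recovered at the
    weights λ_1, ..., λ_(k-1), λ_k^‡ ([rho_dag]). Contraction with a weighted
    vector is a graded derivation of [pstar]; by induction on the number of
    arguments this gives the graded pre-Lie identity ([pstar_prelie]), whence
    the graded Jacobi identity of the Nijenhuis-Richardson bracket
    ([NR_jacobi]). The Jacobi identity of the λ-bracket says that Omega * Omega
    vanishes ([star_br]). The remaining conditions of a curved V-data are
    vanishing statements: two lifts cannot be inserted into each other
    ([NR_hat]), and the kernel of the projection is closed under the product
    ([projF_star]).

    Weights. The module automorphism (a, u) |-> (a, 2 u) of the direct sum gives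
    psi, nu1, nu2 and every lift the weights 2, 1, 1/2 and 2 ([wt]), and the
    bracket multiplies weights ([NR_wt]). In characteristic 0 the projection is
    the identity on weight 2 and zero on every other weight that occurs
    ([wt2_fixed], [projF_wt]). Thus only psi, [nu1, f] and [[nu2, f], g] survive
    in the higher derived brackets ([linfE]). In the same way [Omega, Omega] = 0
    splits into its homogeneous components ([Omega_components]); bracketed with
    elements of F these are the generalized Jacobi identities, which for
    operations of arity at most 2 are not trivial only up to three arguments
    ([binary_rel], [binary_Linfty]).

    Deformation maps. The bracket of a binary h with a module map d is
    h(d x, y) + h(x, d y) - d h(x, y) ([NR_map]). Expanding the Maurer-Cartan sum
    of D at (a, b) therefore gives pr_b {X, Y} - D pr_a {X, Y} for the elements
    X = (a, D a) and Y = (b, D b) of the graph ([mc_value]), and this vanishes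
    for all a and b exactly if the graph is closed under the bracket. *)

Set Implicit Arguments.
Unset Strict Implicit.
Unset Printing Implicit Defensive.

Import GRing.Theory.
Local Open Scope ring_scope.

Local Notation mon := {cmonom nat}.

(** * Polynomials with coefficients in a module *)

Section SupportSums.
Variables (N W : zmodType) (G : mon -> N -> W).
Hypothesis GD : forall m x y, G m (x + y) = G m x + G m y.

Let G0 m : G m 0 = 0.
Proof. by apply: (addrI (G m 0)); rewrite -GD !addr0. Qed.

Lemma msum_widen (D : {fset mon}) (p : lpoly N) : (lsupp p `<=` D)%fset ->
  \sum_(m <- lsupp p) G m (lcoef p m) = \sum_(m <- D) G m (lcoef p m).
Proof.
move=> le; apply: (big_fset_incl _ le) => m _ /mcoeff_outdom.
by rewrite /lcoef => ->.
Qed.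

(** The supports of [p], [q] and [p + q] differ; all three sums are extended to
    the union of the first two, where the additivity of [G] applies. *)
Lemma msumD (p q : lpoly N) :
  \sum_(m <- lsupp (p + q)) G m (lcoef (p + q) m) =
  \sum_(m <- lsupp p) G m (lcoef p m) + \sum_(m <- lsupp q) G m (lcoef q m).
Proof.
have lep := fsubsetUl (lsupp p) (lsupp q).
have leq := fsubsetUr (lsupp p) (lsupp q).
rewrite (msum_widen (msuppD_le p q)) (msum_widen lep) (msum_widen leq).
by rewrite -big_split; apply: eq_bigr => m _; rewrite lcoefD GD.
Qed.

Lemma msum_mono x m0 :
  \sum_(m <- lsupp (lmono x m0)) G m (lcoef (lmono x m0) m) = G m0 x.
Proof.
rewrite (msum_widen (@msuppU_le mon N m0 x)) big_seq_fset1.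
by rewrite /lcoef /lmono mcoeffUU.
Qed.

Lemma msum0 : \sum_(m <- lsupp (0 : lpoly N)) G m (lcoef 0 m) = 0.
Proof. by rewrite /lsupp msupp0 big_seq_fset0. Qed.

End SupportSums.

Lemma lmonoD (N : zmodType) (x y : N) m :
  lmono (x + y) m = lmono x m + lmono y m.
Proof. exact: monalgUD. Qed.

Lemma lpolyE (N : zmodType) (p : lpoly N) :
  p = \sum_(m <- lsupp p) lmono (lcoef p m) m.
Proof. exact: monalgE. Qed.

(** A locked copy of [lmono]: two different closed monomials over [lring K] must
    not be compared by unfolding them. *)
HB.lock Definition umono (N : zmodType) (x : N) (m : mon) : lpoly N := lmono x m.

Lemma umonoE (N : zmodType) (x : N) m : umono x m = lmono x m.
Proof. by rewrite umono.unlock. Qed.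

Lemma lcoef_umono (N : zmodType) (x : N) m m' :
  lcoef (umono x m) m' = if m == m' then x else 0.
Proof. by rewrite umonoE /lcoef mcoeffU; case: eqP. Qed.

Lemma umonoD (N : zmodType) (x y : N) m :
  umono (x + y) m = umono x m + umono y m.
Proof. by rewrite umono.unlock lmonoD. Qed.

Lemma lpoly_ind (N : zmodType) (P : lpoly N -> Prop) :
  P 0 -> (forall p q, P p -> P q -> P (p + q)) ->
  (forall x m, P (umono x m)) -> forall p, P p.
Proof.
rewrite umono.unlock => P0 PD PU p; rewrite (lpolyE p).
by elim: (X in \sum_(m <- X) _) => [|m r IH]; rewrite ?big_nil ?big_cons //; apply: PD.
Qed.

Section Action.
Variables (K : fieldType) (N : lmodType {poly K}).
Implicit Types (q : lring K) (p : lpoly N).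

Lemma lactDl q q' p : lact (q + q') p = lact q p + lact q' p.
Proof.
rewrite lact.unlock.
apply: (@msumD _ _ (fun m (a : {poly K}) => \sum_(m' <- lsupp p)
   lmono (a *: lcoef p m') (mmul m m'))) => m x y.
by rewrite -big_split; apply: eq_bigr => m' _; rewrite scalerDl lmonoD.
Qed.

Lemma lactDr q p p' : lact q (p + p') = lact q p + lact q p'.
Proof.
rewrite lact.unlock -big_split; apply: eq_bigr => m _ /=.
apply: (@msumD _ _ (fun m' (x : N) => lmono (q@_m *: x) (mmul m m'))) => m' x y.
by rewrite scalerDr lmonoD.
Qed.

Lemma lact_mono (a : {poly K}) m (x : N) m' :
  lact (umono a m : lring K) (umono x m') = umono (a *: x) (mmul m m').
Proof.
rewrite umono.unlock lact.unlock.
rewrite (@msum_mono _ _ (fun m (a : {poly K}) => \sum_(m'' <- lsupp (lmono x m'))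
   lmono (a *: lcoef (lmono x m') m'') (mmul m m''))); last first.
  by move=> *; rewrite -big_split; apply: eq_bigr => ? _; rewrite scalerDl lmonoD.
apply: (@msum_mono _ _ (fun m' (x : N) => lmono (a *: x) (mmul m m'))) => ? ? ?.
by rewrite scalerDr lmonoD.
Qed.

Lemma umono_mul (a b : {poly K}) m m' :
  (umono a m : lring K) * (umono b m' : lring K) = umono (a * b) (mmul m m').
Proof. by rewrite umono.unlock; exact: (fgmulUU a b m m'). Qed.

Lemma umono1 : umono 1 mone = 1 :> lring K.
Proof. by rewrite umono.unlock; exact: mpolyC1E. Qed.

Lemma lact1 p : lact 1 p = p.
Proof.
elim/lpoly_ind: p => [|p p' IH IH'|x m].
- by apply: (addrI (lact 1 0)); rewrite -lactDr !addr0.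
- by rewrite lactDr IH IH'.
- by rewrite -umono1 lact_mono scale1r mul1m.
Qed.

Lemma lact0r q : lact q (0 : lpoly N) = 0.
Proof. by apply: (addrI (lact q 0)); rewrite -lactDr !addr0. Qed.

Lemma lact0l p : lact 0 p = 0.
Proof. by apply: (addrI (lact 0 p)); rewrite -lactDl !addr0. Qed.

Lemma lactA q q' p : lact q (lact q' p) = lact (q * q') p.
Proof.
elim/lpoly_ind: p => [|p p' IH IH'|x m]; rewrite ?lact0r ?lactDr ?IH ?IH' //.
elim/(@lpoly_ind {poly K}): q' => [|p p' IH IH'|a' m'].
- by rewrite lact0l lact0r mulr0 lact0l.
- by rewrite mulrDr !lactDl lactDr IH IH'.
elim/(@lpoly_ind {poly K}): q => [|p p' IH IH'|a'' m''].
- by rewrite mul0r !lact0l.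
- by rewrite mulrDl !lactDl IH IH'.
by rewrite !lact_mono umono_mul lact_mono scalerA mulmA.
Qed.
End Action.

(** [lpoly N] already carries the scalars of [K]; this alias carries those of
    [lring K], so that evaluations into any module over a commutative ring
    also cover substitutions. *)
Definition smod (K : fieldType) (N : lmodType {poly K}) : Type := lpoly N.

HB.instance Definition _ (K : fieldType) (N : lmodType {poly K}) :=
  GRing.Zmodule.on (smod N).
HB.instance Definition _ (K : fieldType) (N : lmodType {poly K}) :=
  GRing.Zmodule_isLmodule.Build (lring K) (smod N)
   (fun a b v => lactA a b v) (fun v => lact1 v) (fun a u v => lactDr a u v)
   (fun v a b => lactDl a b v).

(** * Substitutions *)

Definition mev (S : comNzRingType) (s : nat -> S) (m : mon) : S :=
  \prod_(i <- finsupp m) s i ^+ m i.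

Section MonomialValue.
Variables (S : comNzRingType) (s : nat -> S).

Lemma mev_widen (D : {fset nat}) (m : mon) : (finsupp m `<=` D)%fset ->
  mev s m = \prod_(i <- D) s i ^+ m i.
Proof.
move=> le; apply: (big_fset_incl _ le) => i _.
by rewrite memNfinsupp => /eqP ->.
Qed.

Lemma mevM m m' : mev s (mmul m m') = mev s m * mev s m'.
Proof.
have le1 := fsubsetUl (finsupp m) (finsupp m').
have le2 := fsubsetUr (finsupp m) (finsupp m').
have le3 : (finsupp (mmul m m') `<=` finsupp m `|` finsupp m')%fset.
  by rewrite mdomD fsubset_refl.
rewrite (mev_widen le1) (mev_widen le2) (mev_widen le3) -big_split.
by apply: eq_bigr => i _; rewrite cmM exprD.
Qed.

Lemma mev1 : mev s mone = 1.
Proof. by rewrite /mev mdom1 big_seq_fset0. Qed.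

Lemma mevU i : mev s (ucm i) = s i.
Proof. by rewrite /mev mdomU big_seq_fset1 cmUU expr1. Qed.

Lemma eq_mev (s' : nat -> S) (m : mon) :
  (forall i, m i != 0%N -> s i = s' i) -> mev s m = mev s' m.
Proof.
by move=> ss; apply: eq_big_seq => i; rewrite -cmE_neq0 => /ss ->.
Qed.

End MonomialValue.

Lemma mev_morph (S S' : comNzRingType) (g : S -> S') s m :
  g 1 = 1 -> (forall x y, g (x * y) = g x * g y) ->
  g (mev s m) = mev (g \o s) m.
Proof.
move=> g1 gM; rewrite /mev (big_morph g gM g1); apply: eq_bigr => i _ /=.
by elim: (m i) => [|n IH]; rewrite ?expr0 // !exprS gM IH.
Qed.

(** The monomials are the free commutative monoid on the variables, by induction
    on the degree. *)
Lemma mev_unique (S : comNzRingType) (h : mon -> S) :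
  h mone = 1 -> (forall m m', h (mmul m m') = h m * h m') ->
  forall m, h m = mev (h \o @ucm nat) m.
Proof.
move=> h1 hM m; have [n] := ubnP (mdeg m); elim: n m => // n IH m lt_mn.
have [->|] := eqVneq m mone; first by rewrite h1 mev1.
rewrite -mdeg_eq0 mdegE; case: (finsupp m =P fset0) => [->|/eqP].
  by rewrite big_seq_fset0.
case/fset0Pn => i; rewrite -cmE_neq0 => mi _.
have em : m = mmul (ucm i) (divcm m (ucm i)).
  apply/eqP/cmP => j; rewrite cmM divcmE cmU.
  by case: eqP => [<-|_]; rewrite ?subn0 // subnKC ?lt0n.
have lt : (mdeg (divcm m (ucm i)) < n)%N.
  by move: lt_mn; rewrite {1}em mdegM mdegU add1n ltnS.
by rewrite em hM mevM mevU (IH _ lt).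
Qed.

Lemma lamE (K : fieldType) i : lam i = umono 1 (ucm i) :> lring K.
Proof. by rewrite umono.unlock. Qed.

Lemma mev_lam (K : fieldType) (m : mon) : mev (@lam K) m = umono 1 m.
Proof.
have -> : mev (@lam K) m = mev ((fun m => umono 1 m : lring K) \o @ucm nat) m.
  by apply: eq_mev => i _; rewrite /= lamE.
apply/esym/(@mev_unique (lring K) (fun m => umono 1 m)) => [|m1 m2].
  exact: umono1.
by rewrite umono_mul mulr1.
Qed.

Section PolyValue.
Variables (K : fieldType) (S : comNzRingType) (f : {rmorphism K -> S}).

Definition polyev (t : S) : {poly K} -> S := horner_eval t \o map_poly f.
HB.instance Definition _ t := GRing.RMorphism.on (polyev t).

Lemma polyevC t c : polyev t c%:P = f c.
Proof. by rewrite /polyev /= map_polyC /horner_eval hornerC. Qed.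

Lemma polyevX t : polyev t 'X = t.
Proof. by rewrite /polyev /= map_polyX /horner_eval hornerX. Qed.
End PolyValue.

HB.instance Definition _ (S : comNzRingType) (s : nat -> S) :=
  monalg.isMultiplicative.Build {cmonom nat} S (mev s) (conj (mevM s) (mev1 s)).

(** * Evaluations *)

Section Evaluation.
Variables (K : fieldType) (S : comNzRingType) (f : {rmorphism K -> S}).
Variables (N : lmodType {poly K}) (H : lmodType S).
Implicit Types (s : nat -> S) (t : S) (h : N -> H) (p : lpoly N).

(** [h] is a module map if ['X] acts on its target as [t]: this is what makes the
    evaluation of [lact q p] depend on [q] through [lsub] only. *)
Definition dlinear t h :=
  forall a x y, h (a *: x + y) = polyev f t a *: h x + h y.

(** The common form of substitution ([h] = [lconst]), extension ([s] = [lam]) and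
    the realization of cochains below: every λ_i is sent to [s i] and the
    coefficients are sent through [h]. *)
Definition leval s h p : H := \sum_(m <- lsupp p) mev s m *: h (lcoef p m).

Definition lsub s t : lring K -> S := mmap (polyev f t) (mev s).

Lemma lsub0 s t : lsub s t 0 = 0. Proof. exact: raddf0. Qed.
Lemma lsub1 s t : lsub s t 1 = 1. Proof. exact: rmorph1. Qed.
Lemma lsubD s t q q' : lsub s t (q + q') = lsub s t q + lsub s t q'.
Proof. exact: raddfD. Qed.
Lemma lsubN s t q : lsub s t (- q) = - lsub s t q.
Proof. exact: raddfN. Qed.
Lemma lsubM s t q q' : lsub s t (q * q') = lsub s t q * lsub s t q'.
Proof. exact: rmorphM. Qed.

Lemma lsub_mono s t a m : lsub s t (umono a m) = polyev f t a * mev s m.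
Proof. by rewrite umono.unlock; exact: mmapU. Qed.

Lemma lsub_lam s t i : lsub s t (lam i) = s i.
Proof. by rewrite lamE lsub_mono rmorph1 mul1r mevU. Qed.

Lemma lsub_cst s t a : lsub s t a%:MP = polyev f t a.
Proof.
have -> : a%:MP = umono a mone :> lring K by rewrite umono.unlock.
by rewrite lsub_mono mev1 mulr1.
Qed.

Lemma lsub_del s t : lsub s t del = t.
Proof. by rewrite lsub_cst polyevX. Qed.

Lemma eq_leval s s' h h' p :
  s =1 s' -> h =1 h' -> leval s h p = leval s' h' p.
Proof.
move=> ss hh; apply: eq_bigr => m _; rewrite hh; congr (_ *: _).
by apply: eq_mev => i _.
Qed.

Lemma leval_in_vars k s s' h p : in_vars k p ->
  (forall i, (i < k)%N -> s i = s' i) -> leval s h p = leval s' h p.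
Proof.
move=> vp ss; apply: eq_big_seq => m mp; congr (_ *: _).
apply: eq_mev => i; case: (ltnP i k) => [/ss //|/(vp _ _ mp) -> //].
Qed.

Lemma leval0 s h : leval s h 0 = 0.
Proof. exact: (@msum0 N H (fun m x => mev s m *: h x)). Qed.

Lemma leval_h0 s p : leval s (fun=> 0) p = 0.
Proof. by apply: big1 => m _; rewrite scaler0. Qed.

Lemma leval_hD s h h' p :
  leval s (fun x => h x + h' x) p = leval s h p + leval s h' p.
Proof. by rewrite -big_split; apply: eq_bigr => m _; rewrite scalerDr. Qed.

Lemma leval_hZ s c h p : leval s (fun x => c *: h x) p = c *: leval s h p.
Proof.
rewrite /leval scaler_sumr.
by apply: eq_bigr => m _; rewrite !scalerA mulrC.
Qed.

Section Additive.
Variables (s : nat -> S) (h : N -> H).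
Hypothesis hD : forall x y, h (x + y) = h x + h y.

Lemma levalD p q : leval s h (p + q) = leval s h p + leval s h q.
Proof.
apply: (@msumD N H (fun m x => mev s m *: h x)) => m x y.
by rewrite hD scalerDr.
Qed.

Lemma leval_mono x m : leval s h (umono x m) = mev s m *: h x.
Proof.
rewrite umono.unlock; apply: (@msum_mono N H (fun m x => mev s m *: h x)) => m' x' y'.
by rewrite hD scalerDr.
Qed.

Lemma levalN p : leval s h (- p) = - leval s h p.
Proof. by apply/eqP; rewrite -addr_eq0 -levalD addNr leval0. Qed.

Lemma leval_sum I r (P : pred I) (F : I -> lpoly N) :
  leval s h (\sum_(i <- r | P i) F i) = \sum_(i <- r | P i) leval s h (F i).
Proof. exact: (big_morph _ levalD (leval0 s h)). Qed.

End Additive.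

Section Semilinear.
Variables (t : S) (h : N -> H).
Hypothesis hh : dlinear t h.

Lemma dlinearD x y : h (x + y) = h x + h y.
Proof. by rewrite -[in LHS](scale1r x) hh rmorph1 scale1r. Qed.

Lemma dlinear0 : h 0 = 0.
Proof. by apply: (addrI (h 0)); rewrite -dlinearD !addr0. Qed.

Lemma dlinearZ a x : h (a *: x) = polyev f t a *: h x.
Proof. by rewrite -[a *: x]addr0 hh dlinear0 addr0. Qed.

Lemma leval_lact s q p : leval s h (lact q p) = lsub s t q *: leval s h p.
Proof.
have hD := dlinearD.
elim/lpoly_ind: p => [|p p' IH IH'|x m].
- by rewrite lact0r leval0 scaler0.
- by rewrite lactDr !levalD // IH IH' scalerDr.
elim/(@lpoly_ind {poly K}): q => [|q q' IH IH'|a m'].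
- by rewrite lact0l leval0 lsub0 scale0r.
- by rewrite lactDl lsubD scalerDl levalD // IH IH'.
rewrite lact_mono !leval_mono // lsub_mono dlinearZ !scalerA mevM.
by congr (_ *: _); rewrite mulrC -!mulrA; congr (_ * _); rewrite mulrC.
Qed.

End Semilinear.

Lemma dlinear_gen t h :
  (forall c x y, h (c%:P *: x + y) = f c *: h x + h y) ->
  (forall x, h ('X *: x) = t *: h x) -> dlinear t h.
Proof.
move=> hC hX.
have hD x y : h (x + y) = h x + h y.
  by rewrite -[in LHS](scale1r x) -polyC1 hC rmorph1 scale1r.
have h0 : h 0 = 0 by apply: (addrI (h 0)); rewrite -hD !addr0.
move=> a x y; rewrite hD; congr (_ + _).
elim/poly_ind: a x => [|a c IH] x; first by rewrite rmorph0 !scale0r h0.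
rewrite scalerDl addrC hC -scalerA IH hX rmorphD rmorphM /= polyevX polyevC.
by rewrite scalerDl scalerA addrC.
Qed.

End Evaluation.

#[global] Hint Resolve dlinearD : core.

Lemma in_vars0 (M : zmodType) k : in_vars k (0 : lpoly M).
Proof. by move=> m i; rewrite /lsupp msupp0 in_fset0. Qed.

Lemma in_varsD (M : zmodType) k (p q : lpoly M) : in_vars k p -> in_vars k q -> in_vars k (p + q).
Proof.
move=> vp vq m i mpq; have /fsubsetP/(_ _ mpq) := msuppD_le p q.
by rewrite in_fsetU => /orP [/vp|/vq]; apply.
Qed.

(** * Constants, substitution and extension as evaluations *)

Section LambdaRing.
Variable K : fieldType.

Definition lcst : K -> lring K := (fun a : {poly K} => a%:MP) \o polyC.
HB.instance Definition _ := GRing.RMorphism.on lcst.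

Lemma polyev_del (a : {poly K}) : polyev lcst del a = a%:MP.
Proof.
elim/poly_ind: a => [|a c IH]; first by rewrite !rmorph0.
by rewrite !rmorphD !rmorphM /= polyevX polyevC IH.
Qed.

Variable N : lmodType {poly K}.
Implicit Types p : lpoly N.

Lemma lconstE (x : N) : lconst x = umono x mone.
Proof. by rewrite umono.unlock. Qed.

Lemma lconst_dlinear : dlinear lcst del (@lconst N : N -> smod N).
Proof.
move=> a x y; rewrite polyev_del !lconstE umonoD; congr (_ + _).
have -> : a%:MP = umono a mone :> lring K by rewrite umono.unlock.
by apply: etrans (esym (lact_mono a mone x mone)); rewrite mul1m.
Qed.

Lemma lconstD (x y : N) : lconst (x + y) = lconst x + lconst y.
Proof. by rewrite !lconstE umonoD. Qed.

Lemma lsubstE (s : nat -> lring K) p :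
  lsubst s p = leval s (@lconst N : N -> smod N) p.
Proof. by rewrite lsubst.unlock. Qed.

Lemma lextE (M : lmodType {poly K}) (g : M -> lpoly N) q :
  lext g q = leval (@lam K) (g : M -> smod N) q.
Proof.
rewrite lext.unlock; apply: eq_bigr => m _.
by rewrite mev_lam umono.unlock.
Qed.

Lemma lscaleE (c : K) p : c *: p = lact (lcst c) p.
Proof.
elim/lpoly_ind: p => [|p p' IH IH'|x m]; first by rewrite scaler0 lact0r.
  by rewrite scalerDr IH IH' lactDr.
have -> : lcst c = umono c%:P mone by rewrite umono.unlock.
rewrite lact_mono mul1m; apply: lpolyP => m'.
by rewrite lcoef_scale !lcoef_umono; case: eqP; rewrite ?scaler0.
Qed.

Lemma leval_scale (S : comNzRingType) (f : {rmorphism K -> S}) (H : lmodType S)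
    s t (h : N -> H) (c : K) p :
  dlinear f t h -> leval s h (c *: p) = f c *: leval s h p.
Proof.
move=> hh; rewrite lscaleE (leval_lact hh).
by congr (_ *: _); rewrite /lcst /= lsub_cst polyevC.
Qed.

(** Evaluating after an evaluation is evaluating once: all interchange rules
    between substitution and extension are instances. *)
Lemma leval_comp (S : comNzRingType) (f : {rmorphism K -> S}) (H : lmodType S)
    (M : lmodType {poly K}) s t (h : N -> H) (u : nat -> lring K)
    (g : M -> smod N) (q : lpoly M) :
  dlinear f t h ->
  leval s h (leval u g q) = leval (lsub f s t \o u) (leval s h \o g) q.
Proof.
move=> hh; rewrite leval_sum; last exact: dlinearD hh.
apply: eq_bigr => m _; rewrite -(mev_morph _ _ (lsub1 f s t) (lsubM f s t)).
exact: (leval_lact hh s (mev u m)).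
Qed.

Lemma leval_lconst (S : comNzRingType) (f : {rmorphism K -> S}) (H : lmodType S)
    s t (h : N -> H) x :
  dlinear f t h -> leval s h (lconst x) = h x.
Proof.
move=> hh; rewrite lconstE.
by rewrite (leval_mono _ (dlinearD hh)) mev1 scale1r.
Qed.

Lemma leval_lsubst (S : comNzRingType) (f : {rmorphism K -> S}) (H : lmodType S)
    s t (h : N -> H) u p :
  dlinear f t h ->
  leval s h (lsubst u p) = leval (lsub f s t \o u) h p.
Proof.
move=> hh; rewrite lsubstE (leval_comp _ _ _ _ hh).
by apply: eq_leval => // x; apply: leval_lconst hh.
Qed.

Lemma lsubst_lam p : lsubst lam p = p.
Proof.
rewrite lsubstE [RHS]lpolyE; apply: eq_bigr => m _; rewrite mev_lam.
rewrite -umonoE lconstE.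
by apply: etrans (lact_mono 1 m _ mone) _; rewrite scale1r mulmC mul1m.
Qed.

Lemma lsubst_in_vars k s p : in_vars k p ->
  (forall i, (i < k)%N -> s i = lam i) -> lsubst s p = p.
Proof.
move=> vp ss; rewrite -[RHS]lsubst_lam (lsubstE s) (lsubstE lam).
exact: (@leval_in_vars K (lring K) N (smod N) k s lam (@lconst N) p vp ss).
Qed.

Lemma in_vars_umono k (x : N) (m : mon) :
  (forall i, m i != 0%N -> (i < k)%N) -> in_vars k (umono x m).
Proof.
move=> lt m' i; rewrite /lsupp umonoE => /(fsubsetP msuppU_le).
rewrite in_fset1 => /eqP ->.
by case: (m i =P 0%N) => // /eqP /lt; rewrite ltnNge => /negP.
Qed.

End LambdaRing.

(** * Signed combinations in abelian groups *)

(** Signs are carried by booleans, so that an identity between signs is a case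
    analysis on parities. *)
Definition sg (V : zmodType) (b : bool) (v : V) : V := if b then - v else v.

Lemma sg0 (V : zmodType) b : sg b (0 : V) = 0.
Proof. by case: b; rewrite /sg ?oppr0. Qed.

Lemma sgD (V : zmodType) b (u v : V) : sg b (u + v) = sg b u + sg b v.
Proof. by case: b; rewrite /sg ?opprD. Qed.

Lemma sg_scale (R : pzRingType) (V : lmodType R) n (v : V) :
  (-1) ^+ n *: v = sg (odd n) v.
Proof. by rewrite -signr_odd /sg; case: (odd n); rewrite ?scaleN1r ?scale1r. Qed.

(** Linear identities in an abelian group are decided by comparing the integer
    coefficients of the atoms. *)
Inductive zexp := ZVar of nat | ZZero | ZAdd of zexp & zexp | ZOpp of zexp.

Fixpoint zeval (V : zmodType) (e : seq V) x : V :=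
  match x with
  | ZVar i => nth 0 e i | ZZero => 0
  | ZAdd x y => zeval e x + zeval e y | ZOpp x => - zeval e x
  end.

Fixpoint zcoef i x : int :=
  match x with
  | ZVar j => Posz (i == j) | ZZero => Posz 0
  | ZAdd x y => intZmod.addz (zcoef i x) (zcoef i y)
  | ZOpp x => intZmod.oppz (zcoef i x)
  end.

Lemma zevalE (V : zmodType) (e : seq V) x :
  zeval e x = \sum_(i < size e) nth 0 e i *~ zcoef i x.
Proof.
elim: x => [j||x IHx y IHy|x IH] /=.
- have [lt|ge] := ltnP j (size e).
    rewrite (bigD1 (Ordinal lt)) //= eqxx mulr1z big1 ?addr0 // => i.
    by rewrite -val_eqE /= => /negPf ->; rewrite mulr0z.
  rewrite nth_default // big1 // => i _.
  by rewrite (ltn_eqF (leq_trans (ltn_ord i) ge)) mulr0z.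
- by rewrite big1 // => i _; rewrite mulr0z.
- by rewrite IHx IHy -big_split; apply: eq_bigr => i _; apply/esym/mulrzDr_tmp.
- by rewrite IH -sumrN; apply: eq_bigr => i _; apply/esym/mulrNz.
Qed.

Lemma zeval_eq (V : zmodType) (e : seq V) x y :
  all (fun i => zcoef i x == zcoef i y) (iota 0 (size e)) ->
  zeval e x = zeval e y.
Proof.
move=> /allP h; rewrite !zevalE; apply: eq_bigr => i _; congr (_ *~ _).
by apply/eqP/h; rewrite mem_iota /=.
Qed.

Ltac zindex x l :=
  lazymatch l with
  | x :: _ => constr:(0%N)
  | _ :: ?l' => let n := zindex x l' in constr:(S n)
  end.
Ltac zatoms l t :=
  lazymatch t with
  | (?x + ?y)%R => let l1 := zatoms l x in zatoms l1 y
  | (- ?x)%R => zatoms l x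
  | 0%R => l
  | _ => let has := match l with context [t :: _] => constr:(true) | _ => constr:(false) end in
         lazymatch has with true => l | false => constr:(t :: l) end
  end.
Ltac zreify l t :=
  lazymatch t with
  | (?x + ?y)%R => let a := zreify l x in let b := zreify l y in constr:(ZAdd a b)
  | (- ?x)%R => let a := zreify l x in constr:(ZOpp a)
  | 0%R => constr:(ZZero)
  | _ => let n := zindex t l in constr:(ZVar n)
  end.
Ltac zmodule V :=
  lazymatch goal with |- ?x = ?y =>
    let l1 := zatoms (@nil (Algebra.Zmodule.sort V)) x in
    let l := zatoms l1 y in
    let a := zreify l x in let b := zreify l y in
    exact: (@zeval_eq V l a b (erefl true))
  end.

(** * Shuffle sums *)

Section Shuffles.
Variables (Z : Type) (W : zmodType).
Implicit Types G : seq Z -> seq Z -> W.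

(** Sums over [(n, k - n)]-unshuffles, by recursion on the sequence of arguments:
    its first entry opens either the first part or the second, where it has to
    cross the [n] entries of the first. Induction on this form replaces the
    manipulation of permutations. *)
Fixpoint shuf n G (zs : seq Z) {struct zs} : W :=
  match n, zs with
  | 0, _ => G [::] zs
  | _, [::] => 0
  | n'.+1, z :: zs' => shuf n' (fun a b => G (z :: a) b) zs'
                       + sg (odd n) (shuf n (fun a b => G a (z :: b)) zs')
  end.

Lemma shuf0 G zs : shuf 0 G zs = G [::] zs.
Proof. by case: zs. Qed.

Lemma shuf_ind (P : W -> Prop) n G zs :
  P 0 -> (forall u v, P u -> P v -> P (u + v)) -> (forall u, P u -> P (- u)) ->
  (forall a b, size a = n -> (size a + size b)%N = size zs -> P (G a b)) ->
  P (shuf n G zs).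
Proof.
move=> P0 PD PN; elim: zs n G => [|z zs IH] [|n] G PG //=; try exact: PG.
apply: PD; first by apply: IH => a b sa sb; apply: PG; rewrite /= ?sa // -sb sa addSn.
suff: P (shuf n.+1 (fun a b => G a (z :: b)) zs) by case: (odd n) => //=; apply: PN.
by apply: IH => a b sa sb; apply: PG; rewrite //= addnS sb.
Qed.

Lemma eq_shuf n G G' zs :
  (forall a b, size a = n -> (size a + size b)%N = size zs -> G a b = G' a b) ->
  shuf n G zs = shuf n G' zs.
Proof.
elim: zs n G G' => [|z zs IH] [|n] G G' e //=; try exact: e.
congr (_ + sg _ _); apply: IH => a b sa sb; apply: e => //=.
- by rewrite sa.
- by rewrite -sb addSn.
- by rewrite -sb addnS.
Qed.

Lemma shufD n G G' zs :
  shuf n (fun a b => G a b + G' a b) zs = shuf n G zs + shuf n G' zs.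
Proof.
elim: zs n G G' => [|z zs IH] [|n] G G' //=; first by rewrite addr0.
by rewrite !IH sgD addrACA.
Qed.

Lemma shuf_zero n G zs :
  (forall a b, size a = n -> (size a + size b)%N = size zs -> G a b = 0) ->
  shuf n G zs = 0.
Proof.
move=> G0; apply: (shuf_ind (P := fun w => w = 0)) => //.
  by move=> u v -> ->; rewrite addr0.
by move=> u ->; rewrite oppr0.
Qed.

Lemma shufN n G zs : shuf n (fun a b => - G a b) zs = - shuf n G zs.
Proof.
apply/eqP; rewrite -addr_eq0 -shufD shuf_zero // => a b _ _.
by rewrite addNr.
Qed.

End Shuffles.

Lemma shuf_morph (Z : Type) (W W' : zmodType) (h : W -> W') n
    (G : seq Z -> seq Z -> W) zs :
  (forall u v, h (u + v) = h u + h v) ->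
  h (shuf n G zs) = shuf n (fun a b => h (G a b)) zs.
Proof.
move=> hD; have h0 : h 0 = 0 by apply: (addrI (h 0)); rewrite -hD !addr0.
have hN u : h (- u) = - h u.
  by apply/eqP; rewrite -addr_eq0 -hD addNr h0.
elim: zs n G => [|z zs IH] [|n] G //=.
by rewrite hD IH; congr (_ + _); rewrite -IH; case: (~~ odd n); rewrite //= hN.
Qed.

(** * Weighted vectors and functionals on sesquilinear test functions *)

Section Functionals.
Variables (K : fieldType) (S : comNzRingType) (f : {rmorphism K -> S}).
Variables (E : lmodType {poly K}) (H : lmodType S).

Local Notation Z := (S * E)%type.
Local Notation V := ((S * E -> H) -> H).

(** Weighted vectors [(t, x)] stand for an argument [x] together with the value
    [t] of its variable; on a sesquilinear test function ['X] acts on [x] as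
    [- t], which is the first sesquilinearity rule of a cochain. *)
Definition sesq (phi : S * E -> H) : Prop :=
  forall t, dlinear f (- t) (fun x => phi (t, x)).

Lemma sesq0 : sesq (fun=> 0).
Proof. by move=> t a x y; rewrite scaler0 addr0. Qed.

Lemma sesq_lin c phi psi :
  sesq phi -> sesq psi -> sesq (fun z => c *: phi z + psi z).
Proof.
move=> sp sq t a x y; rewrite sp sq 2!scalerDr !scalerA mulrC.
by rewrite addrACA.
Qed.

Lemma sesqN phi : sesq phi -> sesq (fun z => - phi z).
Proof. by move=> sp t a x y; rewrite sp opprD scalerN. Qed.

Lemma sesqD phi psi : sesq phi -> sesq psi -> sesq (fun z => phi z + psi z).
Proof. by move=> sp sq t a x y; rewrite sp sq scalerDr addrACA. Qed.

(** A finite combination of evaluations at weighted vectors. Functionals are set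
    to 0 outside the sesquilinear test functions, so that equality of finite
    functionals is equality of functions. *)
Definition fin (v : V) : Prop := exists r : seq (S * (S * E)), forall phi,
  v phi = if `[< sesq phi >] then \sum_(cz <- r) cz.1 *: phi cz.2 else 0.

Lemma fin_nonsesq v phi : fin v -> ~ sesq phi -> v phi = 0.
Proof. by case=> r -> /asboolPn/negPf ->. Qed.

Lemma fin_sesq v : fin v -> exists r : seq (S * (S * E)), forall phi, sesq phi ->
  v phi = \sum_(cz <- r) cz.1 *: phi cz.2.
Proof. by case=> r vr; exists r => phi /asboolP sp; rewrite vr sp. Qed.

Lemma fin_lin v c phi psi : fin v -> sesq phi -> sesq psi ->
  v (fun z => c *: phi z + psi z) = c *: v phi + v psi.
Proof.
move=> /fin_sesq [r vr] sp sq; rewrite !vr //; last exact: sesq_lin.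
rewrite scaler_sumr -big_split; apply: eq_bigr => cz _ /=.
by rewrite scalerDr !scalerA mulrC.
Qed.

Lemma fin_D v phi psi : fin v -> sesq phi -> sesq psi ->
  v (fun z => phi z + psi z) = v phi + v psi.
Proof.
move=> fv sp sq; rewrite -[v phi]scale1r -(fin_lin 1 fv sp sq).
by congr v; apply/funext => z; rewrite scale1r.
Qed.

Lemma fin_v0 v : fin v -> v (fun=> 0) = 0.
Proof.
move=> /fin_sesq [r ->]; last exact: sesq0.
by apply: big1 => cz _; rewrite scaler0.
Qed.

Lemma fin_vN v phi : fin v -> sesq phi -> v (fun z => - phi z) = - v phi.
Proof.
move=> fv sp; apply/eqP; rewrite -addr_eq0 -fin_D //; last exact: sesqN.
apply/eqP; rewrite -[RHS](fin_v0 fv); congr v.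
by apply/funext => z; rewrite addNr.
Qed.

Lemma fin0 : fin 0.
Proof. by exists [::] => phi; rewrite big_nil if_same. Qed.

Lemma fin_add u v : fin u -> fin v -> fin (u + v).
Proof.
move=> [r ur] [r' vr]; exists (r ++ r') => phi.
have -> : (u + v) phi = u phi + v phi by [].
by rewrite ur vr big_cat; case: (asbool _); rewrite ?addr0.
Qed.

Lemma fin_scale c u : fin u -> fin (fun phi => c *: u phi).
Proof.
move=> [r ur]; exists [seq (c * cz.1, cz.2) | cz <- r] => phi.
rewrite ur big_map; case: (asbool _); rewrite ?scaler0 // scaler_sumr.
by apply: eq_bigr => cz _; rewrite scalerA.
Qed.

Lemma fin_opp u : fin u -> fin (- u).
Proof.
move=> /(fin_scale (-1)); congr fin; apply/funext => phi.
by rewrite scaleN1r.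
Qed.

(** The composition of multilinear maps: finite functionals form a commutative
    monad on weighted vectors, with [bind] as its extension operation. *)
Definition bind (t : Z -> V) (v : V) : V := fun phi => v (fun z => t z phi).

Definition sesqV (t : Z -> V) := forall phi, sesq (fun z => t z phi).

Lemma fin_bind t v :
  (forall z, fin (t z)) -> sesqV t -> fin v -> fin (bind t v).
Proof.
move=> ft st /fin_sesq [r vr].
have -> : bind t v = (fun phi => \sum_(cz <- r) cz.1 *: t cz.2 phi).
  by apply/funext => phi; rewrite /bind vr.
elim: r {vr} => [|cz r IH].
  by have := fin0; congr fin; apply/funext => phi; rewrite big_nil.
have := fin_add (fin_scale cz.1 (ft cz.2)) IH; congr fin.
by apply/funext => phi; rewrite big_cons.
Qed.

(** Commutativity of the monad: two finite sums are exchanged. *)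
Lemma bind_comm (T : Z -> Z -> V) u v : fin u -> fin v ->
  (forall z, sesqV (T z)) -> (forall z, sesqV (T^~ z)) ->
  bind (fun z => bind (T z) u) v = bind (fun y => bind (T^~ y) v) u.
Proof.
move=> /fin_sesq [r ur] /fin_sesq [r' vr] s1 s2.
have e : forall phi, (fun z => bind (T z) u phi) =
    (fun z => \sum_(cy <- r) cy.1 *: T z cy.2 phi).
  by move=> phi; apply/funext => z; rewrite /bind ur //; apply: s1.
have e' : forall phi, (fun y => bind (T^~ y) v phi) =
    (fun y => \sum_(cz <- r') cz.1 *: T cz.2 y phi).
  by move=> phi; apply/funext => y; rewrite /bind vr //; apply: s2.
have ss (q : seq (S * (S * E))) (g : Z -> Z -> H) :
    (forall z, sesq (g z)) -> sesq (fun y => \sum_(cz <- q) cz.1 *: g cz.2 y).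
  move=> sg; elim: q => [|cz q IH].
    by have := sesq0; congr sesq; apply/funext => y; rewrite big_nil.
  have := sesq_lin cz.1 (sg cz.2) IH; congr sesq.
  by apply/funext => y; rewrite big_cons.
apply/funext => phi; rewrite /bind -/(bind _ _) e e' vr; last first.
  by apply: (ss r (fun y z => T z y phi)) => y; apply: s2.
rewrite ur; last by apply: (ss r' (fun z y => T z y phi)) => y; apply: s1.
under eq_bigr do rewrite scaler_sumr.
under [RHS]eq_bigr do rewrite scaler_sumr.
rewrite exchange_big; apply: eq_bigr => cz _; apply: eq_bigr => cy _ /=.
by rewrite !scalerA mulrC.
Qed.

Lemma sesq_bind (T : Z -> Z -> V) v : fin v ->
  (forall z, sesqV (T z)) -> (forall y, sesqV (T^~ y)) ->
  sesqV (fun z => bind (T z) v).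
Proof.
move=> fv s1 s2 phi t c x y; rewrite /bind -fin_lin //; try exact: s1.
by congr v; apply/funext => z; apply: s2.
Qed.

(** * Alternating multilinear maps and the pre-Lie product *)

Record multimap (k : nat) (T : seq Z -> V) : Prop := MultiMap {
  mm_size : forall zs, size zs <> k -> T zs = 0;
  mm_alt : forall a x y b, T (a ++ x :: y :: b) = - T (a ++ y :: x :: b);
  mm_fin : forall zs, fin (T zs);
  mm_sesq : forall zs, sesqV (fun z => T (z :: zs)) }.

Implicit Types (T U X : seq Z -> V).

Definition contr (z : Z) T : seq Z -> V := fun zs => T (z :: zs).

(** The insertion product: one value of [U] goes into the first slot of [T]. *)
Definition pstar n T U : seq Z -> V := fun zs =>
  shuf n (fun a b => bind (fun y => T (y :: b)) (U a)) zs.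

Lemma bind0 t : bind t 0 = 0. Proof. by []. Qed.
Lemma bind_assoc t u v : bind t (bind u v) = bind (fun y => bind t (u y)) v.
Proof. by []. Qed.
Lemma bindDt t t' v : sesqV t -> sesqV t' -> fin v ->
  bind (fun z => t z + t' z) v = bind t v + bind t' v.
Proof. by move=> st st' fv; apply/funext => phi; apply: fin_D. Qed.

Lemma bindNt t v : sesqV t -> fin v -> bind (fun z => - t z) v = - bind t v.
Proof. by move=> st fv; apply/funext => phi; apply: fin_vN. Qed.

Lemma bind0t v : fin v -> bind (fun=> 0) v = 0.
Proof. by move=> fv; apply/funext => phi; apply: fin_v0. Qed.

Lemma multimap0 k : multimap k (fun=> 0).
Proof.
split=> //; first by move=> *; rewrite oppr0.
- by move=> _; apply: fin0.
- by move=> zs phi; apply: sesq0.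
Qed.

Lemma multimap_opp k T : multimap k T -> multimap k (fun zs => - T zs).
Proof.
move=> [sT aT fT lT]; split.
- by move=> zs sz; rewrite sT // oppr0.
- by move=> a x y b; rewrite aT.
- by move=> zs; apply: fin_opp.
- by move=> zs phi; apply: sesqN; apply: lT.
Qed.

Lemma multimap_sg k b T : multimap k T -> multimap k (fun zs => sg b (T zs)).
Proof. by case: b => //= /multimap_opp. Qed.

Lemma contr_multimap k z T : multimap k T -> multimap k.-1 (contr z T).
Proof.
move=> [sT aT fT lT]; split.
- move=> zs sz; apply: sT => /= e; apply: sz; rewrite -e //.
- by move=> a x y b; apply: (aT (z :: a)).
- by move=> zs; apply: fT.
- move=> zs phi; have -> : (fun y => contr z T (y :: zs) phi) =
      (fun y => - T (y :: z :: zs) phi).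
    by apply/funext => y; rewrite /contr (aT [::]).
  by apply: sesqN; apply: lT.
Qed.

Lemma contr0 z T : multimap 0 T -> contr z T = (fun=> 0).
Proof. by case=> sT _ _ _; apply/funext => zs; apply: sT. Qed.

Lemma pstar0r n T : pstar n T (fun=> 0) = (fun=> 0).
Proof. by apply/funext => zs; apply: shuf_zero. Qed.

Lemma pstar0l n k U : multimap k U -> pstar n (fun=> 0) U = (fun=> 0).
Proof.
move=> [_ _ fU _]; apply/funext => zs; apply: shuf_zero => a b _ _.
exact: bind0t.
Qed.

Lemma pstarDr n T U U' :
  pstar n T (fun zs => U zs + U' zs) = fun zs => pstar n T U zs + pstar n T U' zs.
Proof. by apply/funext => zs; rewrite /pstar -shufD. Qed.

Lemma pstarNr n T U : pstar n T (fun zs => - U zs) = fun zs => - pstar n T U zs.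
Proof. by apply/funext => zs; rewrite /pstar -shufN. Qed.

Lemma pstar_sgr n T U b :
  pstar n T (fun zs => sg b (U zs)) = fun zs => sg b (pstar n T U zs).
Proof. by case: b => //=; apply: pstarNr. Qed.

Lemma pstarDl n k k' l T T' U : multimap k T -> multimap k' T' -> multimap l U ->
  pstar n (fun zs => T zs + T' zs) U = fun zs => pstar n T U zs + pstar n T' U zs.
Proof.
move=> [_ _ _ lT] [_ _ _ lT'] [_ _ fU _]; apply/funext => zs.
by rewrite /pstar -shufD; apply: eq_shuf => a b _ _; rewrite -bindDt.
Qed.

Lemma pstarNl n k l T U : multimap k T -> multimap l U ->
  pstar n (fun zs => - T zs) U = fun zs => - pstar n T U zs.
Proof.
move=> [_ _ _ lT] [_ _ fU _]; apply/funext => zs.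
by rewrite /pstar -shufN; apply: eq_shuf => a b _ _; rewrite -bindNt.
Qed.

Lemma pstar_sgl n k l T U c : multimap k T -> multimap l U ->
  pstar n (fun zs => sg c (T zs)) U = fun zs => sg c (pstar n T U zs).
Proof. by case: c => //= mT mU; apply: pstarNl mT mU. Qed.

(** Contraction with a weighted vector is a graded derivation of the product,
    read off from the recursion that defines [shuf]; everything below follows
    from this rule by induction on the arguments. *)
Lemma contr_pstar n k z T U : multimap k T -> multimap n U ->
  contr z (pstar n T U) =
  fun zs => pstar n.-1 T (contr z U) zs + sg (~~ odd n) (pstar n (contr z T) U zs).
Proof.
move=> mT mU; apply/funext => zs.
have e m : pstar m (contr z T) U zs =
    - shuf m (fun a b => bind (fun y => T (y :: z :: b)) (U a)) zs.
  rewrite -shufN; apply: eq_shuf => a b _ _.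
  rewrite -bindNt; [|exact: mm_sesq mT _|exact: mm_fin mU _].
  congr (bind _ (U a)); apply/funext => y; apply: (mm_alt mT [::]).
case: n mU e => [|n] mU e; rewrite e /contr /pstar /=.
  by rewrite !shuf0 (mm_size mU (zs := [:: z])) // bind0 add0r opprK.
by case: (odd n); rewrite //= opprK.
Qed.

Lemma pstar_size m n T U zs : multimap m.+1 T -> multimap n U ->
  size zs <> (m + n)%N -> pstar n T U zs = 0.
Proof.
move=> mT mU sz; apply: shuf_zero => a b sa sb.
have -> : (fun y => T (y :: b)) = (fun=> 0).
  apply/funext => y; apply: (mm_size mT) => /= -[sb']; apply: sz.
  by rewrite -sb sa sb' addnC.
by apply: bind0t; apply: mm_fin mU _.
Qed.

Lemma sesq_shuf n (G : Z -> seq Z -> seq Z -> V) zs :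
  (forall a b, sesqV (fun z => G z a b)) -> sesqV (fun z => shuf n (G z) zs).
Proof.
elim: zs n G => [|z zs IH] [|n] G sG //=; try exact: sG.
  by move=> phi; apply: sesq0.
move=> phi; apply: sesqD; first by apply: IH => a b; apply: sG.
case: (~~ odd n) => /=; first apply: sesqN.
  by apply: (IH n.+1 (fun z' a b => G z' a (z :: b))) => a b; apply: sG.
by apply: (IH n.+1 (fun z' a b => G z' a (z :: b))) => a b; apply: sG.
Qed.

Lemma pstar_fin n k T U zs : multimap k T -> multimap n U -> fin (pstar n T U zs).
Proof.
move=> mT mU; apply: shuf_ind => [|u v|u|a b _ _].
- exact: fin0.
- exact: fin_add.
- exact: fin_opp.
apply: fin_bind; first by move=> z; apply: mm_fin mT _.
- exact: mm_sesq mT _.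
- exact: mm_fin mU _.
Qed.

(** Contractions anticommute on both factors, hence on the product. *)
Lemma pstar_alt n k T U a x y b : multimap k T -> multimap n U ->
  pstar n T U (a ++ x :: y :: b) = - pstar n T U (a ++ y :: x :: b).
Proof.
elim: a n k T U => [|z a IH] n k T U mT mU.
  have e u v : pstar n T U (u :: v :: b) = contr v (contr u (pstar n T U)) b.
    by [].
  have c k' T' u v : multimap k' T' -> contr u (contr v T') =
      fun zs => - contr v (contr u T') zs.
    by move=> mT'; apply/funext => zs; apply: (mm_alt mT' [::]).
  have cT := contr_multimap _ mT; have cU := contr_multimap _ mU.
  have e2 u v : pstar n T U (u :: v :: b) =
      pstar n.-2 T (contr v (contr u U)) b
      + sg (~~ odd n.-1) (pstar n.-1 (contr v T) (contr u U) b)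
      + sg (~~ odd n) (pstar n.-1 (contr u T) (contr v U) b)
      + pstar n (contr v (contr u T)) U b.
    rewrite e (contr_pstar u mT mU) {1}/contr -/(contr v (pstar n.-1 T (contr u U)) b).
    rewrite (contr_pstar v mT (cU u)) -/(contr v (pstar n (contr u T) U) b).
    rewrite (contr_pstar v (cT u) mU) sgD -!addrA; congr (_ + (_ + (_ + _))).
    by case: (~~ odd n); rewrite //= opprK.
  rewrite !e2 (c _ _ x y mT) (c _ _ x y mU) pstarNr.
  rewrite (pstarNl _ (contr_multimap y (cT x)) mU).
  case: n mU cU {e e2} => [|n] mU cU.
    rewrite !(contr0 _ mU) !pstar0r.
    by rewrite !sg0 !addr0 !opprD !oppr0 !add0r opprK.
  move: (pstar n.+1.-2 T _ b) (pstar n.+1.-1 (contr y T) _ b) => A B.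
  move: (pstar n.+1.-1 (contr x T) _ b) (pstar n.+1 _ U b) => C D.
  by rewrite /=; case: (odd n) => /=; zmodule (V : zmodType).
rewrite /= -!/(contr z _ (_ ++ _)) !(contr_pstar z mT mU).
rewrite (IH _ _ _ _ mT (contr_multimap z mU)).
rewrite (IH _ _ _ _ (contr_multimap z mT) mU).
by rewrite opprD; case: (~~ odd n).
Qed.

Lemma pstar_multimap m n T U : multimap m.+1 T -> multimap n U ->
  multimap (m + n) (pstar n T U).
Proof.
move=> mT mU; split.
- by move=> zs sz; apply: pstar_size mT mU sz.
- by move=> a x y b; apply: pstar_alt mT mU.
- by move=> zs; apply: pstar_fin mT mU.
move=> zs phi; have e z : pstar n T U (z :: zs) phi =
   (pstar n.-1 T (contr z U) zs + sg (~~ odd n) (pstar n (contr z T) U zs)) phi.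
  exact: (congr1 (fun F : seq Z -> V => F zs phi) (contr_pstar z mT mU)).
have -> : (fun z => pstar n T U (z :: zs) phi) = (fun z => 
    pstar n.-1 T (contr z U) zs phi + (sg (~~ odd n) (pstar n (contr z T) U zs)) phi).
  by apply/funext => z; rewrite e.
apply: sesqD.
  apply: sesq_shuf => a b psi; rewrite /bind /contr.
  exact: mm_sesq mU a _.
have s : sesqV (fun z => pstar n (contr z T) U zs).
  apply: sesq_shuf => a b.
  apply: (sesq_bind (T := fun z y => T (z :: y :: b)) (mm_fin mU a)) => y.
    exact: mm_sesq (contr_multimap y mT) b.
  exact: mm_sesq mT (y :: b).
by case: (~~ odd n) => /=; [apply: sesqN|]; apply: s.
Qed.

End Functionals.

(** * The graded pre-Lie identity *)

Section PreLie.
Variables (K : fieldType) (S : comNzRingType) (f : {rmorphism K -> S}).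
Variables (E : lmodType {poly K}) (H : lmodType S).

Local Notation Z := (S * E)%type.
Local Notation V := ((S * E -> H) -> H).
Local Notation multimap := (@multimap K S f E H).
Implicit Types (T U W : seq Z -> V).

Lemma pstar_closed a b T U : multimap a T -> multimap b U ->
  multimap (a + b).-1 (pstar b T U).
Proof.
case: a => [|a] mT mU; last exact: pstar_multimap.
have -> : pstar b T U = (fun=> 0); last exact: multimap0.
apply/funext => zs; apply: shuf_zero => u v _ _.
have -> : (fun y => T (y :: v)) = (fun=> 0).
  by apply/funext => y; apply: (mm_size mT).
exact: bind0t (mm_fin mU u).
Qed.

Lemma pstar_cons n k z T U zs : multimap k T -> multimap n U ->
  pstar n T U (z :: zs) =
  pstar n.-1 T (contr z U) zs + sg (~~ odd n) (pstar n (contr z T) U zs).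
Proof.
move=> mT mU.
exact: (congr1 (fun F : seq Z -> V => F zs) (contr_pstar z mT mU)).
Qed.

Lemma pstar_arity0 c U W : multimap 0 U -> multimap c W -> pstar c U W = (fun=> 0).
Proof.
move=> mU mW; apply/funext => zs; apply: shuf_zero => a b _ _.
have -> : (fun y => U (y :: b)) = (fun=> 0).
  by apply/funext => y; apply: (mm_size mU).
exact: bind0t (mm_fin mW a).
Qed.

Definition assoc b c T U W : seq Z -> V := fun zs =>
  pstar c (pstar b T U) W zs - pstar (b + c).-1 T (pstar c U W) zs.

(** The derivation rule for [pstar], applied twice on each side; the terms in
    which both contractions meet the same product cancel. *)
Lemma assoc_cons a b c T U W z zs :
  multimap a T -> multimap b U -> multimap c W ->
  assoc b c T U W (z :: zs) =
    (if c is c'.+1 then assoc b c' T U (contr z W) zs else 0)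
    + (if b is b'.+1 then sg (~~ odd c) (assoc b' c T (contr z U) W zs) else 0)
    + sg (odd b (+) odd c) (assoc b c (contr z T) U W zs).
Proof.
move=> mT mU mW; have mTU := pstar_closed mT mU; have mUW := pstar_closed mU mW.
have cT := contr_multimap z mT; have cU := contr_multimap z mU.
have e1 : pstar c (contr z (pstar b T U)) W zs =
    pstar c (pstar b.-1 T (contr z U)) W zs
    + sg (~~ odd b) (pstar c (pstar b (contr z T) U) W zs).
  rewrite (contr_pstar z mT mU).
  have m1 := pstar_closed mT cU; have m2 := pstar_closed cT mU.
  rewrite (pstarDl c m1 (multimap_sg (~~ odd b) m2) mW).
  by rewrite (pstar_sgl c (~~ odd b) m2 mW).
have e2 n : pstar n T (contr z (pstar c U W)) zs =
    pstar n T (pstar c.-1 U (contr z W)) zs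
    + sg (~~ odd c) (pstar n T (pstar c (contr z U) W) zs).
  by rewrite (contr_pstar z mU mW) pstarDr pstar_sgr.
rewrite /assoc (pstar_cons z zs mTU mW) (pstar_cons z zs mT mUW) e1 e2.
case: b mU mTU mUW cU {e1 e2} => [|b] mU mTU mUW cU.
  rewrite (contr0 z mU) (pstar_arity0 mU mW) !pstar0r (pstar0l _ mW).
  case: c mW {mUW} => [|c] mW.
    rewrite (contr0 z mW) !pstar0r /=; zmodule (V : zmodType).
  have cW := contr_multimap z mW.
  rewrite /= in cW *; rewrite (pstar_arity0 mU cW) !pstar0r.
  by case: (odd c) => /=; zmodule (V : zmodType).
case: c mW {mUW} => [|c] mW.
  rewrite (contr0 z mW) !pstar0r !add0r !addn0 /=.
  case: (odd b) => /=; zmodule (V : zmodType).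
rewrite !addSn !addnS /= oddD.
by case: (odd b); case: (odd c) => /=; zmodule (V : zmodType).
Qed.

Lemma pstar_nil c X W : pstar c X W [::] = if c is 0 then
  bind (fun y => X [:: y]) (W [::]) else 0.
Proof. by case: c. Qed.

(** By induction on the arguments: contraction with a weighted vector is a
    derivation, so only the value at the empty sequence has to be compared.
    There, for [U] and [W] without arguments, the associator inserts two
    constants into [T], and the sign comes from the alternation of [T]. *)
Lemma pstar_prelie a b c T U W zs :
  multimap a T -> multimap b U -> multimap c W ->
  assoc b c T U W zs = sg (~~ odd b && ~~ odd c) (assoc c b T W U zs).
Proof.
elim: zs a b c T U W => [|z zs IH] a b c T U W mT mU mW; last first.
  rewrite (assoc_cons z zs mT mU mW) (assoc_cons z zs mT mW mU).
  rewrite (IH _ _ _ _ _ _ (contr_multimap z mT) mU mW).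
  case: b mU => [|b] mU; case: c mW => [|c] mW.
  - by rewrite !add0r.
  - rewrite (IH _ _ _ _ _ _ mT mU (contr_multimap z mW)) /=.
    by case: (odd c) => /=; zmodule (V : zmodType).
  - rewrite (IH _ _ _ _ _ _ mT (contr_multimap z mU) mW) /=.
    by case: (odd b) => /=; zmodule (V : zmodType).
  - rewrite (IH _ _ _ _ _ _ mT (contr_multimap z mU) mW) /=.
    rewrite (IH _ _ _ _ _ _ mT mU (contr_multimap z mW)) /=.
    by case: (odd b); case: (odd c) => /=; zmodule (V : zmodType).
case: b mU => [|b] mU; case: c mW => [|c] mW.
- rewrite /assoc (pstar_arity0 mU mW) (pstar_arity0 mW mU) !pstar0r !subr0 /=.
  rewrite /pstar /=.
  have s1 z : sesqV f (fun y => T [:: y; z]) by apply: mm_sesq mT [:: z].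
  have s2 z : sesqV f (fun y => T [:: z; y]).
    exact: (mm_sesq (contr_multimap z mT) [::]).
  rewrite (bind_comm (T := fun z y => T [:: y; z]) (mm_fin mU _) (mm_fin mW _)) //.
  rewrite -(bindNt (f := f) (sesq_bind (T := fun z y => T [:: y; z]) _ _ _)) //.
  + congr (bind _ (U [::])); apply/funext => y.
    rewrite -(bindNt (f := f)) //; last exact: mm_fin mW _.
    by congr (bind _ (W [::])); apply/funext => z; apply: (mm_alt mT [::] _ _ [::]).
  + exact: mm_fin mW _.
  + exact: mm_fin mU _.
- rewrite /assoc !pstar_nil /=.
  case: c mW => [|c] mW; rewrite ?addSn ?addn0 /= /pstar /=.
    have -> : (fun y => bind (fun z => T [:: z]) (W [:: y]) - 0) =
              (fun y => bind (fun z => T [:: z]) (W [:: y])).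
      by apply/funext => y; rewrite subr0.
    by rewrite bind_assoc !subrr.
  by rewrite sg0 addr0 (bind0t (mm_fin mU _)) !subrr sg0.
- rewrite /assoc !pstar_nil /=.
  case: b mU => [|b] mU; rewrite ?addSn ?addn0 /= /pstar /=.
    have -> : (fun y => bind (fun z => T [:: z]) (U [:: y]) - 0) =
              (fun y => bind (fun z => T [:: z]) (U [:: y])).
      by apply/funext => y; rewrite subr0.
    by rewrite bind_assoc !subrr.
  by rewrite sg0 addr0 (bind0t (mm_fin mW _)) !subrr sg0.
- by rewrite /assoc !addSn !addnS /= !pstar_nil !subr0 sg0.
Qed.

End PreLie.

(** * Unshuffles *)

Lemma lift_perm_inj k (i0 j0 : 'I_k.+1) : injective (@lift_perm k i0 j0).
Proof.
move=> t u e; apply/permP => l; apply: (@lift_inj _ j0).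
by rewrite -!(lift_perm_lift i0 j0) e.
Qed.

Lemma lift_perm_ex k (i0 : 'I_k.+1) (s : 'S_k.+1) :
  exists t, s = lift_perm i0 (s i0) t.
Proof.
pose g l := odflt l (unlift (s i0) (s (lift i0 l))).
have gE l : lift (s i0) (g l) = s (lift i0 l).
  have ne : s i0 != s (lift i0 l) by rewrite (inj_eq perm_inj) neq_lift.
  by have [u eu] := unlift_some ne; rewrite /g => ->.
have gI : injective g.
  move=> l l' e; apply: (@lift_inj _ i0); apply: (@perm_inj _ s).
  by rewrite -!gE e.
exists (perm gI); apply/permP => l.
case: (unliftP i0 l) => [l'|] ->; first by rewrite lift_perm_lift permE gE.
by rewrite lift_perm_id.
Qed.

Lemma sum_lift_perm (W : nmodType) k (i0 j0 : 'I_k.+1) (P : pred 'S_k.+1)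
    (F : 'S_k.+1 -> W) :
  \sum_(s : 'S_k.+1 | P s && (s i0 == j0)) F s =
  \sum_(t : 'S_k | P (lift_perm i0 j0 t)) F (lift_perm i0 j0 t).
Proof.
pose h' (s : 'S_k.+1) := [pick t | lift_perm i0 j0 t == s].
have h'K t : h' (lift_perm i0 j0 t) = Some t.
  rewrite /h'; case: pickP => [u /eqP /lift_perm_inj -> //|/(_ t)].
  by rewrite eqxx.
rewrite (reindex_omap (lift_perm i0 j0) h').
  by apply: eq_bigl => t; rewrite h'K lift_perm_id !eqxx !andbT.
move=> s /andP [_ /eqP e]; have [t et] := lift_perm_ex i0 s.
by rewrite et e h'K.
Qed.

Lemma unshuffleP p k (s : 'S_k) :
  reflect (forall i j : 'I_k, (i < j)%N -> (j < p)%N || (p <= i)%N -> (s i < s j)%N)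
          (unshuffle p s).
Proof.
apply: (iffP forallP) => [h i j lt c|h i].
  by have /forallP/(_ j)/implyP := h i; apply; rewrite lt c.
by apply/forallP => j; apply/implyP => /andP [lt c]; apply: h.
Qed.

Lemma unshuffle_lift0 n k (t : 'S_k) :
  unshuffle n.+1 (lift_perm ord0 ord0 t) = unshuffle n t.
Proof.
apply/unshuffleP/unshuffleP => h i j lt c.
  have := h (lift ord0 i) (lift ord0 j).
  by rewrite !lift_perm_lift !lift0 /= !ltnS; apply.
case: (unliftP ord0 j) lt c => [j'|] -> //; case: (unliftP ord0 i) => [i'|] ->.
  by rewrite !lift_perm_lift !lift0 /= !ltnS; apply: h.
by rewrite lift_perm_id lift_perm_lift lift0.
Qed.

Lemma unshuffle_lift n k (t : 'S_k) (i0 : 'I_k.+1) : val i0 = n ->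
  unshuffle n (lift_perm i0 ord0 t) = unshuffle n t.
Proof.
move=> ei0.
have lt_bump (i : nat) : (bump n i < n)%N = (i < n)%N.
  rewrite /bump; case: (leqP n i) => h; rewrite /= ?add0n ?add1n //.
  by rewrite ltnNge leqW.
have le_bump (i : nat) : (n <= bump n i)%N = (n <= i)%N.
  by rewrite leqNgt lt_bump -leqNgt.
have ltb (i j : nat) : (bump n i < bump n j)%N = (i < j)%N.
  by rewrite !ltnNge leq_bump2.
apply/unshuffleP/unshuffleP => h i j lt c.
  have := h (lift i0 i) (lift i0 j).
  by rewrite !lift_perm_lift !lift0 /= ei0 !ltnS ltb lt_bump le_bump; apply.
case: (unliftP i0 j) lt c => [j'|] ->; case: (unliftP i0 i) => [i'|] ->.
- by rewrite !lift_perm_lift !lift0 /= ei0 !ltnS ltb lt_bump le_bump; apply: h.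
- by rewrite lift_perm_id lift_perm_lift lift0.
- by rewrite /= ei0 lt_bump ltnn le_bump /= ltnNge => /negPf ->.
- by rewrite ltnn.
Qed.

(** An unshuffle increases on its two blocks of positions, so that it takes the
    value 0 at position 0 or at position [n.+1], where the second block starts. *)
Lemma sum_unshuffle_split (W : nmodType) n k (F : 'S_k.+1 -> W) :
  \sum_(s : 'S_k.+1 | unshuffle n.+1 s) F s =
  \sum_(t : 'S_k | unshuffle n t) F (lift_perm ord0 ord0 t)
  + (if (n.+1 <= k)%N then
       \sum_(t : 'S_k | unshuffle n.+1 t) F (lift_perm (inord n.+1) ord0 t)
     else 0).
Proof.
rewrite (partition_big (fun s : 'S_k.+1 => s^-1%g ord0) predT) //=.
have e i : \sum_(s : 'S_k.+1 | unshuffle n.+1 s && (s^-1%g ord0 == i)) F s =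
    \sum_(t : 'S_k | unshuffle n.+1 (lift_perm i ord0 t)) F (lift_perm i ord0 t).
  rewrite -sum_lift_perm; apply: eq_bigl => s.
  by rewrite -(inj_eq (@perm_inj _ s)) permKV eq_sym.
under eq_bigr do rewrite e.
rewrite big_ord_recl /=; congr (_ + _).
  by apply: eq_bigl => t; rewrite unshuffle_lift0.
have zero (i : 'I_k) : i != n :> nat ->
    \sum_(t : 'S_k | unshuffle n.+1 (lift_perm (lift ord0 i) ord0 t))
       F (lift_perm (lift ord0 i) ord0 t) = 0.
  move=> ne; rewrite big_pred0 // => t; apply/negP => /unshuffleP h.
  have ltk := ltn_ord i.
  have [lt|gt|e'] := ltngtP i n; last by rewrite e' eqxx in ne.
    have c : (lift ord0 i < n.+1)%N by rewrite lift0 ltnS.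
    by have := h ord0 (lift ord0 i); rewrite lift_perm_id c => /(_ isT isT).
  have lt : (n.+1 < k.+1)%N by rewrite ltnS (ltn_trans gt).
  have c : (Ordinal lt < lift ord0 i)%N by rewrite lift0 ltnS.
  have := h (Ordinal lt) (lift ord0 i) c; rewrite lift_perm_id /= leqnn orbT.
  by move=> /(_ isT).
case: ifP => [lt|ge]; last first.
  apply: big1 => i _; apply: zero; apply: contraFneq ge => <-.
  exact: ltn_ord.
rewrite (bigD1 (Ordinal lt)) //= [X in _ + X]big1 ?addr0 => [|i ne]; last exact: zero.
have -> : lift ord0 (Ordinal lt) = inord n.+1.
  by apply: ord_inj; rewrite lift0 inordK // ltnS.
by apply: eq_bigl => t; rewrite unshuffle_lift //; apply: inordK.
Qed.

Lemma unshuffle0 k (s : 'S_k) : unshuffle 0 s = (s == 1%g).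
Proof.
apply/unshuffleP/eqP => [h|-> i j lt _]; last by rewrite !perm1.
have srt : sorted ltn [seq val (s i) | i <- enum 'I_k].
  rewrite (map_comp val s) sorted_map.
  have: sorted ltn (map val (enum 'I_k)) by rewrite val_enum_ord iota_ltn_sorted.
  rewrite sorted_map; case: (enum 'I_k) => //= x r; elim: r x => //= y r IH x.
  move=> /andP [lt /IH ->]; rewrite andbT; exact: h.
have e : [seq val (s i) | i <- enum 'I_k] = map val (enum 'I_k).
  apply: (irr_sorted_eq ltn_trans ltnn srt).
    by rewrite val_enum_ord iota_ltn_sorted.
  move=> x; apply/mapP/mapP => -[i _ ->].
    by exists (s i); rewrite ?mem_enum.
  by exists (s^-1%g i); rewrite ?mem_enum ?permKV.
apply/permP => i; rewrite perm1; apply: val_inj.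
have e1 : nth 0%N [seq val (s i) | i <- enum 'I_k] i = val (s i).
  by rewrite (nth_map i) ?size_enum_ord // nth_ord_enum.
by rewrite -e1 e val_enum_ord nth_iota.
Qed.

Lemma shuf_small (Z : Type) (W : zmodType) n (G : seq Z -> seq Z -> W) zs :
  (size zs < n)%N -> shuf n G zs = 0.
Proof.
move=> lt; apply: shuf_zero => a b sa sb.
by move: lt; rewrite -sb -sa ltnNge leq_addr.
Qed.

Definition reorder (Z : Type) (z0 : Z) (zs : seq Z) k (s : 'S_k) : seq Z :=
  [seq nth z0 zs (s i) | i : 'I_k].

Lemma size_reorder Z (z0 : Z) zs k (s : 'S_k) : size (reorder z0 zs s) = k.
Proof. by rewrite size_map size_enum_ord. Qed.

Lemma nth_reorder Z (z0 z1 : Z) zs k (s : 'S_k) (i : 'I_k) :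
  nth z1 (reorder z0 zs s) i = nth z0 zs (s i).
Proof. by rewrite (nth_map i) ?size_enum_ord // nth_ord_enum. Qed.

Lemma reorder1 Z (z0 : Z) zs k : size zs = k ->
  reorder z0 zs (1 : 'S_k)%g = zs.
Proof.
move=> sz; apply: (@eq_from_nth _ z0); first by rewrite size_reorder.
move=> i; rewrite size_reorder => lt.
by rewrite (nth_reorder z0 z0 zs 1%g (Ordinal lt)) perm1.
Qed.

Lemma reorder_lift0 Z (z0 z : Z) zs k (t : 'S_k) :
  reorder z0 (z :: zs) (lift_perm ord0 ord0 t) = z :: reorder z0 zs t.
Proof.
rewrite /reorder /image_mem enum_ordSl /= lift_perm_id /= -map_comp; congr (_ :: _).
by apply: eq_map => i /=; rewrite lift_perm_lift lift0.
Qed.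

Lemma reorder_lift Z (z0 z : Z) zs n k (t : 'S_k) : (n <= k)%N ->
  reorder z0 (z :: zs) (lift_perm (inord n) ord0 t) =
  take n (reorder z0 zs t) ++ z :: drop n (reorder z0 zs t).
Proof.
move=> le; have st : size (take n (reorder z0 zs t)) = n.
  by rewrite size_takel ?size_reorder.
apply: (@eq_from_nth _ z0).
  by rewrite size_cat /= st size_drop !size_reorder addnS subnKC.
move=> i; rewrite size_reorder => lt.
rewrite (nth_reorder z0 z0 (z :: zs) _ (Ordinal lt)) nth_cat st.
have en : @inord k n = n :> nat by rewrite inordK.
case: (unliftP (inord n) (Ordinal lt)) => [j|] e; last first.
  have ei : i = n by rewrite -en -e.
  by rewrite e lift_perm_id ei ltnn subnn.
rewrite e lift_perm_lift lift0 /=.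
have ei : i = bump n j.
  by have := congr1 val e; rewrite /= en.
rewrite ei {ei e lt}.
rewrite /bump; case: (leqP n j) => h /=.
  rewrite add1n ltnNge (leqW h) /= subSn //= nth_drop subnKC //.
  by rewrite (nth_reorder z0).
by rewrite add0n h nth_take // (nth_reorder z0).
Qed.

Lemma sg_lift_perm (W : zmodType) k (i j : 'I_k.+1) (t : 'S_k) (w : W) :
  sg (lift_perm i j t) w = sg (odd i (+) odd j) (sg t w).
Proof.
rewrite odd_lift_perm; case: (odd i (+) odd j); case: (odd_perm t) => //=.
by rewrite opprK.
Qed.

Lemma sum_unshuffle (Z : Type) (W : zmodType) (z0 : Z) k n
    (G : seq Z -> seq Z -> W) zs : size zs = k -> (n <= k)%N ->
  \sum_(s : 'S_k | unshuffle n s)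
     sg s (G (take n (reorder z0 zs s)) (drop n (reorder z0 zs s))) =
  shuf n G zs.
Proof.
elim: zs k n G => [|z zs IH] k [|n] G <- // le.
- rewrite (big_pred1 1%g) => [|s]; last exact: unshuffle0.
  by rewrite odd_perm1 take0 drop0 reorder1.
- rewrite (big_pred1 1%g) => [|s]; last exact: unshuffle0.
  by rewrite odd_perm1 take0 drop0 reorder1.
rewrite /= sum_unshuffle_split; congr (_ + _).
  rewrite -(IH _ _ _ erefl) //; apply: eq_bigr => t _.
  by rewrite sg_lift_perm reorder_lift0 addbb /=.
case: ifP => [lt|/negbT]; last by rewrite -ltnNge => lt; rewrite shuf_small // sg0.
rewrite -(IH _ _ _ erefl lt) (big_morph _ (@sgD W (~~ odd n)) (sg0 W _)).
apply: eq_bigr => t _; rewrite sg_lift_perm reorder_lift // inordK ?ltnS //=.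
have st : size (take n.+1 (reorder z0 zs t)) = n.+1.
  by rewrite size_takel ?size_reorder.
by rewrite take_size_cat // drop_size_cat // addbF.
Qed.

Section Alternation.
Variables (Z : Type) (W : zmodType).

Lemma alt_move (T : seq Z -> W) x a b :
  (forall a x y b, T (a ++ x :: y :: b) = - T (a ++ y :: x :: b)) ->
  T (x :: a ++ b) = sg (odd (size a)) (T (a ++ x :: b)).
Proof.
elim: a T => [|y a IH] T alt //=.
rewrite (alt [::]) /= (IH (fun zs => T (y :: zs))); last first.
  by move=> *; apply: (alt (_ :: _)).
by case: (odd (size a)) => //=; rewrite opprK.
Qed.

(** By induction, the first entry of the reordered sequence being moved to its
    place by adjacent transpositions. *)
Lemma alt_reorder (z0 : Z) k (s : 'S_k) (T : seq Z -> W) zs :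
  (forall a x y b, T (a ++ x :: y :: b) = - T (a ++ y :: x :: b)) ->
  size zs = k -> T (reorder z0 zs s) = sg s (T zs).
Proof.
elim: k s T zs => [|k IH] s T zs alt sz.
  have -> : s = 1%g by apply/permP => -[].
  by rewrite odd_perm1 reorder1.
have [t es] := lift_perm_ex ord0 s; set j := s ord0 in es.
have ltj : (j < size zs)%N by rewrite sz.
have ez : zs = take j zs ++ nth z0 zs j :: drop j.+1 zs.
  by rewrite -drop_nth // cat_take_drop.
have st : size (take j zs) = j by rewrite size_takel // ltnW.
have -> : reorder z0 zs s = nth z0 zs j :: reorder z0 (take j zs ++ drop j.+1 zs) t.
  rewrite /reorder /image_mem enum_ordSl /= -/j -map_comp; congr (_ :: _).
  apply: eq_map => i /=; rewrite es lift_perm_lift /=.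
  rewrite nth_cat st /bump; case: (leqP j (t i)) => h /=.
    by rewrite nth_drop add1n addSn subnKC.
  by rewrite add0n nth_take.
rewrite (IH t (fun r => T (nth z0 zs j :: r))); first last.
- rewrite size_cat st size_drop sz subSS addnC subnK //.
  by rewrite -ltnS.
- by move=> *; apply: (alt (_ :: _)).
rewrite alt_move // -ez st es odd_lift_perm /=.
by case: (odd j); case: (odd_perm t) => //=; rewrite opprK.
Qed.

End Alternation.

(** * Conformal cochains as alternating maps of weighted vectors *)

Section Realization.
Variables (K : fieldType) (S : comNzRingType) (f : {rmorphism K -> S}).
Variables (E : lmodType {poly K}) (H : lmodType S).

Local Notation Z := (S * E)%type.
Local Notation V := ((S * E -> H) -> H).
Local Notation multimap := (@multimap K S f E H).
Local Notation sesq := (@sesq K S f E H).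
Implicit Types (F G : mcochain E E) (zs : seq Z) (phi : Z -> H).

(** The value of a cochain has the sum of the weights of its arguments as its
    own weight: this is the index λ_1 + ... + λ_n of the inserted value in the
    insertion product. *)
Definition weight zs : S := \sum_(c <- unzip1 zs) c.

(** The variables are evaluated at the weights of the arguments and the values
    are seen through test functions. The last weight enters through the total
    weight only, which a sesquilinear [phi] identifies with [- 'X]. *)
Definition rho F zs : V := fun phi =>
  if `[< sesq phi >] then
    leval (nth 0 (unzip1 zs)) (fun x => phi (weight zs, x)) (F (unzip2 zs))
  else 0.

Lemma rhoE F zs phi : sesq phi -> rho F zs phi =
  leval (nth 0 (unzip1 zs)) (fun x => phi (weight zs, x)) (F (unzip2 zs)).
Proof. by rewrite /rho => /asboolP ->. Qed.

Lemma rho_nonsesq F zs phi : ~ sesq phi -> rho F zs phi = 0.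
Proof. by rewrite /rho => /asboolPn/negPf ->. Qed.

(** If ['X] acts as minus the total weight, then λ_k^‡ is the last weight: the
    substitution [sub_dag] becomes the identity. *)
Lemma lsub_sub_dag (w : seq S) k i : size w = k.+1 ->
  lsub f (nth 0 w) (- \sum_(c <- w) c) (sub_dag K k.+1 i) = nth 0 w i.
Proof.
move=> sw; rewrite /sub_dag /=; case: eqP => [->|_]; last exact: lsub_lam.
rewrite /ldag lsubD !lsubN lsub_del opprK /=.
rewrite (big_morph _ (lsubD f _ _) (lsub0 f _ _)).
under eq_bigr do rewrite lsub_lam.
by rewrite (big_nth 0) sw big_mkord big_ord_recr /= addrA addNr add0r.
Qed.

Lemma leval_dag (w : seq S) k (h : E -> H) p : size w = k.+1 ->
  dlinear f (- \sum_(c <- w) c) h ->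
  leval (nth 0 w) h (lsubst (sub_dag K k.+1) p) = leval (nth 0 w) h p.
Proof.
move=> sw hh; rewrite (leval_lsubst _ _ _ hh); apply: eq_leval => // i.
exact: lsub_sub_dag.
Qed.

Lemma rho_fin F zs : fin f (rho F zs).
Proof.
exists [seq (mev (nth 0 (unzip1 zs)) m, (weight zs, lcoef (F (unzip2 zs)) m))
       | m <- lsupp (F (unzip2 zs))] => phi.
by rewrite /rho big_map.
Qed.

Section Cochain.
Variables (k : nat) (F : mcochain E E).
Hypothesis cF : is_cochain k.+1 F.

Lemma rho_size zs : size zs <> k.+1 -> rho F zs = 0.
Proof.
move=> sz; apply/funext => phi; rewrite /rho (co_arity cF) ?size_map //.
by rewrite leval0 if_same.
Qed.

Lemma rho_sesq zs : sesqV f (fun z => rho F (z :: zs)).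
Proof.
move=> phi; have [sphi|nphi] := pselect (sesq phi); last first.
  have := @sesq0 K S f E H; congr sesq; apply/funext => z.
  by rewrite rho_nonsesq.
have [sz|nz] := eqVneq (size zs) k; last first.
  have := @sesq0 K S f E H; congr sesq; apply/funext => z.
  by rewrite rho_size //= => -[e]; rewrite e eqxx in nz.
move=> t; have hh := sphi (t + \sum_(c <- unzip1 zs) c).
have e x : rho F ((t, x) :: zs) phi = leval (nth 0 (t :: unzip1 zs))
    (fun y => phi (t + \sum_(c <- unzip1 zs) c, y)) (F (x :: unzip2 zs)).
  by rewrite rhoE // /weight /= big_cons.
have s2 : (size (Nil E) + size (unzip2 zs)).+1 = k.+1 by rewrite size_map sz.
have hh' := hh; rewrite -[t + _](big_cons _ _ _ _ xpredT id) in hh'.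
apply: dlinear_gen => [c x y|x]; rewrite !e.
  rewrite (co_lin cF (a1 := [::]) c x y s2) levalD; last exact: dlinearD hh.
  by rewrite (leval_scale _ _ _ hh).
rewrite (co_sesq cF (a1 := [::]) x s2) (leval_lact hh); congr (_ *: _).
rewrite lsubN; congr (- _).
have -> : - (t + \sum_(c <- unzip1 zs) c) = - \sum_(c <- t :: unzip1 zs) c.
  by rewrite big_cons.
by rewrite lsub_sub_dag //= size_map sz.
Qed.

(** The total weight is symmetric, so that the skew-symmetry of a cochain, whose
    λ_k^‡ is the last weight, becomes plain alternation. *)
Lemma rho_reorder (s : 'S_k.+1) z0 zs : size zs = k.+1 ->
  rho F zs = sg s (rho F (reorder z0 zs s)).
Proof.
move=> sz; apply/funext => phi.
have -> : sg s (rho F (reorder z0 zs s)) phi = sg s (rho F (reorder z0 zs s) phi).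
  by rewrite /sg; case: (odd_perm s).
have [sphi|nphi] := pselect (sesq phi); last by rewrite !rho_nonsesq // sg0.
have ew : weight (reorder z0 zs s) = weight zs.
  rewrite /weight [LHS]big_map big_image [RHS]big_map /=.
  rewrite [RHS](big_nth z0) sz big_mkord [RHS](reindex_inj (@perm_inj _ s)).
  exact: eq_bigl.
rewrite !rhoE // ew; set h := fun x => _.
have sw : size (unzip1 zs) = k.+1 by rewrite size_map.
have hh : dlinear f (- \sum_(c <- unzip1 zs) c) h by exact: sphi.
have s2 : size (unzip2 zs) == k.+1 by rewrite size_map sz.
rewrite [F (unzip2 zs)](co_skew cF s (Tuple s2)) sg_scale oddb.
have -> : permute s (Tuple s2) = unzip2 (reorder z0 zs s).
  rewrite /permute /reorder /image_mem /unzip2 -map_comp; apply: eq_map => i /=.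
  by rewrite (tnth_nth z0.2) /= (nth_map z0) // sz.
have -> p : leval (nth 0 (unzip1 zs)) h (sg s p) = sg s (leval (nth 0 (unzip1 zs)) h p).
  by case: (odd_perm s) => //=; apply/levalN/(dlinearD hh).
congr (sg _ _); rewrite leval_dag // /eval_at (leval_lsubst _ _ _ hh).
apply: (@leval_in_vars K S E H k) => [|i lt /=]; first exact: co_vars cF _.
rewrite nth_take //.
have lt' : (i < k.+1)%N by rewrite ltnS ltnW.
have eL := nth_map (Ordinal lt') 0 (fun j => lam (s j) : lring K) (n := i).
rewrite eL ?size_enum_ord // lsub_lam (nth_ord_enum _ (Ordinal lt')).
rewrite [RHS](nth_map z0) ?size_reorder //.
have /= -> := nth_reorder z0 z0 zs s (Ordinal lt').
by rewrite (nth_map z0) ?sz.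
Qed.

Lemma rho_alt a x y b : rho F (a ++ x :: y :: b) = - rho F (a ++ y :: x :: b).
Proof.
have [sz|/eqP ne] := eqVneq (size (a ++ x :: y :: b)) k.+1; last first.
  by rewrite !rho_size ?oppr0 //; move: ne; rewrite !size_cat.
have szE : (size a + (size b).+2)%N = k.+1 by rewrite -sz size_cat.
have lti : (size a < k.+1)%N by rewrite -szE -addn1 leq_add2l.
have ltj : ((size a).+1 < k.+1)%N by rewrite -szE -addn2 leq_add2l.
rewrite (rho_reorder (tperm (Ordinal lti) (Ordinal ltj)) x sz) odd_tperm.
have -> /= : Ordinal lti != Ordinal ltj by rewrite -val_eqE /= neq_ltn leqnn.
congr (- rho F _); apply: (@eq_from_nth _ x).
  by rewrite size_reorder -szE size_cat.
move=> i; rewrite size_reorder => lt.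
rewrite (nth_reorder x x _ _ (Ordinal lt)) !nth_cat.
case: tpermP => [[->]|[->]|/eqP ni /eqP nj].
- by rewrite /= ltnn subnn ltnNge leqnSn subSnn.
- by rewrite /= ltnn subnn ltnNge leqnSn subSnn.
move: ni nj; rewrite -!val_eqE /= => ni nj; case: ltngtP ni => // gt _.
have : (size a).+1 != i by rewrite eq_sym.
rewrite neq_ltn ltnS [X in _ || X]leqNgt gt orbF => gt2.
by rewrite -(subnKC gt2) !addSnnS !addKn.
Qed.

Lemma rho_multimap : multimap k.+1 (rho F).
Proof.
split; [exact: rho_size | exact: rho_alt | by move=> zs; apply: rho_fin |].
exact: rho_sesq.
Qed.

End Cochain.

(** [idx] lists the arguments in the order of an unshuffle. *)
Lemma leval_star_term m n F G zs (idx : seq nat) phi z0 :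
  is_cochain m.+1 F -> is_cochain n.+1 G -> sesq phi ->
  size idx = (m + n.+1)%N -> (forall i, i \in idx -> (i < size zs)%N) ->
  let ws := [seq nth z0 zs i | i <- idx] in
  let ls : seq (lring K) := [seq lam i | i <- idx] in
  let xs := [seq nth 0 (unzip2 zs) i | i <- idx] in
  weight ws = weight zs ->
  leval (nth 0 (unzip1 zs)) (fun x => phi (weight zs, x))
    (lext (fun y : E =>
             eval_at F (take m ((\sum_(l <- take n.+1 ls) l) :: drop n.+1 ls))
                     (y :: drop n.+1 xs))
          (eval_at G (take n ls) (take n.+1 xs))) =
  bind (fun y => rho F (y :: drop n.+1 ws)) (rho G (take n.+1 ws)) phi.
Proof.
move=> cF cG sphi sz lt_idx ws ls xs ew; set w := nth 0 (unzip1 zs).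
set h := fun x => phi (weight zs, x).
have hh : dlinear f (- weight zs) h by exact: sphi.
have ex : xs = unzip2 ws.
  rewrite /xs /ws /unzip2 -map_comp; apply/eq_in_map => i /lt_idx lt /=.
  by rewrite (nth_map z0).
have el i : (i < size idx)%N ->
    lsub f w (- weight zs) (nth 0 ls i) = nth 0 (unzip1 ws) i.
  move=> lt; rewrite (nth_map 0%N) // lsub_lam /ws /unzip1 -map_comp.
  by rewrite (nth_map 0%N) //= /w (nth_map z0) // lt_idx // mem_nth.
set t := weight (take n.+1 ws).
have et : t + weight (drop n.+1 ws) = weight zs.
  by rewrite -ew /t /weight -big_cat -map_cat cat_take_drop.
set A := fun y : E => eval_at F _ _.
have eA y : leval w h (A y) = rho F ((t, y) :: drop n.+1 ws) phi.
  rewrite rhoE // /A /eval_at (leval_lsubst _ _ _ hh) /= ex.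
  have -> : weight ((t, y) :: drop n.+1 ws) = weight zs.
    by rewrite -et /weight /= big_cons.
  have -> : drop n.+1 (unzip2 ws) = unzip2 (drop n.+1 ws) by rewrite -map_drop.
  apply: (@leval_in_vars K S E H m) => [|i lt /=].
    exact: co_vars cF _.
  rewrite nth_take //; case: i lt => [|i] lt /=.
    rewrite (big_morph _ (lsubD f _ _) (lsub0 f _ _)).
    rewrite /t /weight /unzip1 map_take.
    have szt : size (take n.+1 ls) = n.+1.
      by rewrite size_takel // size_map sz leq_addl.
    have szt' : size (take n.+1 (unzip1 ws)) = n.+1.
      by rewrite size_takel // !size_map sz leq_addl.
    rewrite (big_nth 0) szt [RHS](big_nth 0) szt'.
    apply: eq_big_nat => j /andP [_ ltj]; rewrite !nth_take //.
    by apply: el; rewrite sz (leq_trans ltj) // leq_addl.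
  rewrite nth_drop /unzip1 map_drop nth_drop; apply: el.
  by rewrite sz addnC ltn_add2r ltnW.
have hA : dlinear f (- t) (fun y => leval w h (A y)).
  have := rho_sesq cF (drop n.+1 ws) phi t.
  by congr dlinear; apply/funext => y.
rewrite lextE (leval_comp _ _ _ _ hh).
have -> : leval (lsub f w (- weight zs) \o lam) (leval w h \o (A : E -> smod E))
    (eval_at G (take n ls) (take n.+1 xs)) =
    leval w (fun y => leval w h (A y)) (eval_at G (take n ls) (take n.+1 xs)).
  by apply: eq_leval => // i /=; rewrite lsub_lam.
rewrite /eval_at (leval_lsubst _ _ _ hA) /bind rhoE; last exact: (rho_sesq cF).
rewrite -/t ex.
have -> : take n.+1 (unzip2 ws) = unzip2 (take n.+1 ws) by rewrite -map_take.
rewrite (@leval_in_vars K S E H n _ (nth 0 (unzip1 (take n.+1 ws)))).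
- by apply: eq_leval.
- exact: co_vars cG _.
move=> i lt; have lti : (i < size idx)%N by rewrite sz (ltn_trans lt) // leq_addl.
rewrite /= /unzip1 map_take (nth_take _ lt) (nth_take _ (leqW lt)).
apply: etrans (_ : nth 0 (unzip1 zs) (nth 0%N idx i) = _).
  rewrite /ls (nth_map 0%N 0 (fun j => lam j : lring K) lti).
  exact: lsub_lam.
rewrite /ws -map_comp (nth_map 0%N) //= (nth_map z0) //.
by rewrite lt_idx // mem_nth.
Qed.

(** The terms of the two sums agree one by one: the inserted value has the
    weight that the definition of [star] prescribes, and the final [sub_dag] is
    invisible to sesquilinear test functions. *)
Lemma rho_star m n F G zs : is_cochain m.+1 F -> is_cochain n.+1 G ->
  rho (star m.+1 n.+1 F G) zs = pstar n.+1 (rho F) (rho G) zs.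
Proof.
move=> cF cG; have mF := rho_multimap cF; have mG := rho_multimap cG.
apply/funext => phi; have [sphi|nphi] := pselect (sesq phi); last first.
  by rewrite rho_nonsesq // (fin_nonsesq (pstar_fin zs mF mG)).
have [sz|/eqP nsz] := eqVneq (size zs) (m + n.+1)%N; last first.
  rewrite (pstar_size mF mG nsz) rhoE // /star size_map.
  by move/eqP: nsz => /negPf nsz; rewrite nsz /= leval0.
rewrite rhoE // /star size_map sz /= eqxx /=.
have hh : dlinear f (- weight zs) (fun x => phi (weight zs, x)) by exact: sphi.
have dag p : leval (nth 0 (unzip1 zs)) (fun x => phi (weight zs, x))
      (lsubst (sub_dag K (m + n.+1)) p) =
    leval (nth 0 (unzip1 zs)) (fun x => phi (weight zs, x)) p.
  by rewrite addnS leval_dag // size_map sz addnS.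
rewrite dag leval_sum; last exact: dlinearD hh.
rewrite /pstar (shuf_morph (h := fun v : V => v phi)) //.
pose z0 : Z := (0, 0).
rewrite -(sum_unshuffle z0 _ sz (leq_addl m n.+1)).
apply: eq_bigr => s _; rewrite sg_scale oddb.
have -> p : leval (nth 0 (unzip1 zs)) (fun x => phi (weight zs, x)) (sg s p) =
    sg s (leval (nth 0 (unzip1 zs)) (fun x => phi (weight zs, x)) p).
  by case: (odd_perm s) => //=; apply/levalN/(dlinearD hh).
congr (sg _ _).
pose idx := [seq val (s i) | i : 'I_(m + n.+1)].
have er : reorder z0 zs s = [seq nth z0 zs i | i <- idx].
  by rewrite /idx -map_comp.
have := @leval_star_term m n F G zs idx phi z0 cF cG sphi.
rewrite size_map size_enum_ord er => /(_ erefl) /=.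
have -> : [seq lam i | i <- idx] = [seq lam (s i) | i : 'I_(m + n.+1)] :> seq (lring K).
  by rewrite -map_comp.
have -> : [seq nth 0 (unzip2 zs) i | i <- idx] =
    [seq nth 0 (unzip2 zs) (s i) | i : 'I_(m + n.+1)].
  by rewrite -map_comp.
apply.
  by move=> i /mapP [j _ ->]; rewrite sz; apply: ltn_ord.
rewrite -er /weight [LHS]big_map big_image [RHS]big_map /=.
rewrite [RHS](big_nth z0) sz big_mkord [RHS](reindex_inj (@perm_inj _ s)).
exact: eq_bigl.
Qed.

End Realization.

(** * Recovering a cochain from the alternating map *)

Section VarsClosure.
Variables (K : fieldType) (N : lmodType {poly K}) (k : nat).

Lemma in_vars_sum (M : zmodType) I (r : seq I) (P : pred I) (F : I -> lpoly M) :
  (forall i, P i -> in_vars k (F i)) -> in_vars k (\sum_(i <- r | P i) F i).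
Proof.
move=> vF; apply: big_ind => //; [exact: in_vars0|exact: in_varsD].
Qed.

Lemma in_vars_sumseq (M : zmodType) (I : eqType) (r : seq I) (F : I -> lpoly M) :
  (forall i, i \in r -> in_vars k (F i)) -> in_vars k (\sum_(i <- r) F i).
Proof. by move=> vF; rewrite big_seq; apply: in_vars_sum. Qed.

Lemma in_vars_mono (M : zmodType) (x : M) (m : mon) :
  (forall i, (k <= i)%N -> m i = 0%N) -> in_vars k (lmono x m).
Proof.
move=> m0 m' i; rewrite /lsupp => /(fsubsetP msuppU_le).
by rewrite in_fset1 => /eqP ->; apply: m0.
Qed.

Lemma in_vars_lact (q : lring K) (p : lpoly N) :
  in_vars (N := {poly K}) k q -> in_vars k p -> in_vars k (lact q p).
Proof.
move=> vq vp; rewrite lact.unlock; apply: in_vars_sumseq => m mq.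
apply: in_vars_sumseq => m' mp; apply: in_vars_mono => i le.
by rewrite cmM (vq m i mq le) (vp m' i mp le).
Qed.

Lemma in_vars_mul (q q' : lring K) : in_vars (N := {poly K}) k q ->
  in_vars (N := {poly K}) k q' -> in_vars (N := {poly K}) k (q * q').
Proof.
move=> vq vq'; rewrite malgME; apply: in_vars_sumseq => m mq.
apply: in_vars_sumseq => m' mp; apply: in_vars_mono => i le.
by rewrite cmM (vq m i mq le) (vq' m' i mp le).
Qed.

Lemma in_vars_one : in_vars (N := {poly K}) k (1 : lring K).
Proof. by rewrite -umono1 umonoE; apply: in_vars_mono => i _; rewrite cm1. Qed.

Lemma in_vars_lam i : (i < k)%N -> in_vars (N := {poly K}) k (lam i : lring K).
Proof.
move=> lt; rewrite lamE umonoE; apply: in_vars_mono => j le; rewrite cmU.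
by case: eqP => // e; move: le; rewrite -e leqNgt lt.
Qed.

Lemma in_vars_del : in_vars (N := {poly K}) k (del : lring K).
Proof. by apply: in_vars_mono => i _; rewrite cm1. Qed.

Lemma in_varsN (M : zmodType) (p : lpoly M) : in_vars k p -> in_vars k (- p).
Proof. by move=> vp m i; rewrite /lsupp msuppN => /vp; apply. Qed.

Lemma in_vars_leval (M : lmodType {poly K}) (s : nat -> lring K) (h : M -> smod N)
    (p : lpoly M) l :
  in_vars l p -> (forall i, (i < l)%N -> in_vars (N := {poly K}) k (s i)) ->
  (forall x, in_vars k (h x)) -> in_vars k (leval s h p).
Proof.
move=> vp vs vh; apply: in_vars_sumseq => m mp; apply: in_vars_lact => //.
rewrite /mev big_seq; apply: (big_ind (in_vars (N := {poly K}) k)).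
- exact: in_vars_one.
- exact: in_vars_mul.
move=> i; rewrite -cmE_neq0 => mi; elim: (m i) => [|e IH].
  by rewrite expr0; apply: in_vars_one.
rewrite exprS; apply: in_vars_mul => //; apply: vs.
by rewrite ltnNge; apply: contra mi => le; rewrite (vp m i mp le).
Qed.

Lemma in_vars_lsubst (s : nat -> lring K) (p : lpoly N) l :
  in_vars l p -> (forall i, (i < l)%N -> in_vars (N := {poly K}) k (s i)) ->
  in_vars k (lsubst s p).
Proof.
move=> vp vs; rewrite lsubstE; apply: (in_vars_leval vp vs) => x.
by apply: in_vars_mono => i _; rewrite cm1.
Qed.

End VarsClosure.

Section Recovery.
Variables (K : fieldType) (E : lmodType {poly K}).
Implicit Types (F G : mcochain E E).

Local Notation R := (lring K).
Local Notation multimap := (@multimap K (lring K) (@lcst K) E (smod E)).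
Local Notation rho := (@rho K (lring K) (@lcst K) E (smod E)).

Local Notation sesq := (@sesq K (lring K) (@lcst K) E (smod E)).
Local Notation sesqV := (@sesqV K (lring K) (@lcst K) E (smod E)).

(** Sesquilinearity relates the values of a test function at one weight only, so
    it may be supported at a single weight; [- del] is the total weight of
    λ_0, ..., λ_(k-1), λ_k^‡. *)
Definition test0 (z : R * E) : smod E := if z.1 == - del then lconst z.2 else 0.

Lemma test0_sesq : sesq test0.
Proof.
move=> t; rewrite /test0 /=; case: eqP => [->|_] a x y; last first.
  by rewrite scaler0 addr0.
by rewrite opprK; apply: lconst_dlinear.
Qed.

Definition dagw k : seq R := mkseq (sub_dag K k.+1) k.+1.

Lemma dagw_sum k : \sum_(c <- dagw k) c = - del.
Proof.
rewrite big_map -[iota 0 _]/(index_iota 0 k.+1) big_mkord big_ord_recr /= {2}/sub_dag /= eqxx /ldag /= addrA.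
rewrite -[RHS]add0r; congr (_ + _); rewrite -sumrB; apply: big1 => i _.
by rewrite /sub_dag /= ltn_eqF // subrr.
Qed.

Lemma rho_test0 F (w : seq R) a : size w = size a -> \sum_(c <- w) c = - del ->
  rho F (zip w a) test0 = lsubst (nth 0 w) (F a).
Proof.
move=> sz ew; rewrite rhoE; last exact: test0_sesq.
rewrite unzip1_zip ?sz // unzip2_zip ?sz // lsubstE; apply: eq_leval => // x.
by rewrite /weight unzip1_zip ?sz // ew /test0 eqxx.
Qed.

(** Evaluation at the generic weights λ_0, ..., λ_(k-1), λ_k^‡ loses nothing. *)
Lemma rho_dag k F a : size a = k.+1 -> in_vars k (F a) ->
  rho F (zip (dagw k) a) test0 = F a.
Proof.
move=> sz vF; rewrite rho_test0 ?dagw_sum ?size_mkseq //.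
apply: (lsubst_in_vars vF) => i lt; rewrite nth_mkseq ?ltnS ?(ltnW lt) //.
by rewrite /sub_dag /= ltn_eqF.
Qed.

Lemma multimap_slot k T a b : multimap k T -> sesqV (fun z => T (a ++ z :: b)).
Proof.
move=> mT phi.
have -> : (fun z => T (a ++ z :: b) phi) =
    (fun z => sg (odd (size a)) (T (z :: a ++ b) phi)).
  apply/funext => z; rewrite (alt_move z a b (mm_alt mT)).
  by case: (odd (size a)); rewrite //= opprK.
by case: (odd (size a)) => /=; [apply: sesqN|]; apply: (mm_sesq mT (a ++ b)).
Qed.

Lemma dag_split k (a1 a2 : seq E) x : (size a1 + size a2).+1 = k.+1 ->
  zip (dagw k) (a1 ++ x :: a2) =
  zip (take (size a1) (dagw k)) a1
    ++ (sub_dag K k.+1 (size a1), x) :: zip (drop (size a1).+1 (dagw k)) a2.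
Proof.
move=> sz; have lt : (size a1 < k.+1)%N by rewrite -sz ltnS leq_addr.
rewrite -{1}(cat_take_drop (size a1) (dagw k)) zip_cat; last first.
  by rewrite size_takel // size_mkseq ltnW.
by rewrite (drop_nth 0) ?size_mkseq //= nth_mkseq.
Qed.

(** The conditions on a cochain are those on its realization, evaluated at the
    generic weights. *)
Lemma cochain_of_multimap k F :
  (forall a, size a <> k.+1 -> F a = 0) -> (forall a, in_vars k (F a)) ->
  multimap k.+1 (rho F) -> is_cochain k.+1 F.
Proof.
move=> aF vF mF; split => //.
- move=> a1 a2 c x y sz.
  have rec z : F (a1 ++ z :: a2) = rho F (zip (take (size a1) (dagw k)) a1
      ++ (sub_dag K k.+1 (size a1), z) :: zip (drop (size a1).+1 (dagw k)) a2) test0.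
    by rewrite -dag_split // rho_dag // size_cat /= addnS.
  rewrite !rec (multimap_slot _ _ mF) polyevC.
  by rewrite lscaleE.
- move=> a1 a2 x sz.
  have rec z : F (a1 ++ z :: a2) = rho F (zip (take (size a1) (dagw k)) a1
      ++ (sub_dag K k.+1 (size a1), z) :: zip (drop (size a1).+1 (dagw k)) a2) test0.
    by rewrite -dag_split // rho_dag // size_cat /= addnS.
  rewrite !rec (dlinearZ (multimap_slot _ _ mF _ _)).
  by rewrite polyevX.
move=> s a; have sa : size a = k.+1 by rewrite size_tuple.
have sD : size (dagw k) = k.+1 by rewrite size_mkseq.
rewrite sg_scale oddb.
pose z0 : R * E := (0, tnth a ord0).
pose b := permute s a; have sb : size b = k.+1 by rewrite size_map size_enum_ord.
have er : reorder z0 (zip (dagw k) a) s = zip (reorder 0 (dagw k) s) b.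
  apply: (@eq_from_nth _ z0); first by rewrite size_zip !size_reorder sb minnn.
  move=> i; rewrite size_reorder => lt.
  rewrite (nth_reorder z0 z0 _ s (Ordinal lt)) !nth_zip ?size_reorder ?sb ?sD ?sa //.
  have /= -> := nth_reorder 0 0 (dagw k) s (Ordinal lt); congr (_, _).
  rewrite (nth_map (Ordinal lt)) ?size_enum_ord // (nth_ord_enum _ (Ordinal lt)).
  by rewrite [RHS](tnth_nth (tnth a ord0)).
have -> : lsubst (sub_dag K k.+1) (eval_at F (take k.+1.-1 [seq lam (s i) | i : 'I_k.+1]) b)
    = rho F (zip (reorder 0 (dagw k) s) b) test0.
  rewrite rho_test0 ?size_reorder ?sb //; last first.
    rewrite -(dagw_sum k) [LHS]big_image [RHS](big_nth 0) sD big_mkord.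
    by rewrite [RHS](reindex_inj (@perm_inj _ s)); apply: eq_bigl.
  rewrite lsubstE (leval_lsubst _ _ _ (@lconst_dlinear K E)) lsubstE.
  apply: (@leval_in_vars K R E (smod E) k) => [|i lt]; first exact: vF.
  have lt' : (i < k.+1)%N by rewrite ltnS ltnW.
  have /= -> := nth_reorder 0 0 (dagw k) s (Ordinal lt').
  rewrite /= (nth_take _ lt).
  have eL := nth_map (Ordinal lt') 0 (fun j => lam (s j) : R) (n := i).
  rewrite eL ?size_enum_ord // lsub_lam (nth_ord_enum _ (Ordinal lt')).
  by rewrite nth_mkseq.
rewrite -er (alt_reorder z0 s (mm_alt mF)) ?size_zip ?sD ?sa ?minnn //.
rewrite -[LHS](rho_dag sa (vF a)).
by case: (odd_perm s) => //=; rewrite opprK.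
Qed.

Lemma star_in_vars m n F G x : is_cochain m.+1 F -> is_cochain n.+1 G ->
  in_vars (m + n) (star m.+1 n.+1 F G x).
Proof.
move=> cF cG; rewrite /star; case: ifP => _; first exact: in_vars0.
have -> : (m.+1 + n.+1).-1 = (m + n).+1 by rewrite addSn addnS.
apply: (@in_vars_lsubst _ _ _ _ _ (m + n).+1); last first.
  move=> i; rewrite ltnS leq_eqVlt /sub_dag /= => /orP [/eqP ->|lt].
    rewrite eqxx /ldag; apply: in_varsD; last exact/in_varsN/in_vars_del.
    apply/in_varsN/in_vars_sum => j _; exact: in_vars_lam.
  by rewrite ltn_eqF //; apply: in_vars_lam.
apply: in_vars_sum => s _; rewrite sg_scale.
set ls := [seq lam (s i) | i : _].
have vls l : l \in ls -> in_vars (N := {poly K}) (m + n).+1 l.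
  by case/imageP => i _ ->; apply: in_vars_lam.
have vnth (r : seq R) i : (forall l, l \in r -> in_vars (N := {poly K}) (m + n).+1 l) ->
    in_vars (N := {poly K}) (m + n).+1 (nth 0 r i).
  move=> vr; have [lt|ge] := ltnP i (size r); first exact/vr/mem_nth.
  by rewrite nth_default //; apply: in_vars0.
set Q := lext _ _; suff vQ : in_vars (m + n).+1 Q.
  by rewrite /sg; case: odd => //; apply: in_varsN.
rewrite /Q lextE; apply: (@in_vars_leval _ _ _ _ _ _ _ (m + n).+1).
- rewrite /eval_at; apply: (@in_vars_lsubst K E _ _ _ n) => [|i _].
    exact: co_vars cG _.
  apply: vnth => l.
  by move/mem_take; apply: vls.
- exact: in_vars_lam.
move=> y; rewrite /eval_at; apply: (@in_vars_lsubst K E _ _ _ m) => [|i _].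
  exact: co_vars cF _.
apply: vnth => l.
move/mem_take; rewrite inE => /orP [/eqP ->|/mem_drop]; last exact: vls.
by apply: in_vars_sumseq => l' /mem_take; apply: vls.
Qed.

Lemma star_cochain m n F G : is_cochain m.+1 F -> is_cochain n.+1 G ->
  is_cochain (m + n).+1 (star m.+1 n.+1 F G).
Proof.
move=> cF cG; apply: cochain_of_multimap.
- move=> a /eqP; rewrite /star.
  have -> : (m.+1 + n.+1).-1 = (m + n).+1 by rewrite addSn addnS.
  by move/negPf=> sz; rewrite sz.
- by move=> a; apply: star_in_vars.
have -> : rho (star m.+1 n.+1 F G) = pstar n.+1 (rho F) (rho G).
  by apply/funext => zs; apply: rho_star.
by rewrite -addnS; apply: pstar_multimap; apply: rho_multimap.
Qed.

(** Both sides are recovered from their realizations, where the identity is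
    [pstar_prelie]. *)
Lemma star_prelie m n p F G X a :
  is_cochain m.+1 F -> is_cochain n.+1 G -> is_cochain p.+1 X ->
  star (m + n).+1 p.+1 (star m.+1 n.+1 F G) X a
  - star m.+1 (n + p).+1 F (star n.+1 p.+1 G X) a =
  sg (odd n && odd p) (star (m + p).+1 n.+1 (star m.+1 p.+1 F X) G a
  - star m.+1 (p + n).+1 F (star p.+1 n.+1 X G) a).
Proof.
move=> cF cG cX.
have cFG := star_cochain cF cG; have cGX := star_cochain cG cX.
have cFX := star_cochain cF cX; have cXG := star_cochain cX cG.
have c1 := star_cochain cFG cX; have c2 := star_cochain cF cGX.
have c3 := star_cochain cFX cG; have c4 := star_cochain cF cXG.
rewrite !addnA in c2 c4; rewrite [(m + p + n)%N]addnAC in c3 c4.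
have [sa|/eqP na] := eqVneq (size a) (m + n + p).+1; last first.
  rewrite (co_arity c1 na) (co_arity c2 na) (co_arity c3 na) (co_arity c4 na).
  by rewrite subr0 sg0.
rewrite -[star (m + n).+1 _ _ _ a](rho_dag sa (@co_vars _ _ _ _ _ c1 a)).
rewrite -[star m.+1 (n + p).+1 _ _ a](rho_dag sa (@co_vars _ _ _ _ _ c2 a)).
rewrite -[star (m + p).+1 _ _ _ a](rho_dag sa (@co_vars _ _ _ _ _ c3 a)).
rewrite -[star m.+1 (p + n).+1 _ _ a](rho_dag sa (@co_vars _ _ _ _ _ c4 a)).
rewrite !rho_star //.
rewrite (_ : rho (star m.+1 n.+1 F G) = pstar n.+1 (rho F) (rho G)); last first.
  by apply/funext => zs; apply: rho_star.
rewrite (_ : rho (star n.+1 p.+1 G X) = pstar p.+1 (rho G) (rho X)); last first.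
  by apply/funext => zs; apply: rho_star.
rewrite (_ : rho (star m.+1 p.+1 F X) = pstar p.+1 (rho F) (rho X)); last first.
  by apply/funext => zs; apply: rho_star.
rewrite (_ : rho (star p.+1 n.+1 X G) = pstar n.+1 (rho X) (rho G)); last first.
  by apply/funext => zs; apply: rho_star.
have mF := @rho_multimap K (lring K) (@lcst K) E (smod E) m F cF.
have mG := @rho_multimap K (lring K) (@lcst K) E (smod E) n G cG.
have mX := @rho_multimap K (lring K) (@lcst K) E (smod E) p X cX.
have := congr1 (fun v => v test0) (pstar_prelie (zip (dagw _) a) mF mG mX).
rewrite /assoc !addSn !addnS /= !negbK.
by case: (odd n && odd p); apply.
Qed.

End Recovery.

(** * The graded Lie algebra of cochains *)

Section Bilinear.
Variables (K : fieldType).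

Lemma leval_Kscale (M N : lmodType {poly K}) (s : nat -> lring K)
    (h : M -> smod N) (c : K) (p : lpoly M) :
  (forall x y, h (x + y) = h x + h y) ->
  (forall x, h (c%:P *: x) = lcst c *: h x) ->
  leval s h (c *: p) = lcst c *: leval s h p.
Proof.
move=> hD hZ; elim/lpoly_ind: p => [|p q IH IH'|x m].
- by rewrite scaler0 leval0 scaler0.
- by rewrite scalerDr !levalD // IH IH' scalerDr.
rewrite lscaleE; have -> : lcst c = umono c%:P mone by rewrite umonoE.
rewrite lact_mono mul1m !leval_mono // hZ.
have -> : lcst c = umono c%:P mone by rewrite umonoE.
by rewrite !scalerA mulrC.
Qed.

Lemma lsubst_lin (N : lmodType {poly K}) (s : nat -> lring K) (c : K)
    (p q : lpoly N) :
  lsubst s (c *: p + q) = c *: lsubst s p + lsubst s q.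
Proof.
rewrite !lsubstE (levalD _ (dlinearD (@lconst_dlinear K N))).
by rewrite (leval_scale _ _ _ (@lconst_dlinear K N)) [in RHS]lscaleE.
Qed.

Lemma lsubst0 (N : lmodType {poly K}) (s : nat -> lring K) :
  lsubst s (0 : lpoly N) = 0.
Proof. by rewrite lsubstE leval0. Qed.

Lemma lext0 (M N : lmodType {poly K}) (h : M -> lpoly N) : lext h 0 = 0.
Proof. by rewrite lextE leval0. Qed.

Lemma lext_h0 (M N : lmodType {poly K}) (q : lpoly M) :
  lext (fun=> 0 : lpoly N) q = 0.
Proof. by rewrite lextE leval_h0. Qed.

Lemma lext_linl (M N : lmodType {poly K}) (c : K) (h h' : M -> lpoly N) q :
  lext (fun x => c *: h x + h' x) q = c *: lext h q + lext h' q.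
Proof.
rewrite !lextE lscaleE.
apply: (etrans (y := leval (@lam K)
    (fun x => lcst c *: (h x : smod N) + (h' x : smod N)) q)).
  by apply: eq_leval => // x; rewrite lscaleE.
by rewrite leval_hD leval_hZ.
Qed.

Lemma lext_linr (M N : lmodType {poly K}) (h : M -> lpoly N) (c : K) p q :
  (forall c x y, h (c%:P *: x + y) = c *: h x + h y) ->
  lext h (c *: p + q) = c *: lext h p + lext h q.
Proof.
move=> hl; have hD x y : h (x + y) = h x + h y.
  by rewrite -[in LHS](scale1r x) -polyC1 hl scale1r.
have h0 : h 0 = 0 by apply: (addrI (h 0)); rewrite -hD !addr0.
have hZ x : (h (c%:P *: x) : smod N) = lcst c *: (h x : smod N).
  by rewrite -[_ *: x]addr0 hl h0 addr0 lscaleE.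
rewrite (lscaleE c (lext h p)) !lextE.
have e1 := @levalD K (lring K) M (smod N) (@lam K) h hD (c *: p) q.
have e2 := @leval_Kscale M N (@lam K) h c p hD hZ.
by rewrite e1 e2.
Qed.

Variable E : lmodType {poly K}.
Implicit Types (F G : mcochain E E).

(** The part of multilinearity that composition needs: the inserted value always
    occupies the first slot. *)
Definition lin1 F := forall (c : K) x y a,
  F ((c%:P *: x + y) :: a) = c *: F (x :: a) + F (y :: a).

Lemma cochain_lin1 n F : is_cochain n.+1 F -> lin1 F.
Proof.
move=> cF c x y a; have [/eqP sa|ne] := eqVneq (size a) n.
  by apply: (co_lin cF (a1 := [::]) c x y); rewrite /= (eqP sa).
by rewrite !(co_arity cF) ?scaler0 ?addr0 //= => -[e]; rewrite e eqxx in ne.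
Qed.

Lemma eval_at_lin c F G s a :
  eval_at (c *: F + G) s a = c *: eval_at F s a + eval_at G s a.
Proof. exact: lsubst_lin. Qed.

Lemma mcochainE c F G a : (c *: F + G) a = c *: F a + G a.
Proof. by []. Qed.

Lemma star_linl m n c F F' G :
  star m n (c *: F + F') G = c *: star m n F G + star m n F' G.
Proof.
apply/funext => x; rewrite mcochainE /star; case: ifP => _.
  by rewrite scaler0 addr0.
rewrite -lsubst_lin scaler_sumr -big_split; congr (lsubst _ _).
apply: eq_bigr => s _ /=; rewrite scalerA mulrC -scalerA -scalerDr.
congr (_ *: _); rewrite -lext_linl; congr lext; apply/funext => y.
exact: eval_at_lin.
Qed.

Lemma star_linr m n c F G G' : lin1 F ->
  star m n F (c *: G + G') = c *: star m n F G + star m n F G'.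
Proof.
move=> lF; apply/funext => x; rewrite mcochainE /star; case: ifP => _.
  by rewrite scaler0 addr0.
rewrite -lsubst_lin scaler_sumr -big_split; congr (lsubst _ _).
apply: eq_bigr => s _ /=; rewrite scalerA mulrC -scalerA -scalerDr.
congr (_ *: _); rewrite eval_at_lin lext_linr // => {}c y y'.
by rewrite /eval_at lF lsubst_lin.
Qed.

Lemma star_arity_zero m n m' n' F G x :
  (forall a, size a <> m' -> F a = 0) -> (forall a, size a <> n' -> G a = 0) ->
  (0 < m)%N -> (m, n) != (m', n') -> star m n F G x = 0.
Proof.
move=> aF aG m0 ne; rewrite /star; case: ifP => // /negbFE/eqP sx.
rewrite big1 ?lsubst0 // => s _.
have sz T (g : 'I_(m + n).-1 -> T) : size [seq g i | i : 'I_(m + n).-1] = (m + n).-1.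
  by rewrite size_map size_enum_ord.
have le : (n <= (m + n).-1)%N by rewrite -(ltn_predK m0) addSn leq_addl.
case: (eqVneq n n') ne => [<-|ne _]; last first.
  rewrite /eval_at aG ?lsubst0 ?lext0 ?scaler0 // size_takel ?sz //.
  exact/eqP.
rewrite xpair_eqE eqxx andbT => ne.
have -> : (fun y => eval_at F (take m.-1 (\sum_(l <- take n [seq lam (s i) | i : _]) l
      :: drop n [seq lam (s i) | i : _])) (y :: drop n [seq nth 0 x (s i) | i : _])) =
    (fun=> 0).
  apply/funext => y; rewrite /eval_at aF ?lsubst0 //= size_drop sz => e.
  move: ne; rewrite -e -(ltn_predK m0) addSn /= addnK eqxx //.
by rewrite lext_h0 scaler0.
Qed.

(** On homogeneous cochains only one summand of the bracket survives. *)
Lemma NR_homog m n F G :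
  (forall a, size a <> m.+1 -> F a = 0) -> (forall a, size a <> n.+1 -> G a = 0) ->
  NR F G = star m.+1 n.+1 F G - (-1) ^+ (m * n) *: star n.+1 m.+1 G F.
Proof.
move=> aF aG; apply/funext => x; rewrite /NR.
have e p q : NR_hom p q F G x =
    star p q F G x - (-1) ^+ (p.-1 * q.-1) *: star q p G F x by [].
have z p q (A B : mcochain E E) k l :
    (forall a, size a <> k -> A a = 0) -> (forall a, size a <> l -> B a = 0) ->
    size x <> (k + l).-1 -> (0 < p)%N -> (p + q).-1 = size x -> star p q A B x = 0.
  move=> aA aB nx p0 epq; apply: (star_arity_zero _ aA aB p0).
  by apply/eqP => -[ep eq]; apply: nx; rewrite -epq ep eq.
have arith p : (p < size x)%N -> (p.+1 + (size x - p)).-1 = size x.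
  by move=> lt; rewrite addSn /= subnKC // ltnW.
have [sx|/eqP nx] := eqVneq (size x) (m + n).+1; last first.
  have zero A B k l : (k + l)%N = (m + n)%N -> star k.+1 l.+1 A B x = 0.
    by move=> kl; rewrite /star addSn addnS /= kl; move/eqP/negPf: nx => ->.
  have nx1 : size x <> (m.+1 + n.+1).-1 by rewrite addSn addnS.
  have nx2 : size x <> (n.+1 + m.+1).-1 by rewrite addnC.
  rewrite big1 => [|p _]; last first.
    have lt := ltn_ord p; have pos : (0 < size x - p)%N by rewrite subn_gt0.
    rewrite e (z p.+1 _ F G _ _ aF aG nx1 isT (arith p lt)).
    rewrite (z _ p.+1 G F _ _ aG aF nx2 pos) ?scaler0 ?subrr //.
    by rewrite addnC arith.
  have -> : (star m.+1 n.+1 F G - (-1) ^+ (m * n) *: star n.+1 m.+1 G F) x =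
      star m.+1 n.+1 F G x - (-1) ^+ (m * n) *: star n.+1 m.+1 G F x by [].
  by rewrite (zero F G m n) // (zero G F n m (addnC n m)) scaler0 subr0.
have ltm : (m < size x)%N by rewrite sx ltnS leq_addr.
rewrite (bigD1 (Ordinal ltm)) //= big1 ?addr0 => [|p].
  by rewrite e sx subSn ?leq_addr // addKn.
rewrite -val_eqE /= => ne; rewrite e.
rewrite (star_arity_zero _ aF aG) //; last by rewrite xpair_eqE eqSS (negPf ne).
rewrite (star_arity_zero _ aG aF) ?subn_gt0 ?scaler0 ?subrr //.
by rewrite xpair_eqE eqSS (negPf ne) andbF.
Qed.

Lemma NR_lin c c' F F' G G' : lin1 F -> lin1 F' -> lin1 G -> lin1 G' ->
  (NR (c *: F + F') G = c *: NR F G + NR F' G) *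
  (NR F (c' *: G + G') = c' *: NR F G + NR F G').
Proof.
move=> lF lF' lG lG'; split; apply/funext => x; rewrite mcochainE /NR.
  rewrite scaler_sumr -big_split; apply: eq_bigr => p _ /=.
  rewrite /NR_hom star_linl star_linr // -!mcochainE scalerDr !scalerA mulrC.
  by rewrite -scalerA opprD addrACA -scalerBr.
rewrite scaler_sumr -big_split; apply: eq_bigr => p _ /=.
rewrite /NR_hom star_linl star_linr // -!mcochainE scalerDr !scalerA mulrC.
by rewrite -scalerA opprD addrACA -scalerBr.
Qed.

End Bilinear.

(** * Direct sums and linear combinations *)

Section DirectSums.
Variables (K : fieldType) (V : lmodType K) (G : nat -> V -> Prop).
Hypothesis gG : graded_space G.

Lemma dsum_ind (P : V -> Prop) : P 0 -> (forall x y, P x -> P y -> P (x + y)) ->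
  (forall n x, G n x -> P x) -> forall x, dsum G x -> P x.
Proof. by move=> P0 PD PG x [k [y [Gy ->]]]; apply: big_ind => // i _; apply: (PG i). Qed.

Lemma dsum_homog n x : G n x -> dsum G x.
Proof.
move=> Gx; exists n.+1, (fun i => if i == n then x else 0); split=> [i|].
  by case: eqP => [->|_] //; apply: gs_0.
by rewrite big_ord_recr /= eqxx big1 ?add0r // => i _; rewrite ltn_eqF.
Qed.

Lemma dsum0 : dsum G 0.
Proof. by exists 0%N, (fun=> 0); split; [move=> i; apply: gs_0|rewrite big_ord0]. Qed.

Lemma dsum_lin c x y : dsum G x -> dsum G y -> dsum G (c *: x + y).
Proof.
move=> [k [u [Gu ->]]] [l [v [Gv ->]]].
exists (k + l)%N, (fun i => c *: (if (i < k)%N then u i else 0)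
                            + (if (i < l)%N then v i else 0)).
split=> [i|]; first by apply: gs_lin => //; case: ifP => // _; apply: gs_0.
rewrite big_split -scaler_sumr; congr (_ *: _ + _).
  rewrite big_split_ord /= [X in _ + X]big1 ?addr0 => [|i _].
    by apply: eq_bigr => i _; rewrite ltn_ord.
  by rewrite ltnNge leq_addr.
rewrite addnC big_split_ord /= [X in _ + X]big1 ?addr0 => [|i _].
  by apply: eq_bigr => i _; rewrite ltn_ord.
by rewrite ltnNge leq_addr.
Qed.

Lemma dsumD x y : dsum G x -> dsum G y -> dsum G (x + y).
Proof. by move=> dx dy; rewrite -[x]scale1r; apply: dsum_lin. Qed.

End DirectSums.

Section CochainSpace.
Variables (K : fieldType) (M N : lmodType {poly K}).
Implicit Types (F G : mcochain M N).

Lemma cochain0 k : is_cochain k (0 : mcochain M N).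
Proof.
split=> //.
- by move=> a; apply: in_vars0.
- by move=> a1 a2 c x y _; rewrite scaler0 addr0.
- by move=> a1 a2 x _; rewrite lact0r.
- by move=> s a; rewrite /eval_at !lsubst0 scaler0.
Qed.

Lemma in_varsZ k c (p : lpoly N) : in_vars k p -> in_vars k (c *: p).
Proof.
move=> vp; rewrite lscaleE; apply: in_vars_lact => //.
by apply: in_vars_mono => i _; rewrite cm1.
Qed.

Lemma cochain_lin k c F G :
  is_cochain k F -> is_cochain k G -> is_cochain k (c *: F + G).
Proof.
move=> cF cG; have E a : (c *: F + G) a = c *: F a + G a by [].
split.
- by move=> a sa; rewrite E (co_arity cF sa) (co_arity cG sa) scaler0 addr0.
- move=> a; rewrite E; apply: in_varsD; last exact: co_vars cG a.
  by apply: in_varsZ; apply: co_vars cF a.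
- move=> a1 a2 d x y sz; rewrite !E (co_lin cF _ _ _ sz) (co_lin cG _ _ _ sz).
  by rewrite !scalerDr !scalerA mulrC addrACA.
- move=> a1 a2 x sz; rewrite !E (co_sesq cF _ sz) (co_sesq cG _ sz).
  by rewrite !lscaleE lactDr !lactA mulrC.
- move=> s a; rewrite !E (co_skew cF s a) (co_skew cG s a) /eval_at E !lsubst_lin.
  by rewrite scalerDr !scalerA mulrC.
Qed.

Lemma cochain_graded : graded_space (fun n (h : mcochain M N) => is_cochain n.+1 h).
Proof.
split; [by move=> n; apply: cochain0|by move=> n; apply: cochain_lin|].
move=> k y cy sy i lt; apply/funext => a.
have [sa|/eqP na] := eqVneq (size a) i.+1; last exact: co_arity (cy i) a na.
have sumE r (P : pred 'I_k) : (\sum_(j <- r | P j) y j) a = \sum_(j <- r | P j) y j a.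
  by elim/big_rec2: _ => // j u v _ <-.
have := congr1 (fun F : mcochain M N => F a) sy.
rewrite sumE (bigD1 (Ordinal lt)) //= big1 ?addr0 // => j.
rewrite -val_eqE /= => ne; apply: (co_arity (cy j)); rewrite sa => -[e].
by rewrite e eqxx in ne.
Qed.

End CochainSpace.

(** * The Nijenhuis-Richardson bracket is a graded Lie bracket *)

(** The Jacobi identity of a graded commutator in terms of the twelve iterated
    products: [lijk] is (i j) k, [rijk] is i (j k), and [oi] is the parity of
    the degree. *)
Lemma jacobi_of_prelie (V : zmodType) (o1 o2 o3 : bool)
    (l123 l132 l213 l231 l312 l321 r123 r132 r213 r231 r312 r321 : V) :
  l123 - r123 = sg (o2 && o3) (l132 - r132) ->
  l213 - r213 = sg (o1 && o3) (l231 - r231) ->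
  l312 - r312 = sg (o1 && o2) (l321 - r321) ->
  (r123 - sg (o2 && o3) r132)
    - sg (o1 && (o2 (+) o3)) (l231 - sg (o2 && o3) l321) =
  ((l123 - sg (o1 && o2) l213)
    - sg ((o1 (+) o2) && o3) (r312 - sg (o1 && o2) r321))
  + sg (o1 && o2) ((r213 - sg (o1 && o3) r231)
    - sg (o2 && (o1 (+) o3)) (l132 - sg (o1 && o3) l312)).
Proof.
move=> /eqP; rewrite subr_eq => /eqP ->.
move=> /eqP; rewrite subr_eq => /eqP ->.
move=> /eqP; rewrite subr_eq => /eqP ->.
by case: o1; case: o2; case: o3 => /=; zmodule V.
Qed.

Section GradedLie.
Variables (K : fieldType) (E : lmodType {poly K}).
Implicit Types (F G X : mcochain E E).

Lemma NR_cochain m n F G : is_cochain m.+1 F -> is_cochain n.+1 G ->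
  NR F G = star m.+1 n.+1 F G - (-1) ^+ (m * n) *: star n.+1 m.+1 G F.
Proof. by move=> cF cG; apply: NR_homog; [apply: co_arity cF|apply: co_arity cG]. Qed.

Lemma NR_closed m n F G : is_cochain m.+1 F -> is_cochain n.+1 G ->
  is_cochain (m + n).+1 (NR F G).
Proof.
move=> cF cG; rewrite (NR_cochain cF cG) addrC -scaleNr.
by apply: cochain_lin; [rewrite addnC|]; apply: star_cochain.
Qed.

Lemma dsum_lin1 F : dsum (fun n h => is_cochain n.+1 h) F -> lin1 F.
Proof.
apply: dsum_ind => [c x y a|{}F G lF lG c x y a|n {}F]; last exact: cochain_lin1.
  by rewrite scaler0 addr0.
rewrite [LHS]/(F _ + G _) lF lG -[(F + G) (x :: a)]/(F _ + G _) scalerDr.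
by rewrite addrACA.
Qed.

Lemma NR_jacobi m n p F G X :
  is_cochain m.+1 F -> is_cochain n.+1 G -> is_cochain p.+1 X ->
  NR F (NR G X) = NR (NR F G) X + (-1) ^+ (m * n) *: NR G (NR F X).
Proof.
move=> cF cG cX.
have cGX := NR_closed cG cX; have cFG := NR_closed cF cG; have cFX := NR_closed cF cX.
rewrite (NR_cochain cF cGX) (NR_cochain cFG cX) (NR_cochain cG cFX).
rewrite (NR_cochain cF cG) (NR_cochain cG cX) (NR_cochain cF cX).
have lF := cochain_lin1 cF; have lG := cochain_lin1 cG; have lX := cochain_lin1 cX.
have sub_linl a b (A B C : mcochain E E) e : star a b (A - e *: B) C =
    star a b A C - e *: star a b B C.
  by rewrite [A - _]addrC -[- (e *: B)]scaleNr star_linl scaleNr addrC.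
have sub_linr a b (A B C : mcochain E E) e : lin1 A -> star a b A (B - e *: C) =
    star a b A B - e *: star a b A C.
  by move=> lA; rewrite [B - _]addrC -[- (e *: C)]scaleNr star_linr // scaleNr addrC.
rewrite !sub_linl !sub_linr //.
apply/funext => a.
have p1 := star_prelie a cF cG cX; have p2 := star_prelie a cG cF cX.
have p3 := star_prelie a cX cF cG.
rewrite ![(n + m)%N]addnC ![(p + n)%N]addnC ![(p + m)%N]addnC in p1 p2 p3 *.
have := jacobi_of_prelie p1 p2 p3.
rewrite !sg_scale !oddM !oddD.
have sgE b H : sg b H a = sg b (H a) by case: b.
have addE H H' : (H + H') a = H a + H' a by [].
have oppE H : (- H) a = - H a by [].
by rewrite !(addE, oppE, sgE).
Qed.

Lemma NR_graded_lie :
  graded_lie (fun n (h : mcochain E E) => is_cochain n.+1 h) (@NR K E).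
Proof.
split.
- exact: cochain_graded.
- move=> c x x' y /dsum_lin1 lx /dsum_lin1 lx' /dsum_lin1 ly.
  exact: (NR_lin c c lx lx' ly ly).1.
- move=> c x y y' /dsum_lin1 lx /dsum_lin1 ly /dsum_lin1 ly'.
  exact: (NR_lin c c lx lx ly ly').2.
- by move=> m n x y cx cy; apply: NR_closed.
- move=> m n x y cx cy; rewrite (NR_cochain cx cy) (NR_cochain cy cx).
  by rewrite [(n * m)%N]mulnC scalerBr scalerA -expr2 sqrr_sign scale1r opprB.
- by move=> m n p x y z; apply: NR_jacobi.
Qed.

End GradedLie.

(** * Linear change of arguments and values *)

Section LinearMaps.
Variables (K : fieldType).

Definition klin (M N : lmodType {poly K}) (h : M -> N) :=
  forall a x y, h (a *: x + y) = a *: h x + h y.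

Lemma klin0 (M N : lmodType {poly K}) (h : M -> N) : klin h -> h 0 = 0.
Proof.
move=> hl; apply: (addrI (h 0)).
by rewrite -[X in X + _]scale1r -hl scale1r !addr0.
Qed.

Lemma klinD (M N : lmodType {poly K}) (h : M -> N) x y : klin h -> h (x + y) = h x + h y.
Proof. by move=> hl; rewrite -[in LHS](scale1r x) hl scale1r. Qed.

Lemma klinZ (M N : lmodType {poly K}) (h : M -> N) a x : klin h -> h (a *: x) = a *: h x.
Proof. by move=> hl; rewrite -[a *: x]addr0 hl klin0 // addr0. Qed.

Lemma klin_comp (M N Q : lmodType {poly K}) (g : N -> Q) (h : M -> N) :
  klin g -> klin h -> klin (g \o h).
Proof. by move=> gl hl a x y /=; rewrite hl gl. Qed.

Lemma lmap_comp (M N Q : lmodType {poly K}) (g : N -> Q) (h : M -> N) p :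
  klin g -> klin h -> lmap g (lmap h p) = lmap (g \o h) p.
Proof.
by move=> gl hl; apply: lpolyP => m; rewrite !lcoef_map //= ?(klin0 hl) ?(klin0 gl).
Qed.

Lemma eq_lmap (M N : lmodType {poly K}) (g h : M -> N) p :
  g =1 h -> lmap g p = lmap h p.
Proof. by move=> /funext ->. Qed.

Lemma lmap_id (M : lmodType {poly K}) (p : lpoly M) : lmap id p = p.
Proof. by apply: lpolyP => m; rewrite lcoef_map. Qed.

Section OneMap.
Variables (M N : lmodType {poly K}) (h : M -> N).
Hypothesis hl : klin h.

Let h0 := klin0 hl.

Lemma lmap0 : lmap h 0 = 0.
Proof. by apply: lpolyP => m; rewrite lcoef_map // /lcoef !mcoeff0. Qed.

Lemma lmapD p q : lmap h (p + q) = lmap h p + lmap h q.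
Proof. by apply: lpolyP => m; rewrite !(lcoefD, lcoef_map) // klinD. Qed.

Lemma lmap_umono x m : lmap h (umono x m) = umono (h x) m.
Proof.
by apply: lpolyP => m'; rewrite lcoef_map // !lcoef_umono; case: eqP.
Qed.

Lemma lmap_lact (q : lring K) p : lmap h (lact q p) = lact q (lmap h p).
Proof.
elim/lpoly_ind: p => [|p p' IH IH'|x m].
- by rewrite lact0r lmap0 lact0r.
- by rewrite lactDr !lmapD lactDr IH IH'.
elim/(@lpoly_ind {poly K}): q => [|q q' IH IH'|a m'].
- by rewrite !lact0l lmap0.
- by rewrite !lactDl lmapD IH IH'.
by rewrite lact_mono !lmap_umono lact_mono klinZ.
Qed.

Lemma lmapZ (c : K) p : lmap h (c *: p) = c *: lmap h p.
Proof. by rewrite !lscaleE lmap_lact. Qed.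

Lemma lmapN p : lmap h (- p) = - lmap h p.
Proof. by apply/eqP; rewrite -addr_eq0 -lmapD addNr lmap0. Qed.

Lemma lmap_sum I r (P : pred I) (F : I -> lpoly M) :
  lmap h (\sum_(i <- r | P i) F i) = \sum_(i <- r | P i) lmap h (F i).
Proof. exact: (big_morph _ lmapD lmap0). Qed.

Lemma in_vars_lmap k p : in_vars k p -> in_vars k (lmap h p).
Proof.
move=> vp m i; rewrite /lsupp -mcoeff_neq0 -/(lcoef _ m) lcoef_map // => ne.
apply: vp; rewrite /lsupp -mcoeff_neq0; apply: contraNneq ne => e.
by rewrite /lcoef e h0.
Qed.

Lemma lmap_leval (Q : lmodType {poly K}) (s : nat -> lring K) (g : Q -> smod M) p :
  lmap h (leval s g p) = leval s (fun x => lmap h (g x) : smod N) p.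
Proof.
rewrite /leval [LHS]lmap_sum; apply: eq_bigr => m _.
exact: lmap_lact.
Qed.

Lemma leval_lmap (Q : lmodType {poly K}) (s : nat -> lring K) (g : N -> smod Q) p :
  (forall x y, g (x + y) = g x + g y) ->
  leval s g (lmap h p) = leval s (g \o h) p.
Proof.
move=> gD; have ghD x y : (g \o h) (x + y) = (g \o h) x + (g \o h) y.
  by rewrite /= klinD.
elim/lpoly_ind: p => [|p p' IH IH'|x m].
- by rewrite lmap0 !leval0.
- by rewrite lmapD !levalD // IH IH'.
by rewrite lmap_umono !leval_mono.
Qed.

Lemma lmap_lconst x : lmap h (lconst x) = lconst (h x).
Proof. by rewrite !lconstE lmap_umono. Qed.

Lemma lmap_lsubst s p : lmap h (lsubst s p) = lsubst s (lmap h p).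
Proof.
rewrite !lsubstE lmap_leval leval_lmap; last exact: lconstD.
by apply: (@eq_leval K (lring K) M (smod N)) => // x; apply: lmap_lconst.
Qed.

Lemma lmap_lext (Q : lmodType {poly K}) (g : Q -> lpoly M) p :
  lmap h (lext g p) = lext (fun x => lmap h (g x)) p.
Proof. by rewrite !lextE lmap_leval. Qed.

Lemma lext_lmap (Q : lmodType {poly K}) (g : N -> lpoly Q) p :
  (forall x y, g (x + y) = g x + g y) -> lext g (lmap h p) = lext (g \o h) p.
Proof. by move=> gD; rewrite !lextE leval_lmap. Qed.

End OneMap.

Definition mcmap (M M' N N' : lmodType {poly K}) (al : M' -> M) (be : N -> N')
    (F : mcochain M N) : mcochain M' N' := fun a => lmap be (F (map al a)).

Lemma mcmap_cochain (M M' N N' : lmodType {poly K}) (al : M' -> M) (be : N -> N')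
    k (F : mcochain M N) :
  klin al -> klin be -> is_cochain k F -> is_cochain k (mcmap al be F).
Proof.
move=> la lb cF; rewrite /mcmap; split.
- by move=> a sa; rewrite (co_arity cF) ?size_map // lmap0.
- by move=> a; apply: in_vars_lmap => //; apply: co_vars cF _.
- move=> a1 a2 c x y sz; rewrite !map_cat /= la.
  by rewrite (co_lin cF) ?size_map // lmapD // lmapZ.
- move=> a1 a2 x sz; rewrite !map_cat /= (klinZ _ _ la).
  by rewrite (co_sesq cF) ?size_map // lmap_lact.
move=> s a; have := co_skew cF s (map_tuple al a).
rewrite /eval_at => /= ->; rewrite lmapZ // !lmap_lsubst //.
congr (_ *: lsubst _ (lsubst _ (lmap be (F _)))).
by rewrite /permute -[RHS]map_comp; apply: eq_map => i /=; rewrite tnth_map.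
Qed.

End LinearMaps.

(** * Cochains on a direct sum and the projection *)

Section Projection.
Variables (K : fieldType) (A B : lmodType {poly K}).
Local Notation E := (A * B)%type.
Implicit Types (F G : mcochain E E).

Lemma prA_klin : klin (@prA K A B). Proof. by []. Qed.
Lemma prB_klin : klin (@prB K A B). Proof. by []. Qed.
Lemma inA_klin : klin (@inA K A B).
Proof.
move=> a x y; have -> : a *: inA B x + inA B y = (a *: x + y, a *: 0 + 0) by [].
by rewrite scaler0 addr0.
Qed.
Lemma inB_klin : klin (@inB K A B).
Proof.
move=> a x y; have -> : a *: inB A x + inB A y = (a *: 0 + 0, a *: x + y) by [].
by rewrite scaler0 addr0.
Qed.

Definition iA (x : E) : E := inA B (prA x).
Definition iB (x : E) : E := inB A (prB x).

Lemma iA_klin : klin iA. Proof. exact: klin_comp inA_klin prA_klin. Qed.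
Lemma iB_klin : klin iB. Proof. exact: klin_comp inB_klin prB_klin. Qed.

Lemma iAB x : iA x + iB x = x.
Proof.
case: x => a b; have -> : iA (a, b) + iB (a, b) = (a + 0, 0 + b) by [].
by rewrite addr0 add0r.
Qed.

Lemma hatE (f : mcochain A B) : hat f = mcmap (@prA K A B) (@inB K A B) f.
Proof.
apply/funext => x; rewrite /hat /lpair /mcmap lmap0 ?add0r //.
exact: inA_klin.
Qed.

Lemma projFE F : projF A B F = mcmap iA iB F.
Proof.
rewrite /projF hatE; apply/funext => x; rewrite /mcmap.
by rewrite lmap_comp -?map_comp //; apply: inB_klin.
Qed.

Lemma hat_cochain k (f : mcochain A B) : is_cochain k f -> is_cochain k (hat f).
Proof. by move=> cf; rewrite hatE; apply: mcmap_cochain (inB_klin) cf. Qed.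

Lemma projF_hat (f : mcochain A B) : projF A B (hat f) = hat f.
Proof.
rewrite projFE hatE; apply/funext => x; rewrite /mcmap lmap_comp; last first.
- exact: inB_klin.
- exact: iB_klin.
by rewrite -map_comp.
Qed.

Lemma projF_Fgr n F : is_cochain n.+1 F -> Fgr A B n (projF A B F).
Proof.
move=> cF; exists (mcmap (@inA K A B) (@prB K A B) F); split=> //.
exact: mcmap_cochain inA_klin prB_klin cF.
Qed.

Lemma Fgr_Lgr n F : Fgr A B n F -> Lgr A B n F.
Proof. by case=> f [cf ->]; apply: hat_cochain. Qed.

Lemma projF_lin c F G :
  projF A B (c *: F + G) = c *: projF A B F + projF A B G.
Proof.
rewrite !projFE; apply/funext => x.
have -> : (c *: mcmap iA iB F + mcmap iA iB G) x =
    c *: mcmap iA iB F x + mcmap iA iB G x by [].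
have -> : mcmap iA iB (c *: F + G) x = lmap iB (c *: F (map iA x) + G (map iA x)).
  by [].
by rewrite lmapD ?lmapZ //; apply: iB_klin.
Qed.

Lemma hat_lin c (f g : mcochain A B) : hat (c *: f + g) = c *: hat f + hat g.
Proof.
rewrite !hatE; apply/funext => x.
have -> : (c *: mcmap (@prA K A B) (@inB K A B) f + mcmap (@prA K A B) (@inB K A B) g) x =
    c *: mcmap (@prA K A B) (@inB K A B) f x + mcmap (@prA K A B) (@inB K A B) g x by [].
have -> : mcmap (@prA K A B) (@inB K A B) (c *: f + g) x =
   lmap (@inB K A B) (c *: f (map (@prA K A B) x) + g (map (@prA K A B) x)) by [].
by rewrite lmapD ?lmapZ //; apply: inB_klin.
Qed.

Lemma Fgr_graded : graded_space (Fgr A B).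
Proof.
split.
- move=> n; exists 0; split; first exact: cochain0.
  by rewrite hatE; apply/funext => x; rewrite /mcmap lmap0 //; apply: inB_klin.
- move=> n c x y [f [cf ->]] [g [cg ->]]; exists (c *: f + g).
  by split; [apply: cochain_lin|rewrite hat_lin].
move=> k y Fy; apply: (gs_direct (cochain_graded E E)) => i.
exact: Fgr_Lgr.
Qed.

(** Used twice below: for two lifts, where nothing can be inserted because values
    lie in the second summand and arguments are read in the first, and for two
    cochains in the kernel of the projection, with all arguments in the first
    summand. *)
Lemma lmap_star_zero (P : E -> Prop) (be : E -> E) m n F G x :
  klin be -> P 0 -> (forall i, P (nth 0 x i)) ->
  (forall s1 s2 xs1 xs2, (forall i, P (nth 0 xs1 i)) -> (forall i, P (nth 0 xs2 i)) ->
     lmap be (lext (fun y => lsubst s1 (F (y :: xs2))) (lsubst s2 (G xs1))) = 0) ->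
  lmap be (star m n F G x) = 0.
Proof.
move=> lb P0 Px H; rewrite /star; case: ifP => _; first exact: lmap0.
rewrite lmap_lsubst // lmap_sum // big1 ?lsubst0 // => s _.
have Pxs i : P (nth 0 [seq nth 0 x (s j) | j : 'I_(m + n).-1] i).
  have [lt|ge] := ltnP i (m + n).-1; last first.
    by rewrite nth_default // size_map size_enum_ord.
  by rewrite (nth_map (Ordinal lt)) ?size_enum_ord.
rewrite lmapZ // [X in _ *: X]H ?scaler0 // => i.
  have [lt|ge] := ltnP i n; first by rewrite nth_take.
  by rewrite nth_default // size_take; case: ltnP => // /leq_trans; apply.
by rewrite nth_drop.
Qed.

Lemma star_hat m n (f g : mcochain A B) : lin1 (hat f) -> star m n (hat f) (hat g) = 0.
Proof.
move=> lf; apply/funext => x; rewrite -[LHS]lmap_id.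
apply: (lmap_star_zero (P := fun=> True)) => // s1 s2 xs1 xs2 _ _.
rewrite lmap_id [hat g]hatE /mcmap -lmap_lsubst; last exact: inB_klin.
have hD u v : hat f ((u + v) :: xs2) = hat f (u :: xs2) + hat f (v :: xs2).
  by rewrite -[in LHS](scale1r u) -polyC1 lf scale1r.
rewrite lext_lmap; [|exact: inB_klin|]; last first.
  by move=> u v; rewrite hD -[lsubst _ (hat f (u :: _))]scale1r -lsubst_lin scale1r.
have -> : (fun y => lsubst s1 (hat f (y :: xs2))) \o (@inB K A B) = (fun=> 0).
  apply/funext => u /=.
  have -> : hat f (inB A u :: xs2) = hat f (0 :: xs2) by [].
  have -> : hat f (0 :: xs2) = 0.
    by apply: (addrI (hat f (0 :: xs2))); rewrite -hD !addr0.
  exact: lsubst0.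
exact: lext_h0.
Qed.

Lemma projF_eq0 F : projF A B F = 0 -> forall x, (forall i, nth 0 x i = iA (nth 0 x i)) ->
  lmap iB (F x) = 0.
Proof.
rewrite projFE => /(congr1 (fun h : mcochain E E => h)) e x Px.
have := congr1 (fun h : mcochain E E => h x) e; rewrite /mcmap.
have -> // : map iA x = x.
apply: (@eq_from_nth _ 0); first by rewrite size_map.
by move=> i; rewrite size_map => lt; rewrite (nth_map 0) // -Px.
Qed.

Lemma lmap_split p : lmap iA p + lmap iB p = p.
Proof.
by apply: lpolyP => m; rewrite lcoefD !lcoef_map ?iAB.
Qed.

(** On arguments in the first summand, [G] has its values in the first summand,
    so that [F] is again evaluated there. *)
Lemma projF_star m n F G : lin1 F -> projF A B F = 0 -> projF A B G = 0 ->
  projF A B (star m n F G) = 0.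
Proof.
move=> lF PF PG; rewrite projFE; apply/funext => x; rewrite /mcmap.
apply: (lmap_star_zero (P := fun u => u = iA u)); first exact: iB_klin.
- exact: esym (klin0 iA_klin).
- move=> i; have [lt|ge] := ltnP i (size x).
    by rewrite (nth_map 0) //.
  by rewrite nth_default ?size_map // (klin0 iA_klin).
move=> s1 s2 xs1 xs2 P1 P2.
have e := projF_eq0 PG P1.
have -> : G xs1 = lmap iA (G xs1) by move: (lmap_split (G xs1)); rewrite e addr0 => ->.
have hD u v : lsubst s1 (F ((u + v) :: xs2)) =
    lsubst s1 (F (u :: xs2)) + lsubst s1 (F (v :: xs2)).
  rewrite -[in LHS](scale1r u) -polyC1 lF scale1r.
  by rewrite -[F (u :: xs2)]scale1r lsubst_lin !scale1r.
rewrite -lmap_lsubst; last exact: iA_klin.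
rewrite lext_lmap //; last exact: iA_klin.
rewrite lmap_lext; last exact: iB_klin.
rewrite (_ : (fun x => _) = (fun=> 0)); first exact: lext_h0.
apply/funext => u /=; rewrite lmap_lsubst; last exact: iB_klin.
rewrite (projF_eq0 PF) ?lsubst0 // => -[|i] //=.
Qed.

Lemma projF0 : projF A B 0 = 0.
Proof.
by rewrite projFE; apply/funext => x; rewrite /mcmap lmap0 //; apply: iB_klin.
Qed.

Lemma projF_NR m n F G : is_cochain m.+1 F -> is_cochain n.+1 G ->
  projF A B F = 0 -> projF A B G = 0 -> projF A B (NR F G) = 0.
Proof.
move=> cF cG PF PG; rewrite (NR_cochain cF cG) addrC -scaleNr projF_lin.
rewrite (projF_star _ _ (cochain_lin1 cF)) // (projF_star _ _ (cochain_lin1 cG)) //.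
by rewrite scaler0 addr0.
Qed.

Lemma NR_hat m n (f g : mcochain A B) : is_cochain m.+1 f -> is_cochain n.+1 g ->
  NR (hat f) (hat g) = 0.
Proof.
move=> cf cg; have cf' := hat_cochain cf; have cg' := hat_cochain cg.
rewrite (NR_cochain cf' cg') (star_hat _ _ _ (cochain_lin1 cf')).
by rewrite (star_hat _ _ _ (cochain_lin1 cg')) scaler0 subr0.
Qed.

Lemma curved_V_data_of Delta : is_cochain 2 Delta -> NR Delta Delta = 0 ->
  curved_V_data (Lgr A B) (@NR K E) (Fgr A B) (projF A B) Delta.
Proof.
move=> cD D2; split=> //.
- exact: NR_graded_lie.
- exact: Fgr_graded.
- exact: Fgr_Lgr.
- by move=> m n x y [f [cf ->]] [g [cg ->]]; apply: NR_hat cf cg.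
- by move=> c x y _ _; apply: projF_lin.
- by move=> x _; apply: projF_hat.
- move=> n y; split=> [Fy|[x [Lx <-]]]; last exact: projF_Fgr.
  by exists y; split; [apply: Fgr_Lgr|case: Fy => f [_ ->]; apply: projF_hat].
- by move=> m n x y Lx Ly; apply: projF_NR Lx Ly.
Qed.

End Projection.

(** * The structure cochain *)

Lemma oppB2 (V : zmodType) (a b : V) : b + a = - (- a - b).
Proof. by rewrite opprD !opprK addrC. Qed.

Lemma shuf3_arith (V : zmodType) (a b c : V) :
  a - (b - 0) + (c - 0 + (0 + 0)) = a - b + c.
Proof. by rewrite !subr0 !addr0. Qed.

Lemma addrNK_sub (V : zmodType) (a b c : V) : a + b + (- (a + b) - c) = - c.
Proof. by rewrite addrA subrr add0r. Qed.

Lemma jacobi_arith (V : zmodType) (a b c j1 j2 j3 : V) :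
  a = j1 -> b = - j2 -> c = - j3 -> j3 = j1 + j2 -> a - b + c = 0.
Proof. by move=> -> -> -> ->; rewrite opprK subrr. Qed.

Section LambdaBracket.
Variables (K : fieldType) (E : lmodType {poly K}) (br : E -> E -> lpoly E).
Hypothesis lc : lie_conformal br.

Lemma brDl x x' y : br (x + x') y = br x y + br x' y.
Proof. by rewrite -[in LHS](scale1r x) -polyC1 (lc_linl lc) scale1r. Qed.

Lemma brDr x y y' : br x (y + y') = br x y + br x y'.
Proof. by rewrite -[in LHS](scale1r y) -polyC1 (lc_linr lc) scale1r. Qed.

Lemma br0l y : br 0 y = 0.
Proof. by apply: (addrI (br 0 y)); rewrite -brDl !addr0. Qed.

Lemma br0r x : br x 0 = 0.
Proof. by apply: (addrI (br x 0)); rewrite -brDr !addr0. Qed.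

Lemma brZl (c : K) x y : br (c%:P *: x) y = c *: br x y.
Proof. by rewrite -[_ *: x]addr0 (lc_linl lc) br0l addr0. Qed.

Lemma brZr (c : K) x y : br x (c%:P *: y) = c *: br x y.
Proof. by rewrite -[_ *: y]addr0 (lc_linr lc) br0r addr0. Qed.

Lemma lsubst_vars1 (s : nat -> lring K) x y :
  s 0%N = lam 0 -> lsubst s (br x y) = br x y.
Proof.
move=> s0; apply: (@lsubst_in_vars K E 1 s (br x y)) => [|i]; first exact: lc_vars.
by rewrite ltnS leqn0 => /eqP ->.
Qed.

Lemma permS2 (s : 'S_2) : s = 1%g \/ s = tperm ord0 ord_max.
Proof.
have two (i : 'I_2) : (i == ord0) || (i == ord_max) by case: i => -[|[]].
have ne : ord0 != ord_max :> 'I_2 by [].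
have inj i j : s i = s j -> i = j := @perm_inj _ s i j.
have cs : s ord0 != s ord_max by apply: contraNneq ne => /inj ->.
case/orP: (two (s ord0)) (two (s ord_max)) cs => /eqP e0 /orP [] /eqP e1;
  rewrite e0 e1 ?eqxx // => _; [left|right]; apply/permP => i;
  case/orP: (two i) => /eqP ->.
- by rewrite perm1.
- by rewrite perm1.
- by rewrite tpermL.
- by rewrite tpermR.
Qed.

Lemma enum2 : enum 'I_2 = [:: ord0; ord_max].
Proof.
apply: (inj_map val_inj); rewrite val_enum_ord.
by [].
Qed.

Lemma ldag2 : ldag K 2 = - lam 0 - del.
Proof. by rewrite /ldag big_ord_recr big_ord0 /= add0r. Qed.

Lemma br_cochain : is_cochain 2 (cochain2 br).
Proof.
split.
- by move=> [|x [|y []]].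
- move=> [|x [|y [|z a]]] /=; try exact: in_vars0.
  exact: lc_vars.
- move=> [|x1 [|x2 a1]] [|y1 [|y2 a2]] c x y //= _.
    exact: lc_linl.
  exact: lc_linr.
- move=> [|x1 [|x2 a1]] [|y1 [|y2 a2]] x //= _.
    by rewrite (lc_sesql lc).
  rewrite (lc_sesqr lc) /sub_dag /=; congr (lact _ _).
  by rewrite ldag2; apply: (oppB2 (V := lring K)).
move=> s a.
have [x [y ea]] : exists x y, a = [tuple x; y].
  case/tupleP: a => x a; case/tupleP: a => y a; exists x, y.
  by rewrite (tuple0 a); apply: val_inj.
rewrite ea /permute enum2 /= sg_scale oddb.
case: (permS2 s) => ->.
  rewrite odd_perm1 /= !perm1 /= !(tnth_nth x) /= /eval_at.
  have e : take 1 [seq lam ((1 : 'S_2)%g i) | i : 'I_2] = [:: lam 0] :> seq (lring K).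
    by rewrite /image_mem enum2 /= perm1.
  have e1 := lsubst_vars1 (s := nth 0 [:: lam 0]) x y erefl.
  have e2 := lsubst_vars1 (s := sub_dag K 2) x y erefl.
  by rewrite e e1 e2.
rewrite odd_tperm /= tpermL tpermR !(tnth_nth x) /= /eval_at.
have e : take 1 [seq lam (tperm ord0 ord_max i) | i : 'I_2] = [:: lam 1] :> seq (lring K).
  by rewrite /image_mem enum2 /= tpermL.
rewrite e {1}(lc_skew lc); congr (- _).
rewrite /br_at lsubstE [RHS]lsubstE (leval_lsubst _ _ _ (@lconst_dlinear K E)).
apply: (@leval_in_vars K (lring K) E (smod E) 1) => [|i]; first exact: lc_vars.
rewrite ltnS leqn0 => /eqP -> /=; rewrite lsub_lam /sub_dag /=.
by rewrite ldag2.
Qed.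

Local Notation rho := (@rho K (lring K) (@lcst K) E (smod E)).
Local Notation sesq := (@sesq K (lring K) (@lcst K) E (smod E)).
Local Notation sesqV := (@sesqV K (lring K) (@lcst K) E (smod E)).

(** The three unshuffles give the three terms of the Jacobi identity at the
    weights λ_0, λ_1 and λ_3^‡. *)
Lemma star_br : star 2 2 (cochain2 br) (cochain2 br) = 0.
Proof.
have cO := br_cochain; have cS := star_cochain cO cO.
apply/funext => a.
have [sa|/eqP na] := eqVneq (size a) 3; last exact: (co_arity cS).
case: a sa => [|x [|y [|z []]]] // sa.
rewrite -(rho_dag sa (@co_vars _ _ _ _ _ cS _)) rho_star //.
have mO := @rho_multimap K (lring K) (@lcst K) E (smod E) 1 _ cO.
(* The weights are abstracted: comparing closed elements of [lring K] up to
   conversion is not feasible. *)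
have [w0 ew0] : exists w, w = lam 0 :> lring K := ex_intro _ (lam 0) erefl.
have [w1 ew1] : exists w, w = lam 1 :> lring K := ex_intro _ (lam 1) erefl.
have [w2 ew2] : exists w, w = ldag K 3 := ex_intro _ (ldag K 3) erefl.
pose T zs := rho (cochain2 br) zs; pose te : lring K * E -> smod E := @test0 K E.
pose z1 := (w0, x); pose z2 := (w1, y); pose z3 := (w2, z).
apply: (etrans (y := pstar 2 T T [:: z1; z2; z3] te)).
  rewrite /z1 /z2 /z3 ew0 ew1 ew2; reflexivity.
have ew : w0 + w1 + w2 = - del.
  rewrite ew2 /ldag !big_ord_recr big_ord0 /= add0r -ew0 -ew1.
  exact: addrNK_sub.
have ste : sesq te by exact: test0_sesq.
have val2 (t v : lring K) u z' : t + v = - del ->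
    T [:: (t, u); (v, z')] te = lsubst (fun=> t) (br u z').
  move=> tv; have := @rho_test0 K E (cochain2 br) [:: t; v] [:: u; z'] erefl.
  rewrite !big_cons big_nil addr0 => /(_ tv) /= e; apply: etrans e _.
  rewrite !lsubstE.
  apply: (@leval_in_vars K (lring K) E (smod E) 1); first exact: lc_vars.
  by move=> i; rewrite ltnS leqn0 => /eqP ->.
have val1 (t v : lring K) u z' (phi : lring K * E -> smod E) : sesq phi ->
    T [:: (t, u); (v, z')] phi = leval (fun=> t) (fun x => phi (t + v, x)) (br u z').
  move=> sp; rewrite /T rhoE // /weight /= !big_cons big_nil addr0.
  apply: (@leval_in_vars K (lring K) E (smod E) 1); first exact: lc_vars.
  by move=> i; rewrite ltnS leqn0 => /eqP ->.
have sT (u : lring K * E) : sesqV (fun v => T [:: v; u]).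
  exact: mm_sesq mO [:: u].
have sT' (u : lring K * E) : sesqV (fun v => T [:: u; v]).
  exact: mm_sesq (contr_multimap u mO) [::].
have alt u v : bind (fun w => T [:: w; u]) (T v) = - bind (fun w => T [:: u; w]) (T v).
  rewrite -(bindNt (sT' u) (mm_fin mO v)); congr (bind _ (T v)).
  by apply/funext => w; apply: (mm_alt mO [::] _ _ [::]).
have eS : pstar 2 T T [:: z1; z2; z3] =
    bind (fun w => T [:: w; z3]) (T [:: z1; z2])
    - bind (fun w => T [:: w; z2]) (T [:: z1; z3])
    + bind (fun w => T [:: w; z1]) (T [:: z2; z3]).
  rewrite /pstar /=.
  move: (bind _ (T [:: z1; z2])) (bind _ (T [:: z1; z3])) (bind _ (T [:: z2; z3])).
  exact: shuf3_arith.
have hv (g g' : E -> smod E) u v : g =1 g' ->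
    leval (fun=> w0) g (br u v) = leval (@lam K) g' (br u v).
  move=> gg; apply: (etrans (y := leval (fun=> w0) g' (br u v))).
    exact: (@eq_leval K (lring K) E (smod E)).
  apply: (@leval_in_vars K (lring K) E (smod E) 1); first exact: lc_vars.
  by move=> i; rewrite ltnS leqn0 => /eqP ->; exact: ew0.
have br0E u v : br_at br w0 u v = br u v := lsubst_vars1 (s := fun=> w0) u v ew0.
have eA : leval (fun=> w0) (fun u => T [:: (w0 + w1, u); z3] te) (br x y) =
    lext (fun w => br_at br (w0 + w1) w z) (br_at br w0 x y).
  rewrite lextE br0E.
  by apply: hv => u; apply: val2.
have eB : leval (fun=> w0) (fun u => T [:: z2; (w0 + w2, u)] te) (br x z) =
    lext (br_at br w1 y) (br_at br w0 x z).
  rewrite lextE br0E.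
  by apply: hv => u; apply: val2; rewrite addrCA addrA.
have vC u : T [:: z1; (w1 + w2, u)] te = br_at br w0 x u.
  by apply: val2; rewrite addrA.
have eC : leval (fun=> w1) (fun u => T [:: z1; (w1 + w2, u)] te) (br y z) =
    lext (br_at br w0 x) (br_at br w1 y z).
  have hA : @dlinear K (lring K) (@lcst K) E (smod E) (- (w1 + w2)) (br_at br w0 x).
    by move=> a u v; rewrite -!vC; apply: (sT' z1 te (w1 + w2) a u v).
  apply: etrans (esym (etrans (lextE _ _) (leval_lsubst (@lam K) (fun=> w1) (br y z) hA))).
  apply: (@eq_leval K (lring K) E (smod E)) => [i|u]; last exact: vC.
  rewrite /=; apply/esym; rewrite [X in lsub _ _ _ X]ew1 lsub_lam.
  exact: esym ew1.
have q1 : bind (fun w => T [:: w; z3]) (T [:: z1; z2]) te =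
    lext (fun w => br_at br (w0 + w1) w z) (br_at br w0 x y).
  exact: etrans (val1 _ _ _ _ _ (sT z3 te)) eA.
have q2 : bind (fun w => T [:: w; z2]) (T [:: z1; z3]) te =
    - lext (br_at br w1 y) (br_at br w0 x z).
  apply: (etrans (congr1 (fun v => v te) (alt z2 [:: z1; z3]))).
  exact: (congr1 (@GRing.opp (smod E)) (etrans (val1 _ _ _ _ _ (sT' z2 te)) eB)).
have q3 : bind (fun w => T [:: w; z1]) (T [:: z2; z3]) te =
    - lext (br_at br w0 x) (br_at br w1 y z).
  apply: (etrans (congr1 (fun v => v te) (alt z1 [:: z2; z3]))).
  exact: (congr1 (@GRing.opp (smod E)) (etrans (val1 _ _ _ _ _ (sT' z1 te)) eC)).
apply: (etrans (congr1 (fun v => v te) eS)).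
have J := lc_jacobi lc x y z; rewrite -ew0 -ew1 in J.
exact: (jacobi_arith q1 q2 q3 J).
Qed.

End LambdaBracket.

(** * The three components of the bracket *)

Section Components.
Variables (K : fieldType) (A B : lmodType {poly K}).
Local Notation E := (A * B)%type.
Variable br : E -> E -> lpoly E.
Hypothesis qt : quasi_twilled br.

Let lc : lie_conformal br := qt_lie qt.
Local Notation iA := (@iA K A B).
Local Notation iB := (@iB K A B).
Let iAl : klin iA := @iA_klin K A B.
Let iBl : klin iB := @iB_klin K A B.

Lemma lmap_prA_brB x y : lmap iA (br (iB x) (iB y)) = 0.
Proof.
apply: lpolyP => m; rewrite lcoef_map; last exact: klin0 iAl.
have [] := cs_br (qt_B qt) (x := iB x) (y := iB y) m.
- by exists (prB x).
- by exists (prB y).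
by move=> u ->; rewrite /lcoef mcoeff0.
Qed.

(** The part of the bracket with one argument in each summand; both actions
    together with their flips are its two components. *)
Definition cross x y := br (iA x) (iB y) + br (iB x) (iA y).

Lemma br_split x y : br x y = br (iA x) (iA y) + cross x y + br (iB x) (iB y).
Proof.
rewrite -{1}(iAB x) -{1}(iAB y) (brDl lc) !(brDr lc) /cross.
by rewrite !addrA.
Qed.

Lemma flip_skew (N : lmodType {poly K}) (h : E -> N) x y : klin h ->
  - flip (lmap h (br y x)) = lmap h (br x y).
Proof.
by move=> hl; rewrite /flip -lmap_lsubst // -lmapN // [in RHS](lc_skew lc).
Qed.

Lemma lmap_inA_prA p : lmap (@inA K A B) (lmap (@prA K A B) p) = lmap iA p.
Proof. by rewrite lmap_comp //; apply: inA_klin. Qed.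

Lemma lmap_inB_prB p : lmap (@inB K A B) (lmap (@prB K A B) p) = lmap iB p.
Proof. by rewrite lmap_comp //; apply: inB_klin. Qed.

Lemma psi_hatE : psi_hat br = cochain2 (fun x y => lmap iB (br (iA x) (iA y))).
Proof.
apply/funext => -[|x [|y [|z a]]] //=; rewrite /lpair lmap0 ?add0r.
  exact: lmap_inB_prB.
exact: inA_klin.
Qed.

Lemma nu1_hatE : nu1_hat br = cochain2 (fun x y =>
  lmap iA (br (iA x) (iA y)) + lmap iB (cross x y)).
Proof.
apply/funext => -[|x [|y [|z a]]] //=; rewrite /lpair /brA lmap_inA_prA.
congr (_ + _); rewrite /rhoA flip_skew // -lmapD // -/(cross x y).
exact: lmap_inB_prB.
Qed.

Lemma nu2_hatE : nu2_hat br = cochain2 (fun x y =>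
  lmap iA (cross x y) + lmap iB (br (iB x) (iB y))).
Proof.
apply/funext => -[|x [|y [|z a]]] //=; rewrite /lpair /brB lmap_inB_prB.
congr (_ + _); rewrite /rhoB flip_skew // -lmapD // addrC -/(cross x y).
exact: lmap_inA_prA.
Qed.

Lemma Omega_cochain : is_cochain 2 (Omega br).
Proof. exact: br_cochain lc. Qed.

Lemma Omega_square : NR (Omega br) (Omega br) = 0.
Proof.
by rewrite (NR_cochain Omega_cochain Omega_cochain) (star_br lc) scaler0 subr0.
Qed.

Lemma Omega_sum : Omega br = psi_hat br + nu1_hat br + nu2_hat br.
Proof.
apply/funext => a.
have -> : (psi_hat br + nu1_hat br + nu2_hat br) a =
    psi_hat br a + nu1_hat br a + nu2_hat br a by [].
rewrite psi_hatE nu1_hatE nu2_hatE.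
case: a => [|x [|y [|z a]]]; rewrite /Omega /= ?addr0 //.
rewrite [br x y]br_split.
have eA := lmap_split (br (iA x) (iA y)).
have eC := lmap_split (cross x y).
have eB := lmap_split (br (iB x) (iB y)).
rewrite lmap_prA_brB add0r in eB.
rewrite -[in LHS]eA -[in LHS]eC eB.
move: (lmap iA (br _ _)) (lmap iB (br (iA x) _)) (lmap iA (cross x y))
  (lmap iB (cross x y)) (br (iB x) (iB y)) => a b c d e.
zmodule (lpoly E : zmodType).
Qed.

(** [cross] is the bracket minus its restrictions to the two summands, which
    makes it a cochain without further computation. *)
Definition crossc : mcochain E E :=
  (-1 : K) *: mcmap iA id (Omega br) + ((-1 : K) *: mcmap iB id (Omega br) + Omega br).

Lemma crossc_cochain : is_cochain 2 crossc.
Proof.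
have il : klin (@id E) by [].
have O := Omega_cochain.
apply: cochain_lin (mcmap_cochain iAl il O) _.
exact: cochain_lin (mcmap_cochain iBl il O) O.
Qed.

Lemma crosscE : crossc = cochain2 cross.
Proof.
have e a : crossc a =
    - Omega br (map iA a) + (- Omega br (map iB a) + Omega br a).
  have -> : crossc a = (-1 : K) *: lmap id (Omega br (map iA a))
    + ((-1 : K) *: lmap id (Omega br (map iB a)) + Omega br a) by [].
  by rewrite !lmap_id !scaleN1r.
apply/funext => a; rewrite e.
case: a => [|x [|y [|z a]]]; rewrite /Omega /= ?oppr0 ?addr0 //.
rewrite [br x y]br_split.
move: (br (iA x) _) (br (iB x) _) (cross x y) => a b c.
zmodule (lpoly E : zmodType).
Qed.

Lemma psi_cochain : is_cochain 2 (psi_hat br).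
Proof.
have := mcmap_cochain iAl iBl Omega_cochain; congr is_cochain.
by rewrite psi_hatE; apply/funext => -[|x [|y [|z a]]]; rewrite /mcmap //= lmap0.
Qed.

Lemma nu1_cochain : is_cochain 2 (nu1_hat br).
Proof.
have il : klin (@id E) by [].
have := cochain_lin 1 (mcmap_cochain iAl iAl Omega_cochain)
  (mcmap_cochain il iBl crossc_cochain); congr is_cochain.
rewrite nu1_hatE crosscE scale1r; apply/funext => a.
have -> : (mcmap iA iA (Omega br) + mcmap id iB (cochain2 cross)) a =
  lmap iA (Omega br (map iA a)) + lmap iB (cochain2 cross (map id a)) by [].
by case: a => [|x [|y [|z a]]]; rewrite /Omega /= ?lmap0 ?addr0.
Qed.

Lemma nu2_cochain : is_cochain 2 (nu2_hat br).
Proof.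
have il : klin (@id E) by [].
have := cochain_lin 1 (mcmap_cochain il iAl crossc_cochain)
  (mcmap_cochain iBl iBl Omega_cochain); congr is_cochain.
rewrite nu2_hatE crosscE scale1r; apply/funext => a.
have -> : (mcmap id iA (cochain2 cross) + mcmap iB iB (Omega br)) a =
  lmap iA (cochain2 cross (map id a)) + lmap iB (Omega br (map iB a)) by [].
by case: a => [|x [|y [|z a]]]; rewrite /Omega /= ?lmap0 ?addr0.
Qed.

End Components.

(** * Weights *)

Section Weights.
Variables (K : fieldType) (A B : lmodType {poly K}).
Local Notation E := (A * B)%type.
Local Notation iA := (@iA K A B).
Local Notation iB := (@iB K A B).
Let iAl : klin iA := @iA_klin K A B.
Let iBl : klin iB := @iB_klin K A B.
Implicit Types (F G h : mcochain E E).

(** The automorphism (a, u) |-> (a, 2 u) of the module; the bidegree of a cochain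
    with respect to the two summands is read off from its action. *)
Definition theta (x : E) : E := iA x + (2%:R : K)%:P *: iB x.

Lemma theta_klin : klin theta.
Proof.
move=> a x y; rewrite /theta iAl iBl !scalerDr !scalerA mulrC.
by rewrite addrACA.
Qed.

Lemma iA_theta x : iA (theta x) = iA x.
Proof.
case: x => a b; have -> : iA (theta (a, b)) = (a + 2%:R%:P *: 0, 0) by [].
by rewrite scaler0 addr0.
Qed.

Lemma iB_theta x : iB (theta x) = 2%:R%:P *: iB x.
Proof.
case: x => a b; have -> : iB (theta (a, b)) = (0, 0 + 2%:R%:P *: b) by [].
have -> : 2%:R%:P *: iB (a, b) = (2%:R%:P *: 0, 2%:R%:P *: b) by [].
by rewrite scaler0 add0r.
Qed.

Lemma theta_iA x : theta (iA x) = iA x.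
Proof.
rewrite /theta; have -> : iA (iA x) = iA x by [].
by have -> : iB (iA x) = 0 by []; rewrite scaler0 addr0.
Qed.

Lemma theta_iB x : theta (iB x) = 2%:R%:P *: iB x.
Proof.
rewrite /theta; have -> : iA (iB x) = 0 by [].
by have -> : iB (iB x) = iB x by []; rewrite add0r.
Qed.

Lemma lmap_theta_iA p : lmap theta (lmap iA p) = lmap iA p.
Proof.
rewrite lmap_comp //; last exact: theta_klin.
by apply: eq_lmap => x; apply: theta_iA.
Qed.

Lemma lmap_theta_iB p : lmap theta (lmap iB p) = 2%:R *: lmap iB p.
Proof.
apply: lpolyP => m; rewrite lcoef_scale (lcoef_map (klin0 theta_klin)).
by rewrite !(lcoef_map (klin0 iBl)) theta_iB.
Qed.

(** A component with [j] arguments in the second summand has weight [2 ^ - j] if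
    its values are in the first summand, and [2 ^ (1 - j)] if they are in the
    second. *)
Definition wt (d : K) h := forall x, lmap theta (h x) = d *: h (map theta x).

Lemma wt_hat f : wt 2%:R (hat f : mcochain E E).
Proof.
move=> x; have -> : hat f (map theta x) = hat f x.
  rewrite /hat -map_comp; congr (lpair _ (f _)); apply: eq_map => y /=.
  by have := congr1 (@prA K A B) (iA_theta y).
rewrite hatE /mcmap; have e p : lmap (@inB K A B) p = lmap iB (lmap (@inB K A B) p).
  by rewrite lmap_comp //; apply: inB_klin.
by rewrite e lmap_theta_iB.
Qed.

(** The automorphism is carried through the inserted value. *)
Lemma star_wt d e m n F G : lin1 F -> wt d F -> wt e G -> wt (d * e) (star m n F G).
Proof.
move=> lF wF wG x; rewrite /star size_map; case: ifP => _.
  by rewrite lmap0 ?scaler0 //; apply: theta_klin.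
have tl := theta_klin.
have sZ (c : K) (p : lpoly E) r : lsubst r (c *: p) = c *: lsubst r p.
  by rewrite -[c *: p]addr0 lsubst_lin lsubst0 addr0.
have sD (p q : lpoly E) r : lsubst r (p + q) = lsubst r p + lsubst r q.
  by rewrite -[p]scale1r lsubst_lin !scale1r.
rewrite lmap_lsubst // lmap_sum // -sZ.
congr (lsubst _ _); rewrite scaler_sumr; apply: eq_bigr => s _.
rewrite lmapZ // scalerA [(d * e) * _]mulrC -scalerA; congr (_ *: _).
have -> : [seq nth 0 (map theta x) (s i) | i : 'I_(m + n).-1] =
    map theta [seq nth 0 x (s i) | i : 'I_(m + n).-1].
  rewrite -map_comp; apply: eq_map => i /=.
  have [lt|ge] := ltnP (s i) (size x); first by rewrite (nth_map 0).
  by rewrite !nth_default ?size_map // (klin0 tl).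
set xs := [seq nth 0 x (s i) | i : 'I_(m + n).-1].
rewrite -map_take -map_drop; set xs1 := take n xs; set xs2 := drop n xs.
rewrite /eval_at lmap_lext //.
set s1 := nth 0 (take m.-1 _); set s2 := nth 0 (take n.-1 _).
have F0 a : F (0 :: a) = 0.
  have := lF 1 0 0 a; rewrite scaler0 addr0 scale1r => /eqP.
  by rewrite -subr_eq0 opprD addrA subrr sub0r oppr_eq0 => /eqP.
have FD u v a : F ((u + v) :: a) = F (u :: a) + F (v :: a).
  by rewrite -[in LHS](scale1r u) -polyC1 lF scale1r.
have -> : (fun y => lmap theta (lsubst s1 (F (y :: xs2)))) =
    (fun y => d *: lsubst s1 (F (theta y :: map theta xs2))).
  by apply/funext => y; rewrite lmap_lsubst // wF sZ.
rewrite -[X in lext X](_ : (fun y => d *: (fun z => lsubst s1 (F (theta z :: map theta xs2))) y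
   + (fun=> 0) y) = _); last by apply/funext => y /=; rewrite addr0.
rewrite lext_linl lext_h0 addr0 -scalerA; congr (_ *: _).
have -> : (fun z => lsubst s1 (F (theta z :: map theta xs2))) =
    (fun z => lsubst s1 (F (z :: map theta xs2))) \o theta by [].
rewrite -lext_lmap //; last by move=> u v; rewrite FD sD.
rewrite lmap_lsubst // wG sZ -[e *: lsubst _ _]addr0 lext_linr; last by move=> c u v; rewrite lF lsubst_lin.
by rewrite lext0 addr0 -map_take -map_drop.
Qed.

Lemma wt_lin d c F G : wt d F -> wt d G -> wt d (c *: F + G).
Proof.
move=> wF wG x; have eE y : (c *: F + G) y = c *: F y + G y by [].
rewrite !eE lmapD ?lmapZ ?wF ?wG ?scalerDr ?scalerA 1?mulrC //; exact: theta_klin.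
Qed.

Lemma NR_wt d e F G : lin1 F -> lin1 G -> wt d F -> wt e G -> wt (d * e) (NR F G).
Proof.
move=> lF lG wF wG x; rewrite /NR size_map.
rewrite lmap_sum ?scaler_sumr; last exact: theta_klin.
apply: eq_bigr => p _; rewrite /NR_hom addrC -scaleNr.
apply: wt_lin; last exact: star_wt.
by rewrite mulrC; apply: star_wt.
Qed.

Lemma projF_wt d h : d != 2%:R -> wt d h -> projF A B h = 0.
Proof.
move=> d2 wh; rewrite projFE; apply/funext => x; rewrite /mcmap.
have tl := theta_klin; set y := map iA x.
have ey : map theta y = y.
  by rewrite /y -map_comp; apply: eq_map => z; apply: theta_iA.
have := congr1 (lmap iB) (wh y); rewrite ey lmapZ // lmap_comp //.
have -> : lmap (iB \o theta) (h y) = 2%:R *: lmap iB (h y).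
  apply: lpolyP => m; rewrite lcoef_scale lcoef_map; last first.
    by rewrite /= (klin0 tl) (klin0 iBl).
  by rewrite /= iB_theta (lcoef_map (klin0 iBl)).
move/eqP; rewrite -subr_eq0 -scalerBl scaler_eq0 subr_eq0 eq_sym (negPf d2) /=.
by move/eqP.
Qed.

Hypothesis K0 : forall n : nat, n.+1%:R != 0 :> K.

Lemma pow2_neq1 n : (2%:R : K) ^+ n.+1 != 1.
Proof.
rewrite -natrX -subr_eq0 -[1]/(1%:R) -natrB ?expn_gt0 //.
have : (1 < 2 ^ n.+1)%N by rewrite -{1}(expn0 2) ltn_exp2l.
by rewrite -subn_gt0; case: (2 ^ n.+1 - 1)%N => // k _; apply: K0.
Qed.

Definition multilin h := forall a1 a2 (c : K) x y,
  h (a1 ++ (c%:P *: x + y) :: a2) = c *: h (a1 ++ x :: a2) + h (a1 ++ y :: a2).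

Lemma cochain_multilin n h : is_cochain n.+1 h -> multilin h.
Proof.
move=> ch a1 a2 c x y.
have [sz|/eqP ne] := eqVneq (size a1 + size a2).+1 n.+1; first by apply: (co_lin ch).
by rewrite !(co_arity ch) ?scaler0 ?addr0 // size_cat /= addnS.
Qed.

Lemma dsum_multilin h : dsum (Lgr A B) h -> multilin h.
Proof.
apply: dsum_ind => [a1 a2 c x y|F G hF hG a1 a2 c x y|n F]; last exact: cochain_multilin.
  by rewrite scaler0 addr0.
have e a : (F + G) a = F a + G a by [].
by rewrite !e hF hG scalerDr addrACA.
Qed.

Section Fixed.
Variable h : mcochain E E.
Hypotheses (hl : multilin h) (wh : wt 2%:R h).

Lemma cochain_slot0 a1 a2 : h (a1 ++ 0 :: a2) = 0.
Proof.
have := hl a1 a2 1 0 0; rewrite scaler0 addr0 scale1r => /eqP.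
by rewrite -subr_eq0 opprD addrA subrr sub0r oppr_eq0 => /eqP.
Qed.

Lemma cochain_slotZ a1 a2 (c : K) x :
  h (a1 ++ c%:P *: x :: a2) = c *: h (a1 ++ x :: a2).
Proof. by rewrite -[_ *: x]addr0 hl cochain_slot0 addr0. Qed.

Lemma cochain_slotD a1 a2 x y :
  h (a1 ++ (x + y) :: a2) = h (a1 ++ x :: a2) + h (a1 ++ y :: a2).
Proof. by rewrite -[in LHS](scale1r x) -polyC1 hl scale1r. Qed.

Definition pure (bx : bool * E) : E := if bx.1 then iB bx.2 else iA bx.2.

Lemma h_theta_pure a1 bs : h (a1 ++ map theta (map pure bs)) =
  2%:R ^+ count (fun bx => bx.1) bs *: h (a1 ++ map pure bs).
Proof.
elim: bs a1 => [|[b x] bs IH] a1 /=; first by rewrite scale1r.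
have e : theta (pure (b, x)) = (2%:R ^+ b)%:P *: pure (b, x).
  by case: b; rewrite /pure /= ?theta_iB ?theta_iA ?expr1 ?expr0 ?scale1r.
rewrite e cochain_slotZ -cat_rcons IH scalerA -exprD.
by rewrite cat_rcons.
Qed.

(** With [j > 0] arguments in the second summand the automorphism multiplies the
    value by [2 ^ j.+1], whereas it multiplies its two components by 1 and 2. *)
Lemma pure_zero bs : has (fun bx => bx.1) bs -> h (map pure bs) = 0.
Proof.
rewrite has_count; set j := count _ _ => j0.
have := wh (map pure bs); rewrite (h_theta_pure [::]) /= -/j scalerA -exprS.
set q := h _ => e; have tl := theta_klin.
have eB : lmap iB q = 0.
  have := congr1 (lmap iB) e; rewrite lmapZ // lmap_comp //.
  have -> : lmap (iB \o theta) q = 2%:R *: lmap iB q.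
    apply: lpolyP => m; rewrite lcoef_scale lcoef_map; last first.
      by rewrite /= (klin0 tl) (klin0 iBl).
    by rewrite /= iB_theta (lcoef_map (klin0 iBl)).
  move/eqP; rewrite -subr_eq0 -scalerBl scaler_eq0 => /orP [|/eqP //].
  rewrite exprS -{1}[2%:R]mulr1 -mulrBr mulf_eq0 (negPf (K0 1)) /= subr_eq0 eq_sym.
  by case: (j) j0 => // k _; rewrite (negPf (pow2_neq1 k)).
have eA : lmap iA q = 0.
  have := congr1 (lmap iA) e; rewrite lmapZ // lmap_comp //.
  have -> : lmap (iA \o theta) q = lmap iA q by apply: eq_lmap => x; apply: iA_theta.
  move/eqP; rewrite -subr_eq0 -[X in X - _]scale1r -scalerBl scaler_eq0.
  by rewrite subr_eq0 eq_sym (negPf (pow2_neq1 j)) => /eqP.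
by rewrite -[LHS]lmap_split eA eB addr0.
Qed.

Lemma mixed_zero bs a : has (fun bx => bx.1) bs -> h (map pure bs ++ a) = 0.
Proof.
elim: a bs => [|x a IH] bs hb; first by rewrite cats0; apply: pure_zero.
rewrite -(iAB x) cochain_slotD -!cat_rcons.
have -> : iB x = pure (true, x) by [].
have e1 : rcons (map pure bs) (iA x) = map pure (rcons bs (false, x)).
  by rewrite map_rcons.
have e2 : rcons (map pure bs) (pure (true, x)) = map pure (rcons bs (true, x)).
  by rewrite map_rcons.
by rewrite e1 e2 !IH ?addr0 // has_rcons hb orbT.
Qed.

Lemma h_iA a : h a = h (map iA a).
Proof.
suff e pre post : h (map iA pre ++ post) = h (map iA (pre ++ post)) by apply: (e [::]).
elim: post pre => [|x post IH] pre; first by rewrite !cats0.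
rewrite -[in LHS](iAB x) cochain_slotD.
have -> : h (map iA pre ++ iB x :: post) = 0.
  have := @mixed_zero (rcons (map (pair false) pre) (true, x)) post.
  rewrite map_rcons -map_comp cat_rcons; apply.
  by rewrite has_rcons.
by rewrite addr0 -!cat_rcons -map_rcons IH.
Qed.

(** Weight 2 characterizes, in characteristic 0, the maps without arguments in the
    second summand whose values lie in it. *)
Lemma wt2_fixed : projF A B h = h.
Proof.
rewrite projFE; apply/funext => x; rewrite /mcmap [RHS]h_iA.
set y := map iA x; have tl := theta_klin.
have ey : map theta y = y.
  by rewrite /y -map_comp; apply: eq_map => z; apply: theta_iA.
have := congr1 (lmap iA) (wh y); rewrite ey lmapZ // lmap_comp //.
have -> : lmap (iA \o theta) (h y) = lmap iA (h y).
  by apply: eq_lmap => z; apply: iA_theta.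
move/eqP; rewrite -subr_eq0 -[X in X - _]scale1r -scalerBl scaler_eq0.
rewrite subr_eq0 eq_sym -[2%:R]expr1 (negPf (pow2_neq1 0)) => /eqP e.
by rewrite -[RHS]lmap_split e add0r.
Qed.

End Fixed.
End Weights.

(** * Relations in a graded Lie algebra with an abelian subalgebra *)

Section GradedLieRelations.
Variables (K : fieldType) (V : lmodType K).
Variables (L F : nat -> V -> Prop) (br : V -> V -> V).
Hypotheses (gl : graded_lie L br) (FL : forall n x, F n x -> L n x).
Hypothesis Fab : forall m n x y, F m x -> F n y -> br x y = 0.

Let gL : graded_space L := gl_space gl.

Lemma dsum_br x y : dsum L x -> dsum L y -> dsum L (br x y).
Proof.
move=> dx dy; have [k [u [Lu ex]]] := dx; have [l [v [Lv ey]]] := dy.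
have hom n w : L n w -> dsum L (br w y).
  move=> Lw; have dw := dsum_homog gL Lw; rewrite ey.
  have : dsum L (\sum_(i < l) v i) /\ dsum L (br w (\sum_(i < l) v i)).
    apply: (big_ind (fun z => dsum L z /\ dsum L (br w z))).
    - split; first exact: (dsum0 gL).
      have := gl_linr gl (-1) dw (dsum0 gL) (dsum0 gL).
      rewrite scaler0 addr0 scaleN1r addNr => ->; exact: (dsum0 gL).
    - move=> z z' [dz bz] [dz' bz']; split; first exact: (dsumD gL).
      have := gl_linr gl 1 dw dz dz'; rewrite !scale1r => ->.
      exact: (dsumD gL).
    - by move=> i _; split; apply: (dsum_homog gL); [|apply: gl_deg gl _ _ _ _ Lw (Lv _)].
  by case.
rewrite ex.
have : dsum L (\sum_(i < k) u i) /\ dsum L (br (\sum_(i < k) u i) y).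
  apply: (big_ind (fun z => dsum L z /\ dsum L (br z y))).
  - split; first exact: (dsum0 gL).
    have := gl_linl gl (-1) (dsum0 gL) (dsum0 gL) dy.
    rewrite scaler0 addr0 scaleN1r addNr => ->; exact: (dsum0 gL).
  - move=> z z' [dz bz] [dz' bz']; split; first exact: (dsumD gL).
    have := gl_linl gl 1 dz dz' dy; rewrite !scale1r => ->.
    exact: (dsumD gL).
  - by move=> i _; split; [apply: (dsum_homog gL)|apply: hom].
by case.
Qed.

Lemma glDl x x' y : dsum L x -> dsum L x' -> dsum L y ->
  br (x + x') y = br x y + br x' y.
Proof. by move=> dx dx' dy; have := gl_linl gl 1 dx dx' dy; rewrite !scale1r. Qed.

Lemma glDr x y y' : dsum L x -> dsum L y -> dsum L y' ->
  br x (y + y') = br x y + br x y'.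
Proof. by move=> dx dy dy'; have := gl_linr gl 1 dx dy dy'; rewrite !scale1r. Qed.

Lemma gl0l y : dsum L y -> br 0 y = 0.
Proof.
move=> dy; have := gl_linl gl (-1) (dsum0 gL) (dsum0 gL) dy.
by rewrite scaler0 addr0 scaleN1r addNr.
Qed.

Lemma gl0r x : dsum L x -> br x 0 = 0.
Proof.
move=> dx; have := gl_linr gl (-1) dx (dsum0 gL) (dsum0 gL).
by rewrite scaler0 addr0 scaleN1r addNr.
Qed.

Lemma glZl c x y : dsum L x -> dsum L y -> br (c *: x) y = c *: br x y.
Proof.
move=> dx dy; have := gl_linl gl c dx (dsum0 gL) dy.
by rewrite (gl0l dy) !addr0.
Qed.

Lemma dsumZ c x : dsum L x -> dsum L (c *: x).
Proof. by move=> dx; rewrite -[_ *: x]addr0; apply: (dsum_lin gL) => //; apply: (dsum0 gL). Qed.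

Lemma glBl x x' y : dsum L x -> dsum L x' -> dsum L y ->
  br (x - x') y = br x y - br x' y.
Proof.
move=> dx dx' dy; rewrite -scaleN1r glDl //; last exact: dsumZ.
by rewrite glZl // scaleN1r.
Qed.

Let LD m x : L m x -> dsum L x := @dsum_homog _ _ _ gL m x.
Let FD m x : F m x -> dsum L x := fun Fx => LD (FL Fx).
Let deg m n x y : L m x -> L n y -> L (m + n) (br x y) := @gl_deg _ _ _ _ gl m n x y.

(** The Jacobi identity with [f] and [g] commuting. *)
Lemma br_swap m a b x f g : L m x -> F a f -> F b g ->
  br (br x f) g = (-1) ^+ (a * b) *: br (br x g) f.
Proof.
move=> Lx Ff Fg; have := gl_jacobi gl Lx (FL Ff) (FL Fg).
rewrite (Fab Ff Fg) (gl0r (LD Lx)).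
rewrite [br f _](gl_skew gl (FL Ff) (deg Lx (FL Fg))) !scalerN !sg_scale.
rewrite !oddM !oddD; move: (br (br x f) g) (br (br x g) f) => u v /esym/eqP.
by rewrite subr_eq0 => /eqP ->; case: (odd a); case: (odd b); case: (odd m);
  rewrite /= ?opprK.
Qed.

(** [p], [n1] and [n2] play the parts of the three components of an element of
    square zero; the hypotheses of the four relations are the components of the
    square, bracketed with elements of [F]. *)
Section Master.
Variables p n1 n2 : V.
Hypotheses (Fp : F 1 p) (L1 : L 1 n1) (L2 : L 1 n2).
Hypothesis F1 : forall a f, F a f -> F a.+1 (br n1 f).
Hypothesis F2 : forall a b f g, F a f -> F b g -> F (a + b).+1 (br (br n2 f) g).
Hypothesis K2 : 2%:R != 0 :> K.

Let Lp : L 1 p := FL Fp.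

Lemma eq2_0 (u : V) : u + u = 0 -> u = 0.
Proof.
by rewrite -mulr2n -scaler_nat => /eqP; rewrite scaler_eq0 (negPf K2) => /eqP.
Qed.

Lemma odd_comm x y : L 1 x -> L 1 y -> br x y = br y x.
Proof. by move=> Lx Ly; rewrite (gl_skew gl Lx Ly) muln1 expr1 scaleN1r opprK. Qed.

Lemma jac1 x y z n : L 1 x -> L 1 y -> L n z ->
  br (br x y) z = br x (br y z) + br y (br x z).
Proof.
move=> Lx Ly Lz; rewrite (gl_jacobi gl Lx Ly Lz) muln1 expr1 scaleN1r.
by rewrite subrK.
Qed.

Lemma rel0 : br n1 p + br p n1 = 0 -> br n1 p = 0.
Proof. by rewrite (odd_comm Lp L1) => /eq2_0. Qed.

Ltac ds := by repeat first [assumption | apply: (dsumD gL) | apply: dsum_br | apply: dsumZ].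

Let d1 : dsum L n1 := LD L1.
Let d2 : dsum L n2 := LD L2.
Let dp : dsum L p := LD Lp.

Lemma rel1 a f : F a f -> br (br n1 n1 + (br p n2 + br n2 p)) f = 0 ->
  br (br n2 p) f + br n1 (br n1 f) = 0.
Proof.
move=> Ff; have df := FD Ff.
rewrite (odd_comm Lp L2) !glDl; try ds.
rewrite (jac1 L1 L1 (FL Ff)); move: (br n1 (br n1 f)) (br (br n2 p) f) => u v e.
by apply: eq2_0; rewrite -e; zmodule V.
Qed.

Lemma rel2 a b f g : F a f -> F b g ->
  br (br (br n1 n2 + br n2 n1) f) g = 0 ->
  br (br n2 (br n1 f)) g + (-1) ^+ (a * b) *: br (br n2 (br n1 g)) f
  + br n1 (br (br n2 f) g) = 0.
Proof.
move=> Ff Fg; have df := FD Ff; have dg := FD Fg.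
rewrite (odd_comm L2 L1) !glDl; try ds.
move=> /eq2_0.
have L2f := deg L2 (FL Ff); have L1f := FL (F1 Ff).
rewrite (jac1 L1 L2 (FL Ff)) glDl; try ds.
have := gl_jacobi gl L1 L2f (FL Fg); rewrite (br_swap L2 Ff (F1 Fg)).
rewrite !sg_scale mul1n !oddM oddD oddS /= => ->.
move: (br (br n1 _) g) (br (br n2 (br n1 g)) f) (br (br n2 (br n1 f)) g) => u v w.
move=> e; rewrite -e.
by case: (odd a); case: (odd b) => /=; zmodule V.
Qed.

Lemma rel3 a b c f g h : F a f -> F b g -> F c h ->
  br (br (br (br n2 n2) f) g) h = 0 ->
  br (br n2 (br (br n2 f) g)) h
  + (-1) ^+ (b * c) *: br (br n2 (br (br n2 f) h)) g
  + (-1) ^+ (a * (b + c)) *: br (br n2 (br (br n2 g) h)) f = 0.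
Proof.
move=> Ff Fg Fh; have df := FD Ff; have dg := FD Fg; have dh := FD Fh.
have L2f := deg L2 (FL Ff); have L2g := deg L2 (FL Fg).
rewrite (jac1 L2 L2 (FL Ff)) !glDl; try ds.
move=> /eq2_0.
have u1 := F2 Ff Fg; have u2 := F2 Fg Fh; have u3 := F2 Ff Fh.
have := gl_jacobi gl L2 L2f (FL Fg) => e.
have {e} -> : br (br n2 (br n2 f)) g = br n2 (br (br n2 f) g)
    - (-1) ^+ (1 * (1 + a)) *: br (br n2 f) (br n2 g) by rewrite e addrK.
rewrite glBl ?glZl; try ds.
have := gl_jacobi gl L2f L2g (FL Fh) => e.
have {e} -> : br (br (br n2 f) (br n2 g)) h = br (br n2 f) (br (br n2 g) h)
    - (-1) ^+ ((1 + a) * (1 + b)) *: br (br n2 g) (br (br n2 f) h) by rewrite e addrK.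
rewrite (br_swap L2 Ff u2) (br_swap L2 Fg u3) !sg_scale.
rewrite !(oddM, oddD, oddS) /=.
move: (br (br n2 _) f) (br (br n2 _) g) (br (br n2 _) h) => u v w.
move=> e; rewrite -e.
by case: (odd a) => /=; case: (odd b) => /=; case: (odd c) => /=; zmodule V.
Qed.

End Master.
End GradedLieRelations.

(** * Curved L-infinity algebras with at most binary operations *)

Section SmallPermutations.
Variables (K : fieldType).
Local Notation o1 := (lift ord0 ord0).
Local Notation o2 := (lift ord0 (lift ord0 ord0)).

Lemma enumI1 : enum 'I_1 = [:: ord0].
Proof. by apply: (inj_map val_inj); rewrite val_enum_ord. Qed.

Lemma enumI2 : enum 'I_2 = [:: ord0; o1].
Proof. by apply: (inj_map val_inj); rewrite val_enum_ord. Qed.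

Lemma enumI3 : enum 'I_3 = [:: ord0; o1; o2].
Proof. by apply: (inj_map val_inj); rewrite val_enum_ord. Qed.

Lemma sum_unshuffle_all (W : nmodType) k (F : 'S_k -> W) :
  \sum_(s : 'S_k | unshuffle k s) F s = F 1%g.
Proof.
elim: k F => [|k IH] F.
  by rewrite (big_pred1 1%g) // => s; apply: unshuffle0.
by rewrite sum_unshuffle_split ltnn addr0 (IH (fun t => F (lift_perm ord0 ord0 t))) lift_perm1.
Qed.

Lemma sum_unshuffle_none (W : nmodType) k (F : 'S_k -> W) :
  \sum_(s : 'S_k | unshuffle 0 s) F s = F 1%g.
Proof. by rewrite (big_pred1 1%g) // => s; apply: unshuffle0. Qed.

Definition swap12 : 'S_2 := lift_perm (inord 1) ord0 1.

Lemma swap12_0 : swap12 ord0 = o1.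
Proof.
have e : ord0 = lift (inord 1) ord0 :> 'I_2.
  by apply: val_inj; rewrite /= /bump inordK.
by rewrite [in LHS]e /swap12 lift_perm_lift perm1.
Qed.

Lemma swap12_1 : swap12 o1 = ord0.
Proof.
have -> : o1 = inord 1 :> 'I_2 by apply: val_inj; rewrite /= /bump inordK.
exact: lift_perm_id.
Qed.

Lemma sum_unshuffle_1_2 (W : nmodType) (F : 'S_2 -> W) :
  \sum_(s : 'S_2 | unshuffle 1 s) F s = F 1%g + F swap12.
Proof.
rewrite sum_unshuffle_split ltnSn.
rewrite (sum_unshuffle_none (fun t => F (lift_perm ord0 ord0 t))) lift_perm1.
by rewrite (sum_unshuffle_all (fun t => F (lift_perm (inord 1) ord0 t))).
Qed.

Definition swap23 : 'S_3 := lift_perm ord0 ord0 swap12.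
Definition cycle3 : 'S_3 := lift_perm (inord 2) ord0 1.

Lemma swap23E : [/\ swap23 ord0 = ord0, swap23 o1 = o2 & swap23 o2 = o1].
Proof.
rewrite /swap23 lift_perm_id !lift_perm_lift swap12_0.
by rewrite -[lift ord0 ord0]/(o1 : 'I_2) swap12_1.
Qed.

Lemma cycle3E : [/\ cycle3 ord0 = o1, cycle3 o1 = o2 & cycle3 o2 = ord0].
Proof.
have e0 : ord0 = lift (inord 2) ord0 :> 'I_3.
  by apply: val_inj; rewrite /= /bump inordK.
have e1 : o1 = lift (inord 2) (lift ord0 ord0) :> 'I_3.
  by apply: val_inj; rewrite /= /bump inordK.
have e2 : o2 = inord 2 :> 'I_3 by apply: val_inj; rewrite /= /bump inordK.
split.
- by rewrite (congr1 cycle3 e0) /cycle3 lift_perm_lift perm1.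
- by rewrite (congr1 cycle3 e1) /cycle3 lift_perm_lift perm1.
- by rewrite e2 /cycle3 lift_perm_id.
Qed.

Lemma sum_unshuffle_2_3 (W : nmodType) (F : 'S_3 -> W) :
  \sum_(s : 'S_3 | unshuffle 2 s) F s = F 1%g + F swap23 + F cycle3.
Proof.
rewrite sum_unshuffle_split ltnSn.
rewrite (sum_unshuffle_1_2 (fun t => F (lift_perm ord0 ord0 t))) lift_perm1.
by rewrite (sum_unshuffle_all (fun t => F (lift_perm (inord 2) ord0 t))).
Qed.

Lemma koszul1 k (d : 'I_k -> nat) : koszul K d 1 = 1.
Proof.
rewrite /koszul big1 // => i _; rewrite big_pred0 // => j.
by rewrite !perm1; apply/negP => /andP [/ltnW]; rewrite leqNgt => /negP.
Qed.

Lemma koszul_2 (d : 'I_2 -> nat) s :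
  koszul K d s = if (s o1 < s ord0)%N then (-1) ^+ (d (s ord0) * d (s o1)) else 1.
Proof.
rewrite /koszul.
under eq_bigr => i _ do rewrite big_mkcond !big_ord_recl big_ord0 /=.
by rewrite !big_ord_recl big_ord0 /= !mulr1 !mul1r.
Qed.

Lemma koszul_3 (d : 'I_3 -> nat) s : koszul K d s =
  (if (s o1 < s ord0)%N then (-1) ^+ (d (s ord0) * d (s o1)) else 1) *
  (if (s o2 < s ord0)%N then (-1) ^+ (d (s ord0) * d (s o2)) else 1) *
  (if (s o2 < s o1)%N then (-1) ^+ (d (s o1) * d (s o2)) else 1).
Proof.
rewrite /koszul.
under eq_bigr => i _ do rewrite big_mkcond !big_ord_recl big_ord0 /=.
by rewrite !big_ord_recl big_ord0 /= !mulr1 !mul1r.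
Qed.

Section Permuted.
Variables (V : lmodType K).

Lemma permuted1 k (v : 'I_k -> V) : permuted 1 v = [seq v i | i : 'I_k].
Proof. by apply: eq_map => i; rewrite perm1. Qed.

Lemma permuted_2 (v : 'I_2 -> V) s : permuted s v = [:: v (s ord0); v (s o1)].
Proof. by rewrite /permuted /image_mem enumI2. Qed.

Lemma permuted_3 (v : 'I_3 -> V) s :
  permuted s v = [:: v (s ord0); v (s o1); v (s o2)].
Proof. by rewrite /permuted /image_mem enumI3. Qed.

End Permuted.
End SmallPermutations.

Section BinaryLinfty.
Variables (K : fieldType) (V : lmodType K).
Variables (L F : nat -> V -> Prop) (br : V -> V -> V).
Hypotheses (gl : graded_lie L br) (gF : graded_space F).
Hypothesis FL : forall n x, F n x -> L n x.
Hypothesis Fab : forall m n x y, F m x -> F n y -> br x y = 0.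
Variables (l : seq V -> V) (p n1 n2 : V).
Hypotheses (Fp : F 1 p) (L1 : L 1 n1) (L2 : L 1 n2).
Hypothesis F1 : forall a f, F a f -> F a.+1 (br n1 f).
Hypothesis F2 : forall a b f g, F a f -> F b g -> F (a + b).+1 (br (br n2 f) g).
Hypothesis K2 : 2%:R != 0 :> K.
Hypothesis l_0 : l [::] = p.
Hypothesis l_1 : forall f, dsum F f -> l [:: f] = br n1 f.
Hypothesis l_2 : forall f g, dsum F f -> dsum F g -> l [:: f; g] = br (br n2 f) g.
Hypothesis l_3 : forall fs, (3 <= size fs)%N ->
  (forall i, (i < size fs)%N -> dsum F (nth 0 fs i)) -> l fs = 0.
Hypothesis R0 : br n1 p + br p n1 = 0.
Hypothesis R1 : forall a f, F a f ->
  br (br n1 n1 + (br p n2 + br n2 p)) f = 0.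
Hypothesis R2 : forall a b f g, F a f -> F b g ->
  br (br (br n1 n2 + br n2 n1) f) g = 0.
Hypothesis R3 : forall a b c f g h, F a f -> F b g -> F c h ->
  br (br (br (br n2 n2) f) g) h = 0.

Let gL : graded_space L := gl_space gl.

Let LD m x : L m x -> dsum L x := @dsum_homog _ _ _ gL m x.
Let DF m x : F m x -> dsum F x := @dsum_homog _ _ _ gF m x.

Lemma dsum_sub x : dsum F x -> dsum L x.
Proof.
apply: dsum_ind => [|y z dy dz|n y Fy]; [exact: (dsum0 gL)|exact: (dsumD gL)|].
exact: LD (FL Fy).
Qed.

Let d1 : dsum L n1 := LD L1.
Let d2 : dsum L n2 := LD L2.

Definition homogs (fs : seq V) :=
  forall i, (i < size fs)%N -> exists d, F d (nth 0 fs i).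

Lemma homogs_dsum fs : homogs fs ->
  forall i, (i < size fs)%N -> dsum F (nth 0 fs i).
Proof. by move=> hf i /hf [d /DF]. Qed.

Lemma l_homog fs : homogs fs -> exists d, F d (l fs).
Proof.
case: fs => [|f [|g [|h fs]]] hf; first by exists 1; rewrite l_0.
- have [a Ff] := hf 0 isT; exists a.+1; rewrite l_1; [exact: F1|exact: DF Ff].
- have [a Ff] := hf 0 isT; have [b Fg] := hf 1 isT; exists (a + b).+1.
  rewrite l_2; [exact: F2|exact: DF Ff|exact: DF Fg].
by exists 0; rewrite l_3 //; [apply: gs_0 gF 0|apply: homogs_dsum].
Qed.

Lemma l_head0 fs : homogs fs -> l (0 :: fs) = 0.
Proof.
have d0 : dsum F 0 := dsum0 gF.
case: fs => [|f [|g fs]] hf.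
- by rewrite l_1 // (gl0r gl).
- have [a Ff] := hf 0 isT; have dg := DF Ff.
  by rewrite l_2 // (gl0r gl d2) (gl0l gl) //; apply: dsum_sub.
rewrite l_3 // => -[_ //|i lt] /=; exact: (homogs_dsum hf (i := i)).
Qed.

Section Relations.
Variables (n : nat) (d : 'I_n -> nat) (v : 'I_n -> V).
Hypothesis Fv : forall i, F (d i) (v i).

Lemma size_permuted s : size (permuted s v) = n.
Proof. by rewrite /permuted /image_mem size_map size_enum_ord. Qed.

Lemma homogs_permuted s : homogs (permuted s v).
Proof.
move=> i; rewrite size_permuted => lt; exists (d (s (Ordinal lt))).
rewrite /permuted /image_mem (nth_map (Ordinal lt)) ?size_enum_ord //.
have -> : nth (Ordinal lt) (enum 'I_n) i = Ordinal lt; last exact: Fv.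
by apply: val_inj; apply: nth_enum_ord.
Qed.

Lemma homogs_take k fs : homogs fs -> homogs (take k fs).
Proof.
move=> hf i; rewrite size_take_min leq_min => /andP [ltk lts].
by rewrite nth_take //; apply: hf.
Qed.

Lemma homogs_drop k fs : homogs fs -> homogs (drop k fs).
Proof.
move=> hf i; rewrite size_drop nth_drop => lt; apply: hf.
by rewrite -ltn_subRL.
Qed.

Definition rel_term i : V := \sum_(s : 'S_n | unshuffle i s)
  koszul K d s *: l (l (take i (permuted s v)) :: drop i (permuted s v)).

(** Either the inner or the outer operation has at least three arguments. *)
Lemma rel_term_zero i : (i <= n)%N -> (3 <= i)%N || (2 <= n - i)%N ->
  rel_term i = 0.
Proof.
move=> le big; apply: big1 => s _; rewrite -[RHS](scaler0 _ (koszul K d s)).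
congr (_ *: _); have hs := @homogs_permuted s.
have ht := @homogs_take i _ hs; have hd := @homogs_drop i _ hs.
case/orP: big => big.
  rewrite [l (take _ _)]l_3 ?l_head0 //; last exact: homogs_dsum.
  by rewrite size_takel ?size_permuted.
rewrite l_3 //= ?ltnS ?size_drop ?size_permuted // => -[_|j] /=.
  by have [e /DF] := l_homog ht.
by move=> lt; apply: (homogs_dsum hd); rewrite size_drop size_permuted.
Qed.

End Relations.

(** With operations of arity at most 2, a term with [i] inner arguments vanishes
    unless [i <= 2] and [n - i <= 1]. This leaves [n <= 3], where the identities
    are [rel0], ..., [rel3]. *)
Lemma binary_rel n (d : 'I_n -> nat) (v : 'I_n -> V) :
  (forall i, F (d i) (v i)) -> \sum_(i < n.+1) rel_term d v i = 0.
Proof.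
case: n d v => [|[|[|[|n]]]] d v Fv.
- rewrite big_ord_recl big_ord0 addr0 /rel_term /= sum_unshuffle_none koszul1 scale1r.
  rewrite /permuted /image_mem enum_ord0 /= l_0 l_1; last exact: DF Fp.
  exact: (rel0 gl FL Fp L1 K2 R0).
- have e0 := DF (Fv ord0); have e1 := DF (F1 (Fv ord0)); have dp := DF Fp.
  rewrite !big_ord_recl big_ord0 addr0 /rel_term /=.
  rewrite sum_unshuffle_none sum_unshuffle_all koszul1 !scale1r permuted1.
  rewrite /image_mem enumI1 /= l_0 !l_1 ?l_2 //.
  exact: (rel1 gl FL Fp L1 L2 K2 (Fv _) (R1 (Fv _))).
- have e i := DF (Fv i); have e1 i := DF (F1 (Fv i)).
  have e2 i j := DF (F2 (Fv i) (Fv j)).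
  rewrite !big_ord_recl big_ord0 addr0 rel_term_zero // add0r /rel_term /=.
  rewrite sum_unshuffle_1_2 sum_unshuffle_all !koszul1 !scale1r !permuted_2.
  rewrite !perm1 koszul_2 swap12_0 swap12_1 /=.
  rewrite !l_2 // !l_1 //.
  rewrite mulnC; exact: (rel2 gl FL Fab L1 L2 F1 K2 (Fv _) (Fv _) (R2 (Fv _) (Fv _))).
- have e i := DF (Fv i); have e2 i j := DF (F2 (Fv i) (Fv j)).
  rewrite !big_ord_recl big_ord0 addr0 /=.
  rewrite (rel_term_zero Fv (i := 0)) // (rel_term_zero Fv (i := 1)) //.
  rewrite (rel_term_zero Fv (i := 3)) // !add0r addr0 /rel_term /=.
  rewrite sum_unshuffle_2_3 koszul1 !scale1r !permuted_3 !perm1.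
  have [a0 a1 a2] := swap23E; have [b0 b1 b2] := cycle3E.
  rewrite !koszul_3 a0 a1 a2 b0 b1 b2 /= !mul1r -exprD !l_2 //.
  rewrite -mulnDl [(_ * d ord0)%N]mulnC [(_ * d (lift ord0 ord0))%N]mulnC.
  exact: (rel3 gl FL Fab L2 F2 K2 (Fv _) (Fv _) (Fv _) (R3 (Fv _) (Fv _) (Fv _))).
apply: big1 => i _; apply: (rel_term_zero Fv); first by rewrite -ltnS.
case: (ltnP 2 i) => //= i2; rewrite ltn_subRL.
by rewrite addnC; apply: leq_ltn_trans (_ : 2 + 1 < _)%N => //; rewrite leq_add2r in i2 *.
Qed.

Lemma binary_Linfty : curved_Linfty F l.
Proof.
split; [exact: gF| | | |by move=> n d v /binary_rel].
- move=> s1 s2 c x y h1 h2 dx dy.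
  have dxy := dsum_lin gF c dx dy.
  have [lx ly lxy] := And3 (dsum_sub dx) (dsum_sub dy) (dsum_sub dxy).
  have h z : dsum F z -> (2 <= size s1 + size s2)%N -> l (s1 ++ z :: s2) = 0.
    move=> dz big; rewrite l_3 //; first by rewrite size_cat /= addnS.
    move=> i; rewrite size_cat nth_cat; case: (ltnP i (size s1)) => [lt _|ge].
      exact: h1.
    rewrite -ltn_subLR //.
    by case: (i - _)%N => [|j] //= lt; apply: h2.
  case: (leqP 2 (size s1 + size s2)) => [big|].
    by rewrite !h // scaler0 addr0.
  case: s1 h1 {h} => [|f [|//]] h1; case: s2 h2 => [|g [|//]] h2 //= _.
  + by rewrite !l_1 // (gl_linr gl).
  + have dg := h2 0 isT; have lg := dsum_sub dg.
    by rewrite !l_2 // (gl_linr gl) // (gl_linl gl) //; apply: dsum_br gl _ _ _ _.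
  have df := h1 0 isT; have lf := dsum_sub df.
  by rewrite !l_2 // (gl_linr gl) //; apply: dsum_br gl _ _ _ _.
- move=> [|[|[|k]]] d v Fv.
  + by rewrite big_ord0 /image_mem enum_ord0 /= l_0.
  + rewrite big_ord_recl big_ord0 addn0 /image_mem enumI1 /= l_1; last exact: DF (Fv _).
    exact: F1.
  + rewrite !big_ord_recl big_ord0 addn0 /image_mem enumI2 /=.
    rewrite l_2; [exact: F2|exact: DF (Fv _)|exact: DF (Fv _)].
  rewrite -permuted1 l_3; [exact: gs_0 gF _|by rewrite size_permuted|].
  apply: homogs_dsum; exact: (homogs_permuted Fv).
move=> [|[|[|k]]] d v s Fv.
- have -> : s = 1%g by apply/permP => -[].
  by rewrite koszul1 scale1r permuted1.
- have -> : s = 1%g by apply/permP => i; rewrite !ord1.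
  by rewrite koszul1 scale1r permuted1.
- have e i := DF (Fv i).
  rewrite permuted_2 -permuted1 permuted_2 !perm1 koszul_2.
  case: (permS2 s) => ->; first by rewrite !perm1 scale1r.
  have -> : lift ord0 ord0 = ord_max :> 'I_2 by apply: val_inj.
  rewrite tpermL tpermR !l_2 //= (br_swap gl FL Fab L2 (Fv ord_max) (Fv ord0)).
  by [].
have l0 t : l (permuted t v) = 0.
  apply: l_3; first by rewrite size_permuted.
  by apply: homogs_dsum; exact: (homogs_permuted Fv).
by rewrite -permuted1 !l0 scaler0.
Qed.

End BinaryLinfty.

(** * The curved L-infinity algebra of a quasi-twilled Lie conformal algebra *)

Section Concrete.
Variables (K : fieldType) (A B : lmodType {poly K}).
Local Notation E := (A * B)%type.
Variable br : E -> E -> lpoly E.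
Hypothesis qt : quasi_twilled br.
Hypothesis K0 : forall n : nat, n.+1%:R != 0 :> K.

Local Notation iA := (@iA K A B).
Local Notation iB := (@iB K A B).
Local Notation wt := (@wt K A B).
Local Notation NR := (@NR K E).
Local Notation P := (projF A B).
Local Notation psi := (psi_hat br).
Local Notation nu1 := (nu1_hat br).
Local Notation nu2 := (nu2_hat br).

Let lc : lie_conformal br := qt_lie qt.
Let iAl : klin iA := @iA_klin K A B.
Let iBl : klin iB := @iB_klin K A B.
Let tl : klin (@theta K A B) := @theta_klin K A B.
Let K2 : 2%:R != 0 :> K := K0 1.

Lemma cross_theta x y : cross br (theta x) (theta y) = 2%:R *: cross br x y.
Proof. by rewrite /cross !iA_theta !iB_theta (brZl lc) (brZr lc) scalerDr. Qed.

Lemma psi_wt : wt (2%:R ^+ 3 / 4%:R) psi.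
Proof.
have -> : 2%:R ^+ 3 / 4%:R = 2%:R :> K.
  rewrite exprSr expr2 -natrM -[(2 * 2)%N]/4%N mulrAC divff ?mul1r //; exact: K0 3.
rewrite (psi_hatE br) => a; case: a => [|x [|y [|z a]]] /=; rewrite ?lmap0 ?scaler0 //.
by rewrite lmap_theta_iB !iA_theta.
Qed.

Lemma nu1_wt : wt (2%:R ^+ 2 / 4%:R) nu1.
Proof.
have -> : 2%:R ^+ 2 / 4%:R = 1 :> K.
  by rewrite expr2 -natrM -[(2 * 2)%N]/4%N divff //; apply: K0 3.
rewrite (nu1_hatE qt) => a; case: a => [|x [|y [|z a]]] /=; rewrite ?lmap0 ?scaler0 //.
rewrite lmapD // lmap_theta_iA lmap_theta_iB cross_theta !iA_theta lmapZ //.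
by rewrite scale1r.
Qed.

Lemma nu2_wt : wt (2%:R ^+ 1 / 4%:R) nu2.
Proof.
have -> : 2%:R ^+ 1 / 4%:R = 2%:R^-1 :> K.
  rewrite expr1 -[4%N]/(2 * 2)%N natrM invfM mulrA divff ?mul1r //.
rewrite (nu2_hatE qt) => a; case: a => [|x [|y [|z a]]] /=; rewrite ?lmap0 ?scaler0 //.
rewrite lmapD // lmap_theta_iA lmap_theta_iB cross_theta !iB_theta lmapZ //.
rewrite (brZl lc) (brZr lc) !(lmapZ iBl) scalerDr !scalerA ?mulrA mulVf //.
by rewrite scale1r mul1r.
Qed.

Let gl : graded_lie (Lgr A B) NR := @NR_graded_lie K E.
Let gL : graded_space (Lgr A B) := gl_space gl.
Let gF : graded_space (Fgr A B) := @Fgr_graded K A B.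

Lemma Fgr_dsum f : dsum (Fgr A B) f -> dsum (Lgr A B) f.
Proof. exact: (dsum_sub gl (@Fgr_Lgr K A B)). Qed.

Lemma Fgr_wt f : dsum (Fgr A B) f -> wt 2%:R f.
Proof.
apply: dsum_ind => [a|F G wF wG|n _ [g [_ ->]]]; last exact: wt_hat.
  have -> : (0 : mcochain E E) a = 0 by [].
  by rewrite lmap0 ?scaler0.
by rewrite -[F]scale1r; apply: wt_lin.
Qed.

Lemma pow2_inj i j : 2%:R ^+ i = 2%:R ^+ j :> K -> i = j.
Proof.
wlog le : i j / (i <= j)%N.
  by move=> h e; case: (leqP i j) => [le|/ltnW le]; [|symmetry]; apply: h.
rewrite -(subnKC le) exprD => /eqP; rewrite -[X in X == _]mulr1 -subr_eq0 -mulrBr.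
rewrite mulf_eq0 expf_eq0 (negPf K2) andbF subr_eq0 eq_sym /=.
by case: (j - i)%N => [|n]; rewrite ?addn0 // (negPf (pow2_neq1 K0 n)).
Qed.

Definition allF (fs : seq (mcochain E E)) :=
  forall i, (i < size fs)%N -> dsum (Fgr A B) (nth 0 fs i).

Lemma allF_cons f fs : allF (f :: fs) -> dsum (Fgr A B) f /\ allF fs.
Proof. by move=> h; split=> [|i]; [apply: (h 0%N)|apply: (h i.+1)]. Qed.

Lemma foldl_wt d X fs : dsum (Lgr A B) X -> wt d X -> allF fs ->
  dsum (Lgr A B) (foldl NR X fs) /\ wt (d * 2%:R ^+ size fs) (foldl NR X fs).
Proof.
elim: fs d X => [|f fs IH] d X dX wX /= => [_|/allF_cons [df dfs]].
  by rewrite expr0 mulr1.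
rewrite exprS mulrA; have dfL := Fgr_dsum df.
apply: IH => //; first exact: (dsum_br gl).
by apply: NR_wt => //; [exact: dsum_lin1|exact: dsum_lin1|exact: Fgr_wt].
Qed.

Lemma foldl_add X Y fs : dsum (Lgr A B) X -> dsum (Lgr A B) Y -> allF fs ->
  foldl NR (X + Y) fs = foldl NR X fs + foldl NR Y fs.
Proof.
elim: fs X Y => [|f fs IH] X Y dX dY //= /allF_cons [/Fgr_dsum df dfs].
by rewrite (glDl gl) // IH //; apply: (dsum_br gl).
Qed.

Lemma projF_add X Y : P (X + Y) = P X + P Y.
Proof. by have := projF_lin 1 X Y; rewrite !scale1r. Qed.

(** Weights are written as [2 ^ j / 4]; every bracket with a lift adds 1 to [j],
    and [j = 3] is the weight of a lift. *)
Lemma projF_foldl j X fs : dsum (Lgr A B) X -> wt (2%:R ^+ j / 4%:R) X -> allF fs ->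
  P (foldl NR X fs) = if (j + size fs == 3)%N then foldl NR X fs else 0.
Proof.
move=> dX wX af; have [dY] := foldl_wt dX wX af.
have K4 : 4%:R != 0 :> K := K0 3.
have -> : 2%:R ^+ j / 4%:R * 2%:R ^+ size fs = 2%:R ^+ (j + size fs) / 4%:R :> K.
  by rewrite exprD mulrAC.
have e3 : 2%:R ^+ 3 / 4%:R = 2%:R :> K.
  rewrite exprSr expr2 -natrM -[(2 * 2)%N]/4%N mulrAC divff ?mul1r //.
case: eqP => [->|ne] wY.
  by apply: (wt2_fixed K0); [apply: dsum_multilin|rewrite -e3].
apply: projF_wt wY; apply/eqP; rewrite -[RHS]e3 => /(mulIf (invr_neq0 K4)).
by move/pow2_inj.
Qed.

Let cp : is_cochain 2 psi := psi_cochain qt.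
Let c1 : is_cochain 2 nu1 := nu1_cochain qt.
Let c2 : is_cochain 2 nu2 := nu2_cochain qt.
Let dp : dsum (Lgr A B) psi := dsum_homog gL (n := 1) cp.
Let d1 : dsum (Lgr A B) nu1 := dsum_homog gL (n := 1) c1.
Let d2 : dsum (Lgr A B) nu2 := dsum_homog gL (n := 1) c2.

Lemma linfE fs : allF fs -> linf br fs =
  (if (size fs == 0)%N then psi else 0)
  + (if (size fs == 1)%N then foldl NR nu1 fs else 0)
  + (if (size fs == 2)%N then foldl NR nu2 fs else 0).
Proof.
move=> af; rewrite /linf /voronov (Omega_sum qt) !foldl_add //; last exact: (dsumD gL).
rewrite !projF_add (projF_foldl dp psi_wt af) (projF_foldl d1 nu1_wt af).
rewrite (projF_foldl d2 nu2_wt af).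
by case: fs af => [|f [|g [|h fs]]].
Qed.

Lemma linf_0 : linf br [::] = psi.
Proof. by rewrite linfE //= !addr0. Qed.

Lemma linf_1 f : dsum (Fgr A B) f -> linf br [:: f] = NR nu1 f.
Proof. by move=> df; rewrite linfE /= ?add0r ?addr0 // => -[]. Qed.

Lemma linf_2 f g : dsum (Fgr A B) f -> dsum (Fgr A B) g ->
  linf br [:: f; g] = NR (NR nu2 f) g.
Proof. by move=> df dg; rewrite linfE /= ?add0r ?addr0 // => -[|[]]. Qed.

Lemma linf_3 fs : (3 <= size fs)%N -> allF fs -> linf br fs = 0.
Proof.
by move=> lt af; rewrite linfE //; case: fs lt {af} => [|f [|g [|h fs]]] //= _; rewrite !addr0.
Qed.

(** The projection of an iterated bracket with lifts singles out one weight of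
    the sum. *)
Lemma weight_components S4 S2 S1 Sh Sq fs :
  dsum (Lgr A B) S4 -> dsum (Lgr A B) S2 -> dsum (Lgr A B) S1 ->
  dsum (Lgr A B) Sh -> dsum (Lgr A B) Sq ->
  wt (2%:R ^+ 4 / 4%:R) S4 -> wt (2%:R ^+ 3 / 4%:R) S2 ->
  wt (2%:R ^+ 2 / 4%:R) S1 -> wt (2%:R ^+ 1 / 4%:R) Sh ->
  wt (2%:R ^+ 0 / 4%:R) Sq -> allF fs ->
  P (foldl NR (S4 + (S2 + (S1 + (Sh + Sq)))) fs) = 0 ->
  (size fs = 0%N -> S2 = 0) /\ (size fs = 1%N -> foldl NR S1 fs = 0) /\
  (size fs = 2%N -> foldl NR Sh fs = 0) /\ (size fs = 3%N -> foldl NR Sq fs = 0).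
Proof.
move=> D4 D2 D1 Dh Dq W4 W2 W1 Wh Wq af.
have Dhq := dsumD gL Dh Dq; have D1hq := dsumD gL D1 Dhq; have D21hq := dsumD gL D2 D1hq.
rewrite !foldl_add // !projF_add.
rewrite (projF_foldl D4 W4 af) (projF_foldl D2 W2 af) (projF_foldl D1 W1 af).
rewrite (projF_foldl Dh Wh af) (projF_foldl Dq Wq af).
clear; move: (foldl NR S4 fs) (foldl NR S1 fs) (foldl NR Sh fs) (foldl NR Sq fs).
rewrite !addnE /addn_rec.
case: fs => [|f1 [|f2 [|f3 [|f4 r]]]] u v w z /=; rewrite ?add0r ?addr0 => e;
  do !split => //.
Qed.

(** [NR Omega Omega = 0] has components of the weights 4, 2, 1, 1/2 and 1/4. *)
Lemma Omega_components fs : allF fs ->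
  (size fs = 0%N -> NR nu1 psi + NR psi nu1 = 0) /\
  (size fs = 1%N -> foldl NR (NR nu1 nu1 + (NR psi nu2 + NR nu2 psi)) fs = 0) /\
  (size fs = 2%N -> foldl NR (NR nu1 nu2 + NR nu2 nu1) fs = 0) /\
  (size fs = 3%N -> foldl NR (NR nu2 nu2) fs = 0).
Proof.
move=> af; have K4 : 4%:R != 0 :> K := K0 3.
have dd X Y : dsum (Lgr A B) X -> dsum (Lgr A B) Y -> dsum (Lgr A B) (NR X Y) := @dsum_br _ _ _ _ gl X Y.
have ww i j k X Y : dsum (Lgr A B) X -> dsum (Lgr A B) Y ->
    wt (2%:R ^+ i / 4%:R) X -> wt (2%:R ^+ j / 4%:R) Y -> (i + j = k + 2)%N ->
    wt (2%:R ^+ k / 4%:R) (NR X Y).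
  move=> dX dY wX wY e.
  have -> : 2%:R ^+ k / 4%:R = 2%:R ^+ i / 4%:R * (2%:R ^+ j / 4%:R) :> K.
    have e4 : 4%:R = 2%:R ^+ 2 :> K by rewrite expr2 -natrM.
    rewrite mulrACA -exprD e exprD -e4 -[_ * 4%:R * _]mulrA; congr (_ * _).
    by rewrite mulrA divff // mul1r.
  by apply: NR_wt => //; apply: dsum_lin1.
have wadd k X Y : wt (2%:R ^+ k / 4%:R) X -> wt (2%:R ^+ k / 4%:R) Y ->
    wt (2%:R ^+ k / 4%:R) (X + Y).
  by move=> wX wY; rewrite -[X]scale1r; apply: wt_lin.
have := congr1 (fun X => P (foldl NR X fs)) (Omega_square qt).
have dpn := dsumD gL dp d1; have dO := dsumD gL dpn d2.
rewrite {1 2}(Omega_sum qt) (glDl gl) // [in NR (psi + _) _](glDl gl) //.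
rewrite !(glDr gl) //.
have D4 : dsum (Lgr A B) (NR psi psi) by apply: (dd).
have D2 : dsum (Lgr A B) (NR nu1 psi + NR psi nu1) by apply: (dsumD gL); apply: (dd).
have D1 : dsum (Lgr A B) (NR nu1 nu1 + (NR psi nu2 + NR nu2 psi)).
  by apply: (dsumD gL); [|apply: (dsumD gL)]; apply: (dd).
have Dh : dsum (Lgr A B) (NR nu1 nu2 + NR nu2 nu1) by apply: (dsumD gL); apply: (dd).
have Dq : dsum (Lgr A B) (NR nu2 nu2) by apply: (dd).
have W4 : wt (2%:R ^+ 4 / 4%:R) (NR psi psi) by apply: (ww _ _ _ _ _ _ _ psi_wt psi_wt).
have W2 : wt (2%:R ^+ 3 / 4%:R) (NR nu1 psi + NR psi nu1).
  by apply: (wadd); [apply: (ww _ _ _ _ _ _ _ nu1_wt psi_wt)|apply: (ww _ _ _ _ _ _ _ psi_wt nu1_wt)].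
have W1 : wt (2%:R ^+ 2 / 4%:R) (NR nu1 nu1 + (NR psi nu2 + NR nu2 psi)).
  apply: (wadd); first by apply: (ww _ _ _ _ _ _ _ nu1_wt nu1_wt).
  by apply: (wadd); [apply: (ww _ _ _ _ _ _ _ psi_wt nu2_wt)|apply: (ww _ _ _ _ _ _ _ nu2_wt psi_wt)].
have Wh : wt (2%:R ^+ 1 / 4%:R) (NR nu1 nu2 + NR nu2 nu1).
  by apply: (wadd); [apply: (ww _ _ _ _ _ _ _ nu1_wt nu2_wt)|apply: (ww _ _ _ _ _ _ _ nu2_wt nu1_wt)].
have Wq : wt (2%:R ^+ 0 / 4%:R) (NR nu2 nu2) by apply: (ww _ _ _ _ _ _ _ nu2_wt nu2_wt).
have -> : (NR psi psi) + NR psi nu1 + NR psi nu2 + (NR nu1 psi + NR nu1 nu1 + NR nu1 nu2)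
    + (NR nu2 psi + NR nu2 nu1 + NR nu2 nu2)
  = (NR psi psi) + ((NR nu1 psi + NR psi nu1) + ((NR nu1 nu1 + (NR psi nu2 + NR nu2 psi))
      + ((NR nu1 nu2 + NR nu2 nu1) + NR nu2 nu2))).
  move: (NR psi nu1) (NR psi nu2) (NR nu1 psi) (NR nu1 nu1) (NR nu1 nu2)
    (NR nu2 psi) (NR nu2 nu1) (NR nu2 nu2) (NR psi psi) => *.
  by zmodule (mcochain E E : zmodType).
have z : foldl NR 0 fs = 0.
  elim: (fs) af => //= f r IH /allF_cons [/Fgr_dsum df ar].
  by rewrite (gl0l gl df) IH.
by rewrite z projF0; apply: weight_components.
Qed.

Lemma psi_Fgr : Fgr A B 1 psi.
Proof.
have := projF_foldl (fs := [::]) dp psi_wt; rewrite /= => <- //.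
exact: projF_Fgr cp.
Qed.

Lemma nu1_Fgr a f : Fgr A B a f -> Fgr A B a.+1 (NR nu1 f).
Proof.
move=> Ff; have af : allF [:: f] by move=> -[] // _; apply: (dsum_homog gF Ff).
have := projF_foldl d1 nu1_wt af; rewrite /= => <-.
by apply: projF_Fgr; apply: (@NR_closed K E 1 a) => //; apply: Fgr_Lgr Ff.
Qed.

Lemma nu2_Fgr a b f g : Fgr A B a f -> Fgr A B b g ->
  Fgr A B (a + b).+1 (NR (NR nu2 f) g).
Proof.
move=> Ff Fg; have af : allF [:: f; g].
  by move=> -[|[]] // _; [apply: (dsum_homog gF Ff)|apply: (dsum_homog gF Fg)].
have := projF_foldl d2 nu2_wt af; rewrite /= => <-.
apply: projF_Fgr; apply: (@NR_closed K E (1 + a) b); last exact: Fgr_Lgr Fg.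
by apply: (@NR_closed K E 1 a) => //; apply: Fgr_Lgr Ff.
Qed.

Lemma linf_curved : curved_Linfty (Fgr A B) (linf br).
Proof.
have h a f : Fgr A B a f -> dsum (Fgr A B) f := @dsum_homog _ _ _ gF a f.
apply: (@binary_Linfty K _ (Lgr A B) (Fgr A B) NR gl gF (@Fgr_Lgr K A B) _
  (linf br) psi nu1 nu2 psi_Fgr c1 c2 nu1_Fgr nu2_Fgr K2 linf_0 linf_1 linf_2 linf_3).
- by move=> m n _ _ [f [cf ->]] [g [cg ->]]; apply: NR_hat cf cg.
- have a0 : allF [::] by move=> i.
  have [e _] := Omega_components a0; exact: (e erefl).
- move=> a f Ff; have af : allF [:: f] by move=> -[] // _; exact: (h _ _ Ff).
  have [_ [e _]] := Omega_components af; exact: (e erefl).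
- move=> a b f g Ff Fg; have af : allF [:: f; g].
    by move=> -[|[]] // _; [exact: (h _ _ Ff)|exact: (h _ _ Fg)].
  have [_ [_ [e _]]] := Omega_components af; exact: (e erefl).
move=> a b c f g k Ff Fg Fk; have af : allF [:: f; g; k].
  by move=> -[|[|[]]] // _; [exact: (h _ _ Ff)|exact: (h _ _ Fg)|exact: (h _ _ Fk)].
have [_ [_ [_ e]]] := Omega_components af; exact: (e erefl).
Qed.

End Concrete.

(** * Bracket with a module map *)

Section BracketWithMap.
Variables (K : fieldType) (E : lmodType {poly K}).
Local Notation o1 := (lift ord0 ord0).
Implicit Types (h : mcochain E E) (d : E -> E).

Lemma lsubst_lconst (N : lmodType {poly K}) s (x : N) : lsubst s (lconst x) = lconst x.
Proof. by rewrite lsubstE (leval_lconst _ _ (@lconst_dlinear K N)). Qed.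

Lemma lext_lconst (N : lmodType {poly K}) (p : lpoly N) : lext (@lconst N) p = p.
Proof. by rewrite lextE -[RHS]lsubst_lam lsubstE. Qed.

Lemma lext_const (M N : lmodType {poly K}) (g : M -> lpoly N) x :
  (forall y z, g (y + z) = g y + g z) -> lext g (lconst x) = g x.
Proof.
move=> gD; rewrite lextE lconstE.
by rewrite (@leval_mono K (lring K) M (smod N) (@lam K) g gD) mev1 scale1r.
Qed.

(** The form in which the two unshuffles of [star 2 1] produce the values of
    [h]. *)
Lemma skew2 h x y (s : 'S_2) : is_cochain 2 h ->
  h [:: x; y] = (-1) ^+ s *: lsubst (sub_dag K 2)
    (eval_at h (take 1 [seq lam (s i) | i : 'I_2])
      [:: nth 0 [:: x; y] (s ord0); nth 0 [:: x; y] (s o1)]).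
Proof.
move=> ch; have := co_skew ch s [tuple x; y].
by rewrite /permute enumI2 /= !(tnth_nth 0).
Qed.

Lemma eval_cochain1 d s x : eval_at (cochain1 d) s [:: x] = lconst (d x).
Proof. exact: lsubst_lconst. Qed.

Lemma star_map h d x y : is_cochain 2 h ->
  star 2 1 h (cochain1 d) [:: x; y] = h [:: d x; y] + h [:: x; d y].
Proof.
move=> ch; rewrite /star [size _]/= eqxx /=.
have sD c (p q : lpoly E) : lsubst (sub_dag K 2) (c *: p + q) =
  c *: lsubst (sub_dag K 2) p + lsubst (sub_dag K 2) q := lsubst_lin _ c p q.
have sZ c (p : lpoly E) : lsubst (sub_dag K 2) (c *: p) = c *: lsubst (sub_dag K 2) p.
  by have := sD c p 0; rewrite lsubst0 !addr0.
have hD (z : E) s : forall u v, eval_at h s [:: u + v; z] = eval_at h s [:: u; z] + eval_at h s [:: v; z].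
  move=> u v; rewrite -[u in LHS]scale1r -polyC1 /eval_at.
  by rewrite (cochain_lin1 ch) scale1r -[h [:: u; z]]scale1r lsubst_lin !scale1r.
rewrite sum_unshuffle_1_2.
pose T (s : 'S_2) z w := (-1) ^+ s *: lsubst (sub_dag K 2)
  (eval_at h (take 1 [seq lam (s i) | i : 'I_2]) [:: z; w]).
have key (s : 'S_2) : lsubst (sub_dag K 2) ((-1) ^+ s *:
   lext (fun w => eval_at h (take 1 ((\sum_(l <- take 1 [seq lam (s i) | i : 'I_2]) l)
     :: drop 1 [seq lam (s i) | i : 'I_2]))
       (w :: drop 1 [seq nth 0 [:: x; y] (s i) | i : 'I_2]))
   (eval_at (cochain1 d) (take 0 [seq lam (s i) | i : 'I_2])
      (take 1 [seq nth 0 [:: x; y] (s i) | i : 'I_2]))) =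
   T s (d (nth 0 [:: x; y] (s ord0))) (nth 0 [:: x; y] (s o1)).
  rewrite sZ; congr (_ *: lsubst _ _); rewrite /image_mem enumI2 /map.
  rewrite [take 1 [:: nth _ _ _; _]]/= [drop 1 [:: nth _ _ _; _]]/=.
  rewrite eval_cochain1 lext_const; last exact: hD.
  by rewrite [take 1 [:: lam _; _]]/= big_seq1 [drop 1 _]/=.
rewrite -[X in lsubst _ (X + _)]scale1r sD scale1r !key {key sD sZ}; congr (_ + _).
  by rewrite /T !perm1 [RHS](skew2 _ _ 1%g ch) !perm1.
by rewrite [RHS](skew2 _ _ swap12 ch) /T swap12_0 swap12_1.
Qed.

Lemma star_map_left h d x y : klin d -> is_cochain 2 h ->
  star 1 2 (cochain1 d) h [:: x; y] = lmap d (h [:: x; y]).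
Proof.
move=> dl ch; rewrite /star [size _]/= eqxx /= sum_unshuffle_all odd_perm1 expr0 scale1r.
rewrite (skew2 x y 1%g ch) odd_perm1 expr0 scale1r !perm1.
rewrite lmap_lsubst //; congr (lsubst _ _); rewrite /image_mem enumI2 /map.
rewrite [take 2 [:: nth _ _ _; _]]/= [drop 2 [:: nth _ _ _; _]]/= !perm1.
move: (eval_at h _ _) => q; rewrite -[RHS]lext_lconst lext_lmap //; last exact: lconstD.
congr (lext _ q); apply/funext => w; exact: eval_cochain1.
Qed.

(** The bracket measures how far [d] is from being a derivation of [h]. *)
Lemma NR_map h d x y : klin d -> is_cochain 1 (cochain1 d) -> is_cochain 2 h ->
  NR h (cochain1 d) [:: x; y] =
    h [:: d x; y] + h [:: x; d y] - lmap d (h [:: x; y]).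
Proof.
move=> dl cd ch; rewrite (@NR_cochain K E 1 0 h _ ch cd) muln0 expr0 scale1r.
have -> : (star 2 1 h (cochain1 d) - star 1 2 (cochain1 d) h) [:: x; y] =
  star 2 1 h (cochain1 d) [:: x; y] - star 1 2 (cochain1 d) h [:: x; y] by [].
by rewrite star_map // star_map_left.
Qed.

End BracketWithMap.

Section MapCochain.
Variables (K : fieldType) (M N : lmodType {poly K}).

Lemma cochain1_cochain (D : M -> N) : klin D -> is_cochain 1 (cochain1 D).
Proof.
move=> Dl; split.
- by move=> [|x [|y a]].
- move=> [|x [|y a]] /=; try exact: in_vars0.
  by rewrite lconstE; apply: in_vars_umono => i; rewrite cm1.
- move=> [|x1 a1] [|y1 a2] c x y //= _.
  by rewrite Dl lscaleE; apply: etrans (lconst_dlinear _ _ _) _; rewrite polyev_del.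
- move=> [|x1 a1] [|y1 a2] x //= _.
  have -> : - sub_dag K 1 0 = ('X)%:MP by rewrite /sub_dag /= /ldag big_ord0 oppr0 sub0r opprK.
  rewrite -[lconst (D ('X *: x))]addr0 -[X in _ + X]/(0 : smod N).
  have e : lconst (0 : N) = 0 by apply: (addrI (lconst 0)); rewrite -lconstD !addr0.
  rewrite (klinZ _ _ Dl) -[X in lconst X]addr0.
  apply: etrans (congr1 (fun z => z + 0) (lconst_dlinear _ _ _)) _.
  by rewrite polyev_del e !addr0.
move=> s a; have -> : s = 1%g by apply/permP => i; rewrite !ord1.
rewrite odd_perm1 expr0 scale1r /permute enumI1 /= perm1.
case/tupleP: a => x a; rewrite (tuple0 a) /= (tnth_nth x) /=.
by rewrite /eval_at !lsubst_lconst.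
Qed.

End MapCochain.

(** * Right deformation maps *)

Section RightDeformation.
Variables (K : fieldType) (A B : lmodType {poly K}).
Local Notation E := (A * B)%type.
Variable br : E -> E -> lpoly E.
Hypothesis qt : quasi_twilled br.
Hypothesis K0 : forall n : nat, n.+1%:R != 0 :> K.
Variable D : {linear A -> B}.

Local Notation iA := (@iA K A B).
Local Notation iB := (@iB K A B).
Local Notation inA := (@inA K A B).
Local Notation inB := (@inB K A B).
Local Notation prA := (@prA K A B).
Local Notation prB := (@prB K A B).
Local Notation NR := (@NR K E).
Local Notation psi := (psi_hat br).
Local Notation nu1 := (nu1_hat br).
Local Notation nu2 := (nu2_hat br).

Let lc : lie_conformal br := qt_lie qt.
Let iAl : klin iA := @iA_klin K A B.
Let iBl : klin iB := @iB_klin K A B.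

Definition dmap (x : E) : E := inB (D (prA x)).

Lemma D_klin : klin D.
Proof. by move=> a x y; rewrite linearP. Qed.

Lemma dmap_klin : klin dmap.
Proof. exact: klin_comp (@inB_klin K A B) (klin_comp D_klin (@prA_klin K A B)). Qed.

Let dl := dmap_klin.

Lemma hat_cochain1 : hat (cochain1 D) = cochain1 dmap :> mcochain E E.
Proof.
rewrite hatE; apply/funext => -[|x [|y a]]; rewrite /mcmap /=.
- by rewrite lmap0 //; apply: inB_klin.
- by rewrite lmap_lconst //; apply: inB_klin.
- by rewrite lmap0 //; apply: inB_klin.
Qed.

Local Notation D1 := (cochain1 dmap).

Lemma dmap_cochain : is_cochain 1 D1.
Proof. exact: cochain1_cochain dl. Qed.

Lemma D1_Fgr : Fgr A B 0 D1.
Proof.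
by exists (cochain1 D); split; [exact: cochain1_cochain D_klin|rewrite hat_cochain1].
Qed.

Lemma dmap_iB x : dmap (iB x) = 0.
Proof. by rewrite /dmap; have -> : prA (iB x) = 0 by []; rewrite linear0. Qed.

Lemma lmap_dmap_iA p : lmap dmap (lmap iA p) = lmap dmap p.
Proof. by rewrite lmap_comp //; apply: eq_lmap => x. Qed.

(** The bracket of two elements of the graph, expanded by bilinearity: the term
    without [D] gives [psi], the terms linear in [D] give [NR nu1 D1] and the
    quadratic ones give the last summand, in which every term occurs twice. The
    cubic term vanishes because the second summand is a subalgebra. The
    right-hand side measures the distance of this bracket from the graph. *)
Lemma mc_value a b :
  (psi + NR nu1 D1 + 2%:R^-1 *: NR (NR nu2 D1) D1) [:: inA a; inA b] =
    lmap iB (br (a, D a) (b, D b)) - lmap dmap (br (a, D a) (b, D b)).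
Proof.
have K2 : 2%:R != 0 :> K := K0 1.
have cn := @NR_closed K E 1 0 nu2 _ (nu2_cochain qt) dmap_cochain.
set x := inA a; set y := inA b; set x' : E := inB (D a); set y' : E := inB (D b).
have eM : (psi + NR nu1 D1 + 2%:R^-1 *: NR (NR nu2 D1) D1) [:: x; y] =
   psi [:: x; y] + NR nu1 D1 [:: x; y] + 2%:R^-1 *: NR (NR nu2 D1) D1 [:: x; y] by [].
have ex : (a, D a) = x + x' :> E.
  have -> : x + x' = (a + 0, 0 + D a) by [].
  by rewrite addr0 add0r.
have ey : (b, D b) = y + y' :> E.
  have -> : y + y' = (b + 0, 0 + D b) by [].
  by rewrite addr0 add0r.
have dx : dmap x = x' by [].
have dy : dmap y = y' by [].
have dx' : dmap x' = 0 := dmap_iB x'.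
have dy' : dmap y' = 0 := dmap_iB y'.
have [Ax Ay] : iA x = x /\ iA y = y by [].
have [Bx Bly] : iB x = 0 /\ iB y = 0 by [].
have [Ax' Ay'] : iA x' = 0 /\ iA y' = 0 by [].
have [Bx' By'] : iB x' = x' /\ iB y' = y' by [].
have psiE : psi [:: x; y] = lmap iB (br x y) by rewrite psi_hatE /= Ax Ay.
have n1E u v : nu1 [:: u; v] = lmap iA (br (iA u) (iA v)) + lmap iB (cross br u v).
  by rewrite nu1_hatE.
have n2E u v : nu2 [:: u; v] = lmap iA (cross br u v) + lmap iB (br (iB u) (iB v)).
  by rewrite nu2_hatE.
have c_xy : cross br x y = 0 by rewrite /cross Bx Bly (br0l lc) (br0r lc) addr0.
have c_xy' : cross br x y' = br x y' by rewrite /cross Ax By' Bx (br0l lc) addr0.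
have c_x'y : cross br x' y = br x' y by rewrite /cross Ax' Ay Bx' (br0l lc) add0r.
have c_x'y' : cross br x' y' = 0 by rewrite /cross Ax' Ay' (br0l lc) (br0r lc) addr0.
have bA : lmap iA (br x' y') = 0 by have := lmap_prA_brB qt x' y'; rewrite Bx' By'.
have bB : lmap dmap (br x' y') = 0 by rewrite -lmap_dmap_iA bA lmap0.
have n2_0l v : nu2 [:: 0; v] = 0.
  by rewrite n2E /cross (klin0 iAl) (klin0 iBl) !(br0l lc) addr0 !lmap0 // addr0.
have n2_0r v : nu2 [:: v; 0] = 0.
  by rewrite n2E /cross (klin0 iAl) (klin0 iBl) !(br0r lc) addr0 !lmap0 // addr0.
have n2_xy : nu2 [:: x; y] = 0 by rewrite n2E c_xy Bx (br0l lc) !lmap0 // addr0.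
have n2_x'y : nu2 [:: x'; y] = lmap iA (br x' y).
  by rewrite n2E c_x'y Bly (br0r lc) lmap0 // addr0.
have n2_xy' : nu2 [:: x; y'] = lmap iA (br x y').
  by rewrite n2E c_xy' Bx (br0l lc) lmap0 // addr0.
have n2_x'y' : nu2 [:: x'; y'] = lmap iB (br x' y').
  by rewrite n2E c_x'y' Bx' By' lmap0 // add0r.
have n1_x'y : nu1 [:: x'; y] = lmap iB (br x' y).
  by rewrite n1E c_x'y Ax' (br0l lc) lmap0 // add0r.
have n1_xy' : nu1 [:: x; y'] = lmap iB (br x y').
  by rewrite n1E c_xy' Ay' (br0r lc) lmap0 // add0r.
have n1_xy : nu1 [:: x; y] = lmap iA (br x y).
  by rewrite n1E c_xy Ax Ay lmap0 // addr0.
have mapE h u v : is_cochain 2 h -> NR h D1 [:: u; v] =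
    h [:: dmap u; v] + h [:: u; dmap v] - lmap dmap (h [:: u; v]).
  by move=> ch; apply: NR_map dl dmap_cochain ch.
have g_x'y : NR nu2 D1 [:: x'; y] = lmap iB (br x' y') - lmap dmap (br x' y).
  rewrite mapE; last exact: nu2_cochain.
  by rewrite dx' dy n2_0l n2_x'y' n2_x'y lmap_dmap_iA add0r.
have g_xy' : NR nu2 D1 [:: x; y'] = lmap iB (br x' y') - lmap dmap (br x y').
  rewrite mapE; last exact: nu2_cochain.
  by rewrite dx dy' n2_0r n2_x'y' n2_xy' lmap_dmap_iA addr0.
have g_xy : lmap dmap (NR nu2 D1 [:: x; y]) = lmap dmap (br x' y) + lmap dmap (br x y').
  rewrite mapE; last exact: nu2_cochain.
  by rewrite dx dy n2_x'y n2_xy' n2_xy lmap0 // subr0 lmapD // !lmap_dmap_iA.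
have nu1E : NR nu1 D1 [:: x; y] = lmap iB (br x' y) + lmap iB (br x y') - lmap dmap (br x y).
  rewrite mapE; last exact: nu1_cochain.
  by rewrite dx dy n1_x'y n1_xy' n1_xy lmap_dmap_iA.
have nu2E : 2%:R^-1 *: NR (NR nu2 D1) D1 [:: x; y] =
    lmap iB (br x' y') - (lmap dmap (br x' y) + lmap dmap (br x y')).
  rewrite mapE // dx dy g_x'y g_xy' g_xy.
  move: (lmap iB _) (lmap dmap (br x' y)) (lmap dmap (br x y')) => u v w.
  have -> : u - v + (u - w) - (v + w) = 2%:R *: (u - (v + w)).
    by rewrite scaler_nat mulr2n; zmodule (lpoly E : zmodType).
  by rewrite scalerA mulVf // scale1r.
rewrite eM psiE nu1E nu2E ex ey (brDl lc) !(brDr lc) !lmapD // bB.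
move: (lmap iB (br x y)) (lmap iB (br x y')) (lmap iB (br x' y)) (lmap iB (br x' y'))
  (lmap dmap (br x y)) (lmap dmap (br x y')) (lmap dmap (br x' y)) => u1 u2 u3 u4 v1 v2 v3.
zmodule (lpoly E : zmodType).
Qed.

Let gF : graded_space (Fgr A B) := @Fgr_graded K A B.
Let dD1 : dsum (Fgr A B) D1 := dsum_homog gF D1_Fgr.

Lemma mc_Fgr : Fgr A B 1 (psi + NR nu1 D1 + 2%:R^-1 *: NR (NR nu2 D1) D1).
Proof.
rewrite addrC; apply: (gs_lin gF).
  exact: (nu2_Fgr qt K0 D1_Fgr D1_Fgr).
rewrite -[psi]scale1r; apply: (gs_lin gF); first exact: (psi_Fgr qt K0).
exact: (nu1_Fgr qt K0 D1_Fgr).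
Qed.

Lemma right_deformationP : right_deformation_map br D <->
  psi + NR nu1 D1 + 2%:R^-1 *: NR (NR nu2 D1) D1 = 0.
Proof.
have coefE a b m : lcoef ((psi + NR nu1 D1 + 2%:R^-1 *: NR (NR nu2 D1) D1) [:: inA a; inA b]) m =
    inB (prB (lcoef (br (a, D a) (b, D b)) m) - D (prA (lcoef (br (a, D a) (b, D b)) m))).
  have e0 : inB 0 = 0 :> E by [].
  rewrite mc_value lcoefD [lcoef (- _) m](@mcoeffN _ E m).
  rewrite -/(lcoef (lmap dmap _) m) !lcoef_map ?(klin0 dl) ?(klin0 iBl) //.
  move: (lcoef _ m) => c.
  by have -> : inB (prB c - D (prA c)) = (0 - 0, prB c - D (prA c)) by rewrite subr0.
split=> [sub|mc0].
  have [f [cf e]] := mc_Fgr; rewrite e; apply/funext => u.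
  have -> : hat f u = hat f (map inA (map prA u)) by rewrite /hat -!map_comp.
  rewrite -e; case: u => [|x [|y [|z u]]].
  - by rewrite e (co_arity (hat_cochain cf)).
  - by rewrite e (co_arity (hat_cochain cf)).
  - apply: lpolyP => m; rewrite [map _ _]/= coefE.
    have graph z : exists a, (prA z, D (prA z)) = (a, D a) by exists (prA z).
    have [c ec] := cs_br sub m (graph x) (graph y).
    by rewrite ec /= subrr /lcoef mcoeff0.
  by rewrite e (co_arity (hat_cochain cf)).
split.
- by exists 0; rewrite linear0.
- move=> c _ _ [a ->] [b ->]; exists (c *: a + b).
  by have -> : c *: (a, D a) + (b, D b) = (c *: a + b, c *: D a + D b) by []; rewrite linearP.
move=> _ _ m [a ->] [b ->]; have := coefE a b m; rewrite mc0.
have -> : (0 : mcochain E E) [:: inA a; inA b] = 0 by [].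
move: (lcoef (br _ _) m) => [c1 c2]; rewrite /lcoef mcoeff0 => /(congr1 prB) /=.
by move=> /esym /eqP; rewrite subr_eq0 => /eqP ->; exists c1.
Qed.

(** Compares the sums of two different lengths that witness the same
    Maurer-Cartan series. *)
Lemma sum_eventually0 (V : zmodType) (T : nat -> V) n m :
  (forall k, (n <= k)%N -> T k = 0) -> (forall k, (m <= k)%N -> T k = 0) ->
  \sum_(k < n) T k = \sum_(k < m) T k.
Proof.
have h p : (forall k, (p <= k)%N -> T k = 0) -> forall j, \sum_(k < p + j) T k = \sum_(k < p) T k.
  move=> Tp; elim=> [|j IH]; first by rewrite addn0.
  by rewrite addnS big_ord_recr /= IH Tp ?addr0 // leq_addr.
by move=> Tn Tm; rewrite -(h n Tn m) addnC h.
Qed.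

Lemma linf_nseq k : (3 <= k)%N -> linf br (nseq k D1) = 0.
Proof.
move=> le; apply: (linf_3 qt K0); rewrite ?size_nseq // => i lt.
by move: lt; rewrite size_nseq nth_nseq => ->.
Qed.

Lemma maurer_cartanP : maurer_cartan (Fgr A B) (linf br) D1 <->
  linf br [::] + linf br [:: D1] + 2%:R^-1 *: linf br [:: D1; D1] = 0.
Proof.
pose T k := (k`!%:R)^-1 *: linf br (nseq k D1).
have T3 k : (3 <= k)%N -> T k = 0 by move=> le; rewrite /T linf_nseq // scaler0.
have S3 : \sum_(k < 3) T k =
    linf br [::] + linf br [:: D1] + 2%:R^-1 *: linf br [:: D1; D1].
  by rewrite !big_ord_recr big_ord0 /= add0r /T /= !invr1 !scale1r.
rewrite -S3; split=> [[_ [n [v0 e]]]|e].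
  rewrite -[RHS]e; apply: sum_eventually0 T3 _ => k le.
  by rewrite /T v0 // scaler0.
split; first exact: D1_Fgr.
by exists 3; split=> [k|]; [apply: linf_nseq|].
Qed.

Lemma right_deformation_maurer_cartan :
  right_deformation_map br D <-> maurer_cartan (Fgr A B) (linf br) D1.
Proof.
rewrite right_deformationP maurer_cartanP.
by rewrite (linf_0 qt K0) (linf_1 qt K0) // (linf_2 qt K0).
Qed.

End RightDeformation.

Theorem theorem3p20 (R : realType) (A B : lmodType {poly R[i]})
    (fgA : fin_gen A) (fgB : fin_gen B)
    (br : A * B -> A * B -> lpoly (A * B)%type) (qt : quasi_twilled br) :
  let l := linf br in
  Omega br = psi_hat br + nu1_hat br + nu2_hat br /\
  curved_V_data (Lgr A B) (@NR _ _) (Fgr A B) (projF A B) (Omega br) /\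
  curved_Linfty (Fgr A B) l /\
  l [::] = psi_hat br /\
  (forall (m : nat) (f : mcochain A B), (0 < m)%N -> is_cochain m f ->
     l [:: hat f] = NR (nu1_hat br) (hat f)) /\
  (forall (m n : nat) (f g : mcochain A B), (0 < m)%N -> (0 < n)%N ->
     is_cochain m f -> is_cochain n g ->
     l [:: hat f; hat g] = NR (NR (nu2_hat br) (hat f)) (hat g)) /\
  (forall fs : seq (mcochain (A * B)%type (A * B)%type), (3 <= size fs)%N ->
     (forall i, (i < size fs)%N -> dsum (Fgr A B) (nth 0 fs i)) ->
     l fs = 0) /\
  (forall D : {linear A -> B},
     let D1 := hat (cochain1 D) in
     (right_deformation_map br D <-> maurer_cartan (Fgr A B) l D1) /\
     (maurer_cartan (Fgr A B) l D1 <->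
        l [::] + l [:: D1] + 2%:R^-1 *: l [:: D1; D1] = 0)).
Proof.
have K0 n : n.+1%:R != 0 :> R[i] by rewrite Num.Theory.pnatr_eq0.
have gF := @Fgr_graded R[i] A B.
have hatF m f : (0 < m)%N -> is_cochain m f -> dsum (Fgr A B) (hat f).
  case: m => // m _ cf; apply: (dsum_homog gF (n := m)).
  by exists f.
split; first exact: Omega_sum.
split; first exact: curved_V_data_of (Omega_cochain qt) (Omega_square qt).
split; first exact: linf_curved.
split; first exact: linf_0.
split; first by move=> m f m0 cf; apply: (linf_1 qt K0); apply: hatF cf.
split.
  move=> m n f g m0 n0 cf cg; apply: (linf_2 qt K0); first exact: hatF cf.
  exact: hatF cg.
split; first by move=> fs; apply: linf_3.
move=> D; rewrite hat_cochain1; split; last exact: maurer_cartanP.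
exact: right_deformation_maurer_cartan.
Qed.
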